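(* Assume one of the hypotheses H1, H3, H4 spelled out in the context, with associated $r$, $\eta$, $\mathcal{X}$, $\mathcal{Y}$, $Q$. There is a constant $c>0$ depending only on $r$ such that the following holds. Let $0<\tau<1$ and assume $\mathrm{Var}[Q]\le1$ and $\mathrm{Inf}_i^{\le\log(1/\tau)/K}(Q)\le\tau$ for all $i$, where $$K=\begin{cases}\log(1/\eta)&\text{under H1},\\ \log(1/\alpha)&\text{under H3},\\ 1&\text{under H4}.\end{cases}$$ Given $0<\gamma<1$, write $R=(T_{1-\gamma}Q)(\mathcal{X})$ and $S=(T_{1-\gamma}Q)(\mathcal{Y})$. Then $$d_L(R,S)\le\tau^{c\gamma/K},\qquad \bigl|\mathbf{E}[\zeta(R)]-\mathbf{E}[\zeta(S)]\bigr|\le\tau^{c\gamma/K}.$$ More generally, the same conclusions hold for $R=Q(\mathcal{X})$, $S=Q(\mathcal{Y})$ if $\mathrm{Var}[Q^{>d}]\le(1-\gamma)^{2d}$ for all $d$.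
   Context: Lévy metric: $d_L(R,S)=\inf\{\lambda>0:\forall t\in\mathbb{R},\ \mathbf{P}[S\le t-\lambda]-\lambda\le\mathbf{P}[R\le t]\le\mathbf{P}[S\le t+\lambda]+\lambda\}$. The function $\zeta:\mathbb{R}\to\mathbb{R}$ is $\zeta(x)=x^2$ for $x\le0$, $0$ for $x\in[0,1]$, $(x-1)^2$ for $x\ge1$. Ensembles. An orthonormal ensemble is a finite collection of real random variables, orthonormal in $L^2$, one of which is the constant $1$. A sequence of ensembles is $\mathcal{X}=(\mathcal{X}_1,\dots,\mathcal{X}_n)$ with $\mathcal{X}_i=\{X_{i,0}=1,X_{i,1},\dots,X_{i,m_i}\}$ orthonormal ensembles, where $\mathcal{X}_1,\dots,\mathcal{X}_n$ are independent families of random variables; similarly $\mathcal{Y}$ with variables $Y_{i,j}$ (same index sets). Polynomials. A multi-index is $\sigma=(\sigma_1,\dots,\sigma_n)\in\mathbb{N}^n$ ($0\in\mathbb{N}$); $|\sigma|=\#\{i:\sigma_i>0\}$; $x_\sigma=\prod_{i=1}^n x_{i,\sigma_i}$. A multilinear polynomial is $Q(x)=\sum_\sigma c_\sigma x_\sigma$ with real $c_\sigma$, finitely many nonzero (only indices occurring in the ensembles are used). $Q(\mathcal{X})$ is the random variable obtained by substituting $X_{i,j}$ for $x_{i,j}$. $Q^{>d}(x)=\sum_{|\sigma|>d}c_\sigma x_\sigma$; $\mathrm{Var}[Q]=\sum_{|\sigma|>0}c_\sigma^2$; $\mathrm{Inf}_i^{\le d}(Q)=\sum_{|\sigma|\le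 d,\ \sigma_i>0}c_\sigma^2$ (for real $d\ge 0$); $(T_\rho Q)(x)=\sum_\sigma\rho^{|\sigma|}c_\sigma x_\sigma$. Hypercontractivity. For $1\le p\le q<\infty$, $0<\eta<1$, $\mathcal{X}$ is $(p,q,\eta)$-hypercontractive if $\|(T_\eta Q)(\mathcal{X})\|_q\le\|Q(\mathcal{X})\|_p$ for every multilinear polynomial $Q$ over $\mathcal{X}$. Hypotheses ($Q$ is a multilinear polynomial in each): H1: $r\ge3$ is an integer; $\mathcal{X},\mathcal{Y}$ are (independent) sequences of $n$ ensembles which are $(2,r,\eta)$-hypercontractive (so $\eta\le(r-1)^{-1/2}$); and for all $i$ and all finite multisets $\Sigma$ of indices with $|\Sigma|<r$, $\mathbf{E}[\prod_{\sigma\in\Sigma}X_{i,\sigma}]=\mathbf{E}[\prod_{\sigma\in\Sigma}Y_{i,\sigma}]$. H3: $r=3$; the variables of $\mathcal{X}_i$ form a basis of the real-valued functions on a finite probability space $\Omega_i$; the least nonzero probability of any atom in any $\Omega_i$ is $\alpha\le1/2$; $\eta=\frac12\alpha^{1/6}$; $\mathcal{Y}$ is any $(2,3,\eta)$-hypercontractive sequence of $n$ ensembles. H4: $r=4$, $\eta=3^{-1/2}$; each ensemble of $\mathcal{X}$ and $\mathcal{Y}$ has only two variables, $1$ and $X_i$ (resp. $1$ and $Y_i$), and each $X_i$ and each $Y_i$ is either a uniform $\pm1$ bit, a standard Gaussian, or uniform on $[-\sqrt3,\sqrt3]$. *)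

(* Defs.v *)
From HB Require Import structures.
From mathcomp Require Import all_boot all_order all_algebra.
From mathcomp Require Import all_classical all_reals all_analysis.

Set Implicit Arguments.
Unset Strict Implicit.
Unset Printing Implicit Defensive.

Import Order.TTheory GRing.Theory Num.Theory.
Import numFieldNormedType.Exports.

Local Open Scope classical_set_scope.
Local Open Scope ring_scope.

(* In this development [m i] is the number of nonconstant variables of the
   i-th ensemble, whose variables are indexed by 'I_(m i).+1 with [ord0] the
   index of the constant 1. *)

Section MultilinearPolynomials.
Context {R : realType} {n : nat}.
Implicit Type m : 'I_n -> nat.

Definition multi_index m := {dffun forall i : 'I_n, 'I_(m i).+1}.

Definition msupp_size m (s : multi_index m) : nat :=
  #|[pred i : 'I_n | s i != ord0]|.

(* A multilinear polynomial is given by its coefficients c_sigma. *)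
Definition mlpoly m := multi_index m -> R.

Definition mlpoly_gt m (d : nat) (Q : mlpoly m) : mlpoly m :=
  fun s => if (d < msupp_size s)%N then Q s else 0.

Definition mlpoly_var m (Q : mlpoly m) : R :=
  \sum_(s : multi_index m | (0 < msupp_size s)%N) Q s ^+ 2.

Definition mlpoly_inf_le m (d : R) (i : 'I_n) (Q : mlpoly m) : R :=
  \sum_(s : multi_index m | ((msupp_size s)%:R <= d) && (s i != ord0))
    Q s ^+ 2.

Definition noise_op m (rho : R) (Q : mlpoly m) : mlpoly m :=
  fun s => rho ^+ msupp_size s * Q s.

End MultilinearPolynomials.

Arguments mlpoly R {n} m.

Section Ensembles.
Context {R : realType} {d : measure_display} {T : measurableType d}.
Variable P : probability T R.

Definition orthonormal_ensemble (k : nat) (X : 'I_k.+1 -> {RV P >-> R}) : Prop :=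
  [/\ forall w, X ord0 w = 1,
      forall j, (X j : T -> R) \in Lfun P 2%:E
    & forall j l, 'E_P[fun w => (X j w * X l w)%R]%E = ((j == l)%:R)%:E].

Definition generated_sigma (I : Type) (X : I -> {RV P >-> R}) : set (set T) :=
  <<s \bigcup_i preimage_set_system setT (X i : T -> R) measurable >>.

Definition mutually_independent (I : finType) (F : I -> set (set T)) : Prop :=
  forall (J : {set I}) (A : I -> set T), (forall i, i \in J -> F i (A i)) ->
    P (\bigcap_(i in [set i | i \in J]) A i) = (\prod_(i in J) P (A i))%E.

Section Sequences.
Context {n : nat} {m : 'I_n -> nat}.

Definition rv_families := forall i : 'I_n, 'I_(m i).+1 -> {RV P >-> R}.

Definition ensemble_seq (X : rv_families) : Prop :=
  (forall i, orthonormal_ensemble (X i)) /\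
  mutually_independent (fun i => generated_sigma (X i)).

Definition all_vars (X : rv_families) (u : {i : 'I_n & 'I_(m i).+1}) :
  {RV P >-> R} := X (projT1 u) (projT2 u).

Definition independent_seqs (X Y : rv_families) : Prop :=
  forall A B : set T, generated_sigma (all_vars X) A ->
    generated_sigma (all_vars Y) B -> P (A `&` B) = (P A * P B)%E.

Definition mlpoly_eval (Q : mlpoly R m) (X : rv_families) : T -> R :=
  fun w => \sum_(s : multi_index m) Q s * \prod_(i < n) X i (s i) w.

Definition hypercontractive (p q eta : R) (X : rv_families) : Prop :=
  [/\ 1 <= p, p <= q, 0 < eta < 1
    & forall Q : mlpoly R m,
        ('N[P]_(q%:E) [EFin \o mlpoly_eval (noise_op eta Q) X] <=
         'N[P]_(p%:E) [EFin \o mlpoly_eval Q X])%E].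

End Sequences.
End Ensembles.

Arguments rv_families {R d T} P {n} m.

Record fin_prob_space (R : realType) := FinProbSpace {
  atom :> finType;
  mass : atom -> R;
  mass_ge0 : forall a, 0 <= mass a;
  mass_sum1 : \sum_a mass a = 1 }.

Section Hypotheses.
Context {R : realType} {d : measure_display} {T : measurableType d}.
Variable P : probability T R.

(* The variables live on the ambient space T, so they are functions f_j of a
   random point W of law [mass] in the finite space Om.  As orthonormal
   families in L^2(Om) can only span functions modulo null sets, functions on
   Om are compared on atoms of nonzero probability. *)
Definition basis_of_functions (Om : fin_prob_space R) (k : nat)
    (X : 'I_k.+1 -> {RV P >-> R}) : Prop :=
  exists (W : T -> Om) (f : 'I_k.+1 -> Om -> R),
  [/\ forall a : Om, measurable (W @^-1` [set a]) /\
                     P (W @^-1` [set a]) = (mass a)%:E,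
      forall j w, X j w = f j (W w)
    & forall g : Om -> R, exists! b : {ffun 'I_k.+1 -> R},
        forall a : Om, mass a != 0 -> g a = \sum_j b j * f j a].

Lemma oppsqrt3_lt : - Num.sqrt 3 < Num.sqrt 3 :> R.
Proof. by apply: (@lt_trans _ _ 0); rewrite ?oppr_lt0 sqrtr_gt0. Qed.

Definition uniform_bit (X : {RV P >-> R}) : Prop :=
  distribution P X [set 1] = (2^-1)%:E /\ distribution P X [set -1] = (2^-1)%:E.

Definition standard_gaussian (X : {RV P >-> R}) : Prop :=
  forall A : set R, measurable A -> distribution P X A = normal_prob 0 1 A.

Definition uniform_sqrt3 (X : {RV P >-> R}) : Prop :=
  forall A : set R, measurable A -> distribution P X A = uniform_prob oppsqrt3_lt A.

Context {n : nat} {m : 'I_n -> nat}.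
Implicit Types X Y : rv_families P m.

(* Finite multisets of indices are represented by sequences. *)
Definition matching_moments (r : nat) X Y : Prop :=
  forall (i : 'I_n) (s : seq 'I_(m i).+1), (size s < r)%N ->
    'E_P[fun w => (\prod_(j <- s) X i j w)%R]%E =
    'E_P[fun w => (\prod_(j <- s) Y i j w)%R]%E.

Definition hypothesis_H1 (r : nat) (eta : R) X Y : Prop :=
  [/\ (3 <= r)%N,
      independent_seqs X Y,
      hypercontractive 2 r%:R eta X,
      hypercontractive 2 r%:R eta Y
    & matching_moments r X Y].

Definition hypothesis_H3 (r : nat) (eta alpha : R) X Y : Prop :=
  [/\ r = 3%N,
      exists Om : 'I_n -> fin_prob_space R,
        [/\ forall i, basis_of_functions (Om i) (X i),
            exists i, exists a : Om i, mass a != 0 /\ mass a = alpha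
          & forall i (a : Om i), mass a != 0 -> alpha <= mass a],
      alpha <= 2^-1,
      eta = 2^-1 * alpha `^ (6^-1)
    & hypercontractive 2 3 eta Y].

Definition H4_variable (X : {RV P >-> R}) : Prop :=
  [\/ uniform_bit X, standard_gaussian X | uniform_sqrt3 X].

Definition hypothesis_H4 (r : nat) (eta : R) X Y : Prop :=
  [/\ r = 4%N,
      eta = (Num.sqrt 3)^-1,
      forall i, m i = 1%N
    & forall i (j : 'I_(m i).+1), j != ord0 ->
        H4_variable (X i j) /\ H4_variable (Y i j)].

Definition hypothesis_H134 (r : nat) X Y (K : R) : Prop :=
  exists eta : R,
  [\/ hypothesis_H1 r eta X Y /\ K = ln eta^-1,
      exists alpha : R, hypothesis_H3 r eta alpha X Y /\ K = ln alpha^-1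
    | hypothesis_H4 r eta X Y /\ K = 1].

Definition levy_dist (U V : T -> R) : R :=
  inf [set l : R | 0 < l /\ forall t : R,
    (P [set w | V w <= t - l]%R - l%:E <= P [set w | U w <= t]%R)%E /\
    (P [set w | U w <= t]%R <= P [set w | V w <= t + l]%R + l%:E)%E].

Definition zeta (x : R) : R :=
  if x <= 0 then x ^+ 2 else if x <= 1 then 0 else (x - 1) ^+ 2.

Definition close_laws (eps : R) (U V : T -> R) : Prop :=
  levy_dist U V <= eps /\
  (`| 'E_P[zeta \o U] - 'E_P[zeta \o V] | <= eps%:E)%E.

End Hypotheses.

(* Main.v *)
(* Third absolute moments suffice: under H1 one passes from r to 3, and under H3
   and H4 the variables have fourth moments, from which (2, 3)-hypercontractivity
   is proved by Bonami's induction on the coordinates.  Moments of order at most 2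
   match by orthonormality.  The sequences X and Y, made independent on a product
   space, are exchanged one ensemble at a time (Lindeberg).  The only test
   functions needed are (x - k)_+^3: the Taylor remainders are bounded by third
   moments of hypercontractive polynomials, so by powers of the influences, and the
   indicators of half-lines as well as zeta (up to a quadratic, whose expectation is
   the same on both sides) are approximated by combinations of such functions.
   The polynomial is first truncated at a degree proportional to log(1/tau) / K.
   The multiplicative constants are absorbed in the exponent, because both
   quantities to be bounded never exceed 9/10: this follows from equality of the
   first two moments. *)

Require Import Defs.
From HB Require Import structures.
From mathcomp Require Import all_boot all_order all_algebra.
From mathcomp Require Import all_classical all_reals all_analysis.
From mathcomp Require Import measurable_realfun.
From mathcomp Require Import ring lra.
Set Implicit Arguments.
Unset Strict Implicit.
Unset Printing Implicit Defensive.
Import Order.TTheory GRing.Theory Num.Theory.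
Import numFieldNormedType.Exports.
Local Open Scope classical_set_scope.
Local Open Scope ring_scope.

(** The conclusion carries no multiplicative constant, so every numerical loss has to end up in [c].
    This allows crude hypercontractivity constants, [alpha / 2] under H3 and [1/8] under H4,
    provided that [eta^-1 <= expR (7 * K)]; but it also requires a positive lower bound on [K].
    Under H1, where [K = ln eta^-1], that bound is not assumed: hypercontractivity itself forces
    [eta <= 9/10] once a nonconstant variable exists, and without one the two random variables
    coincide. The scales are fixed by a number [z], of which the target bound is a small power.
    Means of cubes agree up to [2 z^4], and truncation costs at most [4 z^4] in [L^2]; smoothing an
    indicator at scale [2 z] divides the first error by a multiple of [z^3] and leaves a multiple of
    [z]. Hypercontractivity passes to hybrids and to more coordinates by Minkowski's inequality for
    [L^(3/2)] and [L^2] norms of sums of squares. It is used as a pointwise inequality whose weights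
    are the norms of the coefficients, so that its right-hand side is linear in the powers to be
    integrated. *)

Section RealInequalities.
Context {R : realType}.
Implicit Types a b c h f e p q s t u x : R.

(** * Elementary inequalities and the test functions built from [x_+^3] *)

Definition pospart x : R := Num.max x 0.

Lemma pospart_id x : 0 <= x -> pospart x = x.
Proof. by move=> x0; rewrite /pospart max_l. Qed.

Lemma pospart_eq0 x : x <= 0 -> pospart x = 0.
Proof. by move=> x0; rewrite /pospart max_r. Qed.

Variant pospart_spec x : R -> Type :=
  | PosPartPos of 0 <= x : pospart_spec x x
  | PosPartNeg of x < 0 : pospart_spec x 0.

Lemma pospartP x : pospart_spec x (pospart x).
Proof.
by rewrite /pospart; case: (ltP x 0) => x0; constructor.
Qed.

Lemma pospart_ge0 x : 0 <= pospart x.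
Proof. by case: pospartP. Qed.

Lemma pospart_le_norm x : pospart x <= `|x|.
Proof. by case: pospartP => // x0; rewrite ger0_norm. Qed.

(* Second-order Taylor expansion of [x_+^3]; this is the only test function for
   which the replacement argument is carried out. *)
Lemma pospart_cube_taylor a h :
  `|pospart (a + h) ^+ 3 - pospart a ^+ 3 - 3 * pospart a ^+ 2 * h
    - 3 * pospart a * h ^+ 2| <= `|h| ^+ 3.
Proof.
case: (pospartP a) => a0; case: (pospartP (a + h)) => ah0.
- have -> : (a + h) ^+ 3 - a ^+ 3 - 3 * a ^+ 2 * h - 3 * a * h ^+ 2 = h ^+ 3.
    by ring.
  by rewrite normrX.
- have -> : 0 ^+ 3 - a ^+ 3 - 3 * a ^+ 2 * h - 3 * a * h ^+ 2
            = (- (a + h)) ^+ 3 - (- h) ^+ 3 by ring.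
  have u0 : 0 <= - (a + h) by rewrite oppr_ge0 ltW.
  have uh : - (a + h) <= - h by rewrite opprD gerDr oppr_le0.
  have h0 : 0 <= - h by exact: le_trans uh.
  rewrite -(normrN h) (ger0_norm h0) distrC ger0_norm ?subr_ge0 ?lerXn2r//.
  by rewrite gerBl exprn_ge0.
- rewrite !expr0n/= !(mulr0, mul0r, subr0).
  by rewrite normrX lerXn2r ?nnegrE// !ger0_norm//; lra.
- by rewrite !expr0n/= !(mulr0, mul0r, subr0) normr0 exprn_ge0.
Qed.

(* The difference of the two sides is [2 (e f)^2 (a - e f)^2]. *)
Lemma fourth_power_expansion a e f :
  (a + e * f) ^+ 4 <= a ^+ 4 + 4 * e * (a ^+ 3 * f)
                      + 8 * e ^+ 2 * (a ^+ 2 * f ^+ 2) + 3 * e ^+ 4 * f ^+ 4.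
Proof.
rewrite -subr_ge0; set lhs := (X in 0 <= X).
have -> : lhs = 2 * (e * f * (a - e * f)) ^+ 2 by rewrite /lhs; ring.
by rewrite mulr_ge0// sqr_ge0.
Qed.

(** The tangent bound [b^2 / w >= 2 th b - th^2 w] is summed at the optimal slope [th = B / W].
    Since [x / 0 = 0], a term of zero weight has to be assumed zero. With [b] a square and [w] the
    squared norm of a coefficient, integration yields Minkowski's inequality in [L^2]. *)
Lemma cauchy_schwarz_weighted (I : finType) (P : pred I) (b w : I -> R) :
  (forall i, 0 <= w i) -> (forall i, w i = 0 -> b i = 0) ->
  (\sum_(i | P i) b i) ^+ 2
    <= (\sum_(i | P i) w i) * \sum_(i | P i) (b i ^+ 2 / w i).
Proof.
move=> w0 wb; set W := \sum_(i | P i) w i; set B := \sum_(i | P i) b i.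
have W0 : 0 <= W by exact: sumr_ge0.
have [W00|Wn0] := eqVneq W 0.
  suff -> : B = 0 by rewrite expr0n/= W00 mul0r.
  rewrite /B big1// => i Pi; apply: wb; apply: le_anti; rewrite w0 andbT.
  by rewrite -W00 /W (bigD1 i)//= lerDl sumr_ge0.
have Wgt : 0 < W by rewrite lt_neqAle eq_sym Wn0.
set th := B / W.
have : \sum_(i | P i) (2 * th * b i - th ^+ 2 * w i) <=
       \sum_(i | P i) (b i ^+ 2 / w i).
  apply: ler_sum => i _; have [wi|wi] := eqVneq (w i) 0.
    by rewrite wi (wb _ wi) invr0 !mulr0 subr0.
  have wi0 : 0 < w i by rewrite lt_neqAle eq_sym wi w0.
  rewrite ler_pdivlMr// -subr_ge0.
  have -> : b i ^+ 2 - (2 * th * b i - th ^+ 2 * w i) * w i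
            = (b i - th * w i) ^+ 2 by ring.
  exact: sqr_ge0.
rewrite sumrB -!mulr_sumr -/B -/W => /(ler_wpM2l W0); apply: le_trans.
by rewrite /th; apply/eqP/eqP; rewrite le_eqVlt; apply/orP; left; apply/eqP; field.
Qed.

Lemma cube_tangent p q : 0 <= p -> 0 <= q -> 3 * p ^+ 2 * q <= 2 * p ^+ 3 + q ^+ 3.
Proof.
move=> p0 q0; rewrite -subr_ge0; set lhs := (X in 0 <= X).
have -> : lhs = (p - q) ^+ 2 * (2 * p + q) by rewrite /lhs; ring.
by rewrite mulr_ge0 ?sqr_ge0// addr_ge0// mulr_ge0.
Qed.

(* Hoelder with exponents 3/2 and 3; integrated, it is Minkowski's inequality
   in L^(3/2) for the squares [g i ^+ 2]. *)
Lemma hoelder_three_halves (I : finType) (P : pred I) (g a : I -> R) :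
  (forall i, 0 <= a i) -> (forall i, a i = 0 -> g i = 0) ->
  Num.sqrt (\sum_(i | P i) g i ^+ 2) ^+ 3
    <= Num.sqrt (\sum_(i | P i) a i ^+ 2) * \sum_(i | P i) (`|g i| ^+ 3 / a i).
Proof.
move=> a0 ag; set W := \sum_(i | P i) a i ^+ 2.
set G := \sum_(i | P i) g i ^+ 2.
have W0 : 0 <= W by apply: sumr_ge0 => i _; exact: sqr_ge0.
have G0 : 0 <= G by apply: sumr_ge0 => i _; exact: sqr_ge0.
have [W00|Wn0] := eqVneq W 0.
  suff -> : G = 0 by rewrite sqrtr0 expr0n/= W00 sqrtr0 mul0r.
  rewrite /G big1// => i Pi; rewrite ag ?expr0n//; apply/eqP.
  rewrite -sqrf_eq0; apply/eqP; apply: le_anti; rewrite sqr_ge0 andbT.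
  by rewrite -W00 /W (bigD1 i)//= lerDl sumr_ge0// => k _; exact: sqr_ge0.
have Wgt : 0 < W by rewrite lt_neqAle eq_sym Wn0.
set w := Num.sqrt W; set y := Num.sqrt G.
have wgt : 0 < w by rewrite sqrtr_gt0.
have y0 : 0 <= y by exact: sqrtr_ge0.
have wE : W = w ^+ 2 by rewrite sqr_sqrtr.
have yE : G = y ^+ 2 by rewrite sqr_sqrtr.
set th := y / w; have th0 : 0 <= th by rewrite divr_ge0// ltW.
(* Termwise this is [cube_tangent] at [p = |g i|] and [q = th * a i], divided by [2 * a i]. The
   slope [th = y / w] turns the summed left-hand side, multiplied by [w], into exactly [y^3]. *)
have : \sum_(i | P i) (3 / 2 * th * g i ^+ 2 - th ^+ 3 / 2 * a i ^+ 2) <=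
       \sum_(i | P i) (`|g i| ^+ 3 / a i).
  apply: ler_sum => i _; have [ai|ai] := eqVneq (a i) 0.
    by rewrite ai (ag _ ai) invr0 expr0n/= !mulr0 subr0.
  have ai0 : 0 < a i by rewrite lt_neqAle eq_sym ai a0.
  rewrite ler_pdivlMr//.
  have := cube_tangent (normr_ge0 (g i)) (mulr_ge0 th0 (a0 i)).
  by rewrite real_normK ?num_real//; lra.
rewrite sumrB -!mulr_sumr -/G -/W => /(ler_wpM2l (ltW wgt)); apply: le_trans.
rewrite wE yE /th le_eqVlt; apply/orP; left; apply/eqP.
by field; rewrite gt_eqF.
Qed.

Lemma sqrM_le_cubes a b : 0 <= a -> 0 <= b -> a ^+ 2 * b <= a ^+ 3 + b ^+ 3.
Proof.
move=> a0 b0; have := cube_tangent a0 b0.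
have : 0 <= a ^+ 3 by exact: exprn_ge0.
have : 0 <= b ^+ 3 by exact: exprn_ge0.
lra.
Qed.

Lemma mul3_le_cubes a b c : 0 <= a -> 0 <= b -> 0 <= c ->
  a * b * c <= a ^+ 3 + b ^+ 3 + c ^+ 3.
Proof.
move=> a0 b0 c0.
have H (x y : R) : 0 <= x -> 0 <= y -> 0 <= x ^+ 3 /\ 0 <= y ^+ 3 by split; exact: exprn_ge0.
have [A B] := H _ _ a0 b0; have [_ C] := H _ _ a0 c0.
have h : 2 * (a * b * c) <= a ^+ 2 * c + b ^+ 2 * c.
  rewrite -subr_ge0.
  have -> : a ^+ 2 * c + b ^+ 2 * c - 2 * (a * b * c) = (a - b) ^+ 2 * c by ring.
  by rewrite mulr_ge0 ?sqr_ge0.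
have := sqrM_le_cubes a0 c0; have := sqrM_le_cubes b0 c0; lra.
Qed.

(** The arithmetic-geometric mean inequality for [s f^2] and [f^4 / s]. With [s] an [L^2] norm it
    converts a fourth moment bound into one for the third. *)
Lemma cube_norm_le_sqr_fourth f s : 0 < s ->
  `|f| ^+ 3 <= 2^-1 * (s * f ^+ 2 + f ^+ 4 / s).
Proof.
move=> s0; rewrite -(ler_pM2r s0).
have -> : 2^-1 * (s * f ^+ 2 + f ^+ 4 / s) * s
   = 2^-1 * (s ^+ 2 * `|f| ^+ 2 + `|f| ^+ 4).
  rewrite real_normK ?num_real// (_ : `|f| ^+ 4 = f ^+ 4); last first.
    by rewrite -normrX ger0_norm// exprn_even_ge0.
  by field; rewrite gt_eqF.
have : 0 <= (`|f| * (s - `|f|)) ^+ 2 by exact: sqr_ge0.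
by lra.
Qed.

(** Keeping the term [3 u^2] makes the mean of the left side grow with the variance of [u]; this is
    what later keeps [eta] away from 1. *)
Lemma cube_norm_add1 u : 1 + 3 * u + 3 * u ^+ 2 - `|u| ^+ 3 <= `|1 + u| ^+ 3.
Proof.
rewrite -[leRHS]normrX; apply: le_trans (ler_norm _).
have : - u ^+ 3 <= `|u| ^+ 3 by rewrite -normrX -normrN ler_norm.
have -> : (1 + u) ^+ 3 = 1 + 3 * u + 3 * u ^+ 2 + u ^+ 3 by ring.
lra.
Qed.

(* The integral of the quadratic B-spline with knots 0, 1, 2, 3. *)
Definition smooth_step x : R :=
  (pospart x ^+ 3 - 3 * pospart (x - 1) ^+ 3 + 3 * pospart (x - 2) ^+ 3
   - pospart (x - 3) ^+ 3) / 6.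

Lemma smooth_step0 x : x <= 0 -> smooth_step x = 0.
Proof.
move=> x0; rewrite /smooth_step.
by rewrite !pospart_eq0 ?expr0n/= ?(mulr0, subr0, addr0, mul0r)//; lra.
Qed.

Lemma smooth_step1 x : 3 <= x -> smooth_step x = 1.
Proof.
by move=> x3; rewrite /smooth_step !pospart_id; [field|lra..].
Qed.

Lemma smooth_step_itv x : 0 <= smooth_step x <= 1.
Proof.
have [x0|x0] := leP x 0; first by rewrite smooth_step0// lexx ler01.
have [x3|x3] := leP 3 x; first by rewrite smooth_step1// lexx ler01.
have cube y : 0 <= y <= 1 -> 0 <= y ^+ 3 <= 1.
  by case/andP=> y0 y1; rewrite exprn_ge0//= exprn_ile1.
rewrite /smooth_step (pospart_id (ltW x0)) (@pospart_eq0 (x - 3)) ?expr0n/=; last lra.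
have [x1|x1] := leP x 1.
  rewrite !pospart_eq0 ?expr0n/=; [|lra..].
  have /cube : 0 <= x <= 1 by lra.
  by lra.
rewrite (@pospart_id (x - 1)); last lra.
(* For [y = x - 1] in [[0, 1]] the numerator is [1 + 3 y + 3 y^2 - 2 y^3]. The two factorizations
   below bound [3 y^2 - 2 y^3] between 0 and 1, after which everything is linear. *)
have [x2|x2] := leP x 2.
  rewrite pospart_eq0 ?expr0n/=; last lra.
  have /cube : 0 <= x - 1 <= 1 by lra.
  have : 0 <= (x - 1) ^+ 2 <= 1.
    by rewrite sqr_ge0 exprn_ile1; lra.
  have : 0 <= (x - 1) ^+ 2 - (x - 1) ^+ 3.
    rewrite (_ : _ - _ = (x - 1) ^+ 2 * (2 - x)); last by ring.
    by rewrite mulr_ge0 ?sqr_ge0//; lra.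
  have : 0 <= 1 - 3 * (x - 1) ^+ 2 + 2 * (x - 1) ^+ 3.
    rewrite (_ : _ + _ = (2 - x) ^+ 2 * (2 * x - 1)); last by ring.
    by rewrite mulr_ge0 ?sqr_ge0//; lra.
  rewrite (_ : x ^+ 3 = 1 + 3 * (x - 1) + 3 * (x - 1) ^+ 2 + (x - 1) ^+ 3); last by ring.
  by move: ((x - 1) ^+ 2) ((x - 1) ^+ 3) => A B; lra.
rewrite pospart_id; last lra.
have /cube : 0 <= 3 - x <= 1 by lra.
rewrite (_ : x ^+ 3 - 3 * (x - 1) ^+ 3 + 3 * (x - 2) ^+ 3 - 0 = 6 - (3 - x) ^+ 3); last by ring.
by lra.
Qed.

(** The quotient is the average of [y_+^2] over [[x - l, x + l]], as [x_+^3 / 3] is a primitive. The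
    error is [l^2 / 3] for [x >= l]; near 0 the average is at most [(2 l)^3 / (6 l)], whence
    [4/3]. *)
Lemma pospart_sqr_smoothing x l : 0 < l ->
  `|(pospart (x + l) ^+ 3 - pospart (x - l) ^+ 3) / (6 * l) - pospart x ^+ 2|
    <= 4 / 3 * l ^+ 2.
Proof.
move=> l0; rewrite -[leLHS](@mulfK _ (6 * l)); last by rewrite gt_eqF//; lra.
rewrite ler_pdivrMr; last lra.
rewrite -[X in _ * X <= _]gtr0_norm; last lra.
rewrite -normrM mulrBl divfK; last by rewrite gt_eqF//; lra.
have [xl|xl] := leP x (- l).
  rewrite !pospart_eq0 ?expr0n/=; [|lra..].
  by rewrite !(subr0, mul0r) normr0 !mulr_ge0 ?exprn_ge0//; lra.
have [lx|lx] := leP l x.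
  rewrite !pospart_id; [|lra..].
  rewrite (_ : _ - _ = 2 * l ^+ 3); last by ring.
  rewrite ger0_norm; last by rewrite mulr_ge0// exprn_ge0// ltW.
  rewrite (_ : _ * _ * (6 * l) = 8 * l ^+ 3); last by field.
  by apply: ler_wpM2r; [rewrite exprn_ge0// ltW|lra].
rewrite (@pospart_id (x + l)) 1?(@pospart_eq0 (x - l)) ?expr0n/= ?subr0; [|lra..].
rewrite (_ : 4 / 3 * _ * _ = (l + l) ^+ 3); last by field.
have h : (x + l) ^+ 3 <= (l + l) ^+ 3 by rewrite lerXn2r ?nnegrE//; lra.
have xl0 : 0 <= (x + l) ^+ 3 by apply: exprn_ge0; lra.
have p0 : 0 <= pospart x ^+ 2 * (6 * l) by rewrite mulr_ge0 ?sqr_ge0//; lra.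
rewrite ler_norml; apply/andP; split; last lra.
have [x0|x0] := leP x 0.
  rewrite (pospart_eq0 x0) expr0n/= mul0r subr0 (le_trans _ xl0)// oppr_le0.
  by rewrite exprn_ge0//; lra.
rewrite (pospart_id (ltW x0)).
have : x ^+ 2 * l <= l ^+ 2 * l.
  by rewrite ler_wpM2r ?lerXn2r// ?nnegrE; lra.
rewrite (_ : (l + l) ^+ 3 = 8 * (l ^+ 2 * l)); last by ring.
by move: (x ^+ 2) => z; lra.
Qed.

(* The difference [x ^+ 2 - zeta x]; unlike [zeta] it is Lipschitz, and the two
   random variables to compare have the same second moment. *)
Definition huberp x : R := pospart x ^+ 2 - pospart (x - 1) ^+ 2.

Lemma zetaE x : zeta x = x ^+ 2 - huberp x.
Proof.
rewrite /zeta /huberp; have [x0|x0] := leP x 0.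
  by rewrite !pospart_eq0 ?expr0n/= ?subr0//; lra.
rewrite (pospart_id (ltW x0)); have [x1|x1] := leP x 1.
  by rewrite pospart_eq0 ?expr0n/= ?subr0 ?subrr//; lra.
by rewrite pospart_id; [ring|lra].
Qed.

Lemma huberp_cases x : [\/ x <= 0 /\ huberp x = 0, 0 <= x <= 1 /\ huberp x = x ^+ 2
  | 1 <= x /\ huberp x = 2 * x - 1].
Proof.
rewrite /huberp; have [x0|x0] := leP x 0.
  by apply: Or31; rewrite !pospart_eq0 ?expr0n/= ?subr0//; lra.
rewrite (pospart_id (ltW x0)); have [x1|x1] := leP x 1.
  by apply: Or32; rewrite pospart_eq0 ?expr0n/= ?subr0 ?(ltW x0)//; lra.
by apply: Or33; split; [exact: ltW|rewrite pospart_id; [ring|lra]].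
Qed.

Lemma huberp_lip x t : `|huberp x - huberp t| <= 2 * `|x - t|.
Proof.
wlog xt : x t / t <= x => [H|].
  have [/H//|/ltW/H] := leP t x.
  by rewrite distrC (distrC t).
rewrite [X in _ <= _ * X]ger0_norm ?subr_ge0//.
have sq (s : R) : 0 <= s <= 1 -> 0 <= s ^+ 2 <= s.
  by case/andP=> s0 s1; rewrite sqr_ge0 /= expr2 ler_piMl.
rewrite ler_norml.
case: (huberp_cases x) => -[x0 ->]; case: (huberp_cases t) => -[t0 ->].
- lra.
- have := sq _ t0; lra.
- lra.
- have := sq _ x0; lra.
- have := sq _ t0; have := sq _ x0.
  have : 0 <= (x - t) * (2 - x - t) by rewrite mulr_ge0; lra.
  have : 0 <= (x - t) * (x + t) by rewrite mulr_ge0; lra.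
  lra.
- have := sq _ x0; have := sqr_ge0 (x - 1); lra.
- lra.
- have := sq _ t0; have := sq (1 - t); have : 0 <= 1 - t <= 1 by lra.
  move=> h /(_ h); lra.
- lra.
Qed.

(** Subtracting [x - 1/2] leaves an even function of [u = x - 1/2], a rounded absolute value: it is
    [|u|] outside [[0, 1]] and [u^2 + 1/4] inside. *)
Lemma huberp_ge x : `|x - 2^-1| <= huberp x - (x - 2^-1) /\
  4^-1 <= huberp x - (x - 2^-1).
Proof.
case: (huberp_cases x) => -[x0 ->].
- by rewrite ler_norml; lra.
- have := sqr_ge0 (x - 2^-1); have := sqr_ge0 x; have := sqr_ge0 (x - 1).
  by rewrite ler_norml; lra.
- by rewrite ler_norml; lra.
Qed.

(** A quadratic majorant with a free parameter, whose mean only involves the first two moments.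
    Outside [[0, 1]] it is [|u| <= (u^2 + s^2) / (2 s)]; inside, [u^2 + 1/4 <= 1/2 <= s / 2]. *)
Lemma huberp_le x s : 1 <= s ->
  huberp x - (x - 2^-1) <= (x - 2^-1) ^+ 2 / (2 * s) + s / 2.
Proof.
move=> s1; set u := x - 2^-1.
have key : `|u| <= u ^+ 2 / (2 * s) + s / 2.
  rewrite -(ler_pM2r (_ : 0 < 2 * s)); last lra.
  have -> : (u ^+ 2 / (2 * s) + s / 2) * (2 * s) = `|u| ^+ 2 + s ^+ 2.
    by rewrite real_normK ?num_real//; field; lra.
  have := sqr_ge0 (`|u| - s).
  by lra.
case: (huberp_cases x) => -[x0 ->].
- by rewrite sub0r; move: key; apply: le_trans; rewrite -normrN ler_norm.
- have -> : x ^+ 2 - u = u ^+ 2 + 4^-1 by rewrite /u; field.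
  have u2 : u ^+ 2 <= 4^-1.
    have : 0 <= x * (1 - x) by rewrite mulr_ge0; lra.
    by rewrite /u; lra.
  have : 0 <= u ^+ 2 / (2 * s) by rewrite divr_ge0 ?sqr_ge0//; lra.
  lra.
- by move: key; apply: le_trans; apply: le_trans (ler_norm _); rewrite /u; lra.
Qed.

End RealInequalities.

(** * Multilinear polynomials *)

Section MergingMultiIndices.
Context {n : nat} {m : 'I_n -> nat}.
Implicit Types (B : pred 'I_n) (s t u : multi_index m).

Definition multi_index0 : multi_index m := [ffun i => ord0].

Definition supported_on B s : bool := [forall i, (s i != ord0) ==> B i].

Definition merge B s t : multi_index m := [ffun i => if B i then t i else s i].

Lemma supported_onP B s :
  reflect (forall i, ~~ B i -> s i = ord0) (supported_on B s).
Proof.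
apply: (iffP forallP) => h i.
  by move=> Bi; apply/eqP; move: (h i); apply: contraLR => /negPf ->.
by apply/implyP; apply: contraR => /h ->.
Qed.

(** A multi-index is determined by its restrictions to [B] and to the complement, each extended by
    [ord0]; [merge] is the inverse bijection. *)
Lemma sum_merge (V : nmodType) B (F : multi_index m -> V) :
  \sum_u F u = \sum_(t | supported_on B t)
               \sum_(s | supported_on (predC B) s) F (merge B s t).
Proof.
rewrite (pair_big_dep _ (fun _ => _) (fun t s => F (merge B s t)))/=.
pose i0 := multi_index0.
rewrite (reindex_onto (fun p : multi_index m * multi_index m => merge B p.2 p.1)
  (fun u => (merge B i0 u, merge B u i0)))/=; last first.
  by move=> u _; apply/ffunP => i; rewrite !ffunE; case: (B i).
apply: eq_bigl => -[t s] /=; apply/eqP/andP => [[<- <-]|[ht hs]].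
  split; apply/supported_onP => i /=; rewrite !ffunE.
    by move=> /negPf ->.
  by rewrite negbK => ->.
congr (_, _); apply/ffunP => i; rewrite !ffunE; case: (boolP (B i)) => // Bi.
  by move/supported_onP: ht => ->.
by move/supported_onP: hs => -> //=; rewrite negbK.
Qed.

Lemma msupp_size_merge B s t :
  supported_on (predC B) s -> supported_on B t ->
  msupp_size (merge B s t) = (msupp_size s + msupp_size t)%N.
Proof.
move=> /supported_onP hs /supported_onP ht.
rewrite /msupp_size -(cardID B) addnC; congr (_ + _)%N; apply: eq_card => i;
  rewrite !inE !ffunE unfold_in; case: (boolP (B i)) => Bi //=.
- by rewrite (hs i)//= negbK.
- by rewrite andbT.
- by rewrite (ht i)// andbF.
Qed.

Lemma msupp_size0 : msupp_size multi_index0 = 0%N.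
Proof. by apply: eq_card0 => i; rewrite !inE ffunE. Qed.

Lemma msupp_size_eq0 s : msupp_size s = 0%N -> s = multi_index0.
Proof.
move=> /card0_eq s0; apply/ffunP => i; rewrite ffunE.
by have := s0 i; rewrite !inE => /negbFE/eqP.
Qed.

Lemma supported_on0 B : supported_on B multi_index0.
Proof. by apply/supported_onP => i _; rewrite ffunE. Qed.

Lemma msupp_size_pred1 k t : supported_on (pred1 k) t ->
  msupp_size t = (t != multi_index0).
Proof.
move=> /supported_onP h; have [->|tn0] := eqVneq t multi_index0.
  exact: msupp_size0.
rewrite /msupp_size/= -(card1 k); apply: eq_card => i.
rewrite !inE; apply/idP/eqP => [|->].
  by apply: contraNeq => /h ->.
apply: contraNneq tn0 => tk; apply/eqP/ffunP => j; rewrite ffunE.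
by have [->//|jk] := eqVneq j k; exact: h.
Qed.

Lemma pred1_supported_neq0 k t : supported_on (pred1 k) t ->
  (t k != ord0) = (t != multi_index0).
Proof.
move=> /supported_onP h; congr (~~ _); apply/eqP/eqP => [tk|->]; last by rewrite ffunE.
apply/ffunP => j; rewrite ffunE.
by have [->//|jk] := eqVneq j k; exact: h.
Qed.

Lemma msupp_size_gt0 s : (0 < msupp_size s)%N = (s != multi_index0).
Proof.
apply/idP/idP => [|s0]; first by apply: contraTneq => ->; rewrite msupp_size0.
by rewrite lt0n; apply: contraNneq s0 => /msupp_size_eq0 ->.
Qed.

End MergingMultiIndices.

(** * Evaluation at points, and coefficients relative to a block of ensembles *)

Section Evaluation.
Context {R : realType} {n : nat} {m : 'I_n -> nat}.
Implicit Types (B : pred 'I_n) (s t u : multi_index m) (Q : mlpoly R m).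

(** Points are deterministic, so the algebraic identities below hold outcome by outcome and involve
    no probability. *)
Definition values := forall i : 'I_n, 'I_(m i).+1 -> R.
Implicit Types x y : values.

Definition monomial x s : R := \prod_(i < n) x i (s i).

Definition eval Q x : R := \sum_s Q s * monomial x s.

Definition sqnorm Q : R := \sum_s Q s ^+ 2.

(* The coefficient of the monomial x_t in Q, seen as a polynomial in the
   variables of the ensembles outside of B. *)
Definition coef B t Q : mlpoly R m :=
  fun s => if supported_on (predC B) s then Q (merge B s t) else 0.

Lemma monomial_merge x B s t : (forall i, x i ord0 = 1) ->
  supported_on (predC B) s -> supported_on B t ->
  monomial x (merge B s t) = monomial x s * monomial x t.
Proof.
move=> x1 /supported_onP hs /supported_onP ht.
rewrite /monomial -big_split; apply: eq_bigr => i _ /=; rewrite ffunE.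
case: ifPn => Bi; first by rewrite hs /= ?negbK// x1 mul1r.
by rewrite ht// x1 mulr1.
Qed.

Lemma monomial0 x : (forall i, x i ord0 = 1) -> monomial x multi_index0 = 1.
Proof. by move=> x1; rewrite /monomial big1// => i _; rewrite ffunE. Qed.

Lemma monomial_supported x y B t : (forall i, x i ord0 = 1) ->
  (forall i, y i ord0 = 1) -> (forall i, B i -> x i = y i) ->
  supported_on B t -> monomial x t = monomial y t.
Proof.
move=> x1 y1 xy /supported_onP ht; apply: eq_bigr => i _.
by have [Bi|Bi] := boolP (B i); [rewrite xy|rewrite ht// x1 y1].
Qed.

Lemma eval_coef B Q x : (forall i, x i ord0 = 1) ->
  eval Q x = \sum_(t | supported_on B t) eval (coef B t Q) x * monomial x t.
Proof.
move=> x1; rewrite /eval (sum_merge B); apply: eq_bigr => t ht.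
rewrite big_distrl [RHS](bigID (supported_on (predC B)))/= [X in _ + X]big1 ?addr0.
  by apply: eq_bigr => s hs; rewrite /coef hs monomial_merge// mulrA.
by move=> s /negPf hs; rewrite /coef hs !mul0r.
Qed.

Lemma sqnorm_ge0 Q : 0 <= sqnorm Q.
Proof. by apply: sumr_ge0 => s _; exact: sqr_ge0. Qed.

Lemma sqnorm_coef B Q :
  sqnorm Q = \sum_(t | supported_on B t) sqnorm (coef B t Q).
Proof.
rewrite /sqnorm (sum_merge B); apply: eq_bigr => t ht.
rewrite [RHS](bigID (supported_on (predC B)))/= [X in _ + X]big1 ?addr0.
  by apply: eq_bigr => s hs; rewrite /coef hs.
by move=> s /negPf hs; rewrite /coef hs expr0n.
Qed.

Lemma sqnorm_eq0 Q s : sqnorm Q = 0 -> Q s = 0.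
Proof.
move=> Q0; apply/eqP; rewrite -sqrf_eq0; apply/eqP/le_anti.
rewrite sqr_ge0 andbT -Q0 /sqnorm (bigD1 s)//= lerDl.
by apply: sumr_ge0 => k _; exact: sqr_ge0.
Qed.

Lemma eval_ext Q Q' x : Q =1 Q' -> eval Q x = eval Q' x.
Proof. by move=> QQ; apply: eq_bigr => s _; rewrite QQ. Qed.

Lemma eval_sqnorm0 Q x : sqnorm Q = 0 -> eval Q x = 0.
Proof. by move=> Q0; apply: big1 => s _; rewrite sqnorm_eq0// mul0r. Qed.

(** The noise operator is a tensor product over the coordinates: a factor [rho] for each index of
    [t], and the same operator on the remaining coordinates. Both inductions on hypercontractivity
    rest on this. *)
Lemma coef_noise_op rho B t Q : supported_on B t ->
  coef B t (noise_op rho Q) =1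
  (fun s => rho ^+ msupp_size t * noise_op rho (coef B t Q) s).
Proof.
move=> ht s; rewrite /coef /noise_op; case: ifPn => hs; last by rewrite !mulr0.
by rewrite msupp_size_merge// exprD mulrCA mulrA.
Qed.

Lemma eval_scale a Q x : eval (fun s => a * Q s) x = a * eval Q x.
Proof. by rewrite /eval mulr_sumr; apply: eq_bigr => s _; rewrite mulrA. Qed.

Lemma eval_add Q Q' x : eval (fun s => Q s + Q' s) x = eval Q x + eval Q' x.
Proof. by rewrite /eval -big_split; apply: eq_bigr => s _; rewrite mulrDl. Qed.

Lemma eval_coef_noise_op rho B t Q x : supported_on B t ->
  eval (coef B t (noise_op rho Q)) x =
  rho ^+ msupp_size t * eval (noise_op rho (coef B t Q)) x.
Proof. by move=> ht; rewrite (eval_ext _ (coef_noise_op _ _ ht)) eval_scale. Qed.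

Lemma eval_coef_supported B t Q x y : (forall i, x i ord0 = 1) ->
  (forall i, y i ord0 = 1) -> (forall i, ~~ B i -> x i = y i) ->
  eval (coef B t Q) x = eval (coef B t Q) y.
Proof.
move=> x1 y1 xy; apply: eq_bigr => s _; rewrite /coef; case: ifPn => hs.
  by congr (_ * _); apply: monomial_supported hs.
by rewrite !mul0r.
Qed.

Lemma noise_opK rho Q : rho != 0 -> noise_op rho (noise_op rho^-1 Q) =1 Q.
Proof.
move=> r0 s; rewrite /noise_op mulrA exprVn mulfV ?mul1r// expf_neq0//.
Qed.

End Evaluation.
Arguments values R {n} m.

(** * Expectation and independence *)

Section Mean.
Context {d : measure_display} {T : measurableType d} {R : realType}.
Variable P : probability T R.
Implicit Types f g : T -> R.

Definition Rintegrable f : Prop := P.-integrable setT (EFin \o f).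

Definition mean f : R := \int[P]_w f w.

Lemma Rintegrable_measurable f : Rintegrable f -> measurable_fun setT f.
Proof. by move=> /measurable_int/measurable_EFinP. Qed.

Lemma Rintegrable_ext f g : f =1 g -> Rintegrable f -> Rintegrable g.
Proof. by move=> /funext ->. Qed.

Lemma mean_ext f g : f =1 g -> mean f = mean g.
Proof. by move=> /funext ->. Qed.

Lemma meanE f : Rintegrable f -> (\int[P]_w (f w)%:E)%E = (mean f)%:E.
Proof. by move=> sf; rewrite /mean /Rintegral fineK//; exact: integrable_fin_num. Qed.

Lemma expectation_mean f : Rintegrable f -> 'E_P[f]%E = (mean f)%:E.
Proof. by move=> sf; rewrite unlock meanE. Qed.

Lemma Rintegrable_cst a : Rintegrable (fun=> a).
Proof. exact: finite_measure_integrable_cst. Qed.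

Lemma integral_cst_probability a : (\int[P]_w a%:E = a%:E)%E.
Proof.
rewrite (integral_cst P measurableT) -[RHS]mule1; congr (_ * _)%E.
exact: probability_setT.
Qed.

Lemma mean_cst a : mean (fun=> a) = a.
Proof. by rewrite /mean /Rintegral integral_cst_probability. Qed.

Lemma RintegrableD f g : Rintegrable f -> Rintegrable g -> Rintegrable (fun w => f w + g w).
Proof. by move=> sf sg; apply: eq_integrable (integrableD measurableT sf sg). Qed.

Lemma RintegrableB f g : Rintegrable f -> Rintegrable g -> Rintegrable (fun w => f w - g w).
Proof. by move=> sf sg; apply: eq_integrable (integrableB measurableT sf sg). Qed.

Lemma RintegrableZ a f : Rintegrable f -> Rintegrable (fun w => a * f w).
Proof. by move=> sf; apply: eq_integrable (integrableZl measurableT a sf). Qed.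

Lemma Rintegrable_sum (I : finType) (A : pred I) (F : I -> T -> R) :
  (forall i, A i -> Rintegrable (F i)) -> Rintegrable (fun w => \sum_(i | A i) F i w).
Proof.
move=> sF; have := integrable_sum measurableT (index_enum I) sF.
by apply: eq_integrable => // w _; rewrite /= sumEFin.
Qed.

Lemma meanD f g : Rintegrable f -> Rintegrable g ->
  mean (fun w => f w + g w) = mean f + mean g.
Proof. exact: RintegralD. Qed.

Lemma meanB f g : Rintegrable f -> Rintegrable g ->
  mean (fun w => f w - g w) = mean f - mean g.
Proof. exact: RintegralB. Qed.

Lemma meanZ a f : Rintegrable f -> mean (fun w => a * f w) = a * mean f.
Proof. exact: RintegralZl. Qed.

Lemma mean_sum (I : finType) (A : pred I) (F : I -> T -> R) :
  (forall i, A i -> Rintegrable (F i)) ->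
  mean (fun w => \sum_(i | A i) F i w) = \sum_(i | A i) mean (F i).
Proof.
move=> sF.
suff : forall r : seq I, Rintegrable (fun w => \sum_(i <- r | A i) F i w) /\
    mean (fun w => \sum_(i <- r | A i) F i w) = \sum_(i <- r | A i) mean (F i).
  by move=> /(_ (index_enum I)) [].
elim=> [|i r [IH1 IH2]].
  split; first by apply: Rintegrable_ext (Rintegrable_cst 0) => w; rewrite big_nil.
  by rewrite big_nil -[RHS](mean_cst 0); apply: mean_ext => w; rewrite big_nil.
have [Ai|Ai] := boolP (A i); last first.
  split; first by apply: Rintegrable_ext IH1 => w; rewrite big_cons (negPf Ai).
  rewrite big_cons (negPf Ai) -IH2; apply: mean_ext => w.
  by rewrite big_cons (negPf Ai).
split.
  by apply: Rintegrable_ext (RintegrableD (sF _ Ai) IH1) => w; rewrite big_cons Ai.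
rewrite big_cons Ai -IH2 -meanD//; last exact: sF.
by apply: mean_ext => w; rewrite big_cons Ai.
Qed.

Lemma le_mean f g : Rintegrable f -> Rintegrable g -> (forall w, f w <= g w) ->
  mean f <= mean g.
Proof. by move=> sf sg fg; apply: le_Rintegral. Qed.

Lemma mean_ge0 f : (forall w, 0 <= f w) -> 0 <= mean f.
Proof. by move=> f0; apply: Rintegral_ge0. Qed.

Lemma Rintegrable_dominated f g : measurable_fun setT f -> Rintegrable g ->
  (forall w, `|f w| <= g w) -> Rintegrable f.
Proof.
move=> mf sg fg; apply: (le_integrable _ _ _ sg) => //; first exact/measurable_EFinP.
by move=> w _; rewrite /= lee_fin (le_trans (fg w))// ler_norm.
Qed.

Lemma Rintegrable_norm f : Rintegrable f -> Rintegrable (fun w => `|f w|).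
Proof.
move=> sf; apply: Rintegrable_ext (fun=> erefl) _.
by have := integrable_abse sf; apply: eq_integrable.
Qed.

Lemma le_norm_mean f : Rintegrable f -> `|mean f| <= mean (fun w => `|f w|).
Proof. by move=> sf; apply: le_normr_Rintegral. Qed.

Lemma Rintegrable_ge0_le f a : measurable_fun setT f -> (forall w, 0 <= f w) ->
  (\int[P]_w (f w)%:E <= a%:E)%E -> Rintegrable f /\ mean f <= a.
Proof.
move=> mf f0 fa; have sf : Rintegrable f.
  apply/integrableP; split; first exact/measurable_EFinP.
  under eq_integral do rewrite /= ger0_norm//.
  by apply: le_lt_trans fa _; exact: ltry.
by split=> //; rewrite -lee_fin -meanE.
Qed.

Lemma Rintegrable_ae_bounded f a (N : set T) : measurable_fun setT f ->
  measurable N -> P N = 0%E -> (forall w, ~ N w -> 0 <= f w <= a) ->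
  Rintegrable f /\ mean f <= a.
Proof.
move=> mf mN PN fa.
have fae : \forall w \ae P, 0 <= f w <= a.
  by exists N; split=> // w /= nf; apply: contrapT => /fa.
(* The complement of a null set is not empty, and at any of its points [a] dominates a nonnegative
   number. *)
have a0 : 0 <= a.
  have [b /andP[fb0 fba]] : exists b, 0 <= f b <= a; last exact: le_trans fba.
  apply: contrapT => nb.
  have NT : N = setT.
    by apply/seteqP; split=> // x _; apply: contrapT => /fa xf; apply: nb; exists x.
  have := probability_setT P; rewrite -NT.
  by move/eqP; rewrite [P N]PN eq_sym onee_eq0.
have fa' : (\int[P]_w `|(f w)%:E| <= a%:E)%E.
  rewrite -(integral_cst_probability a); apply: ae_ge0_le_integral => //.
  - by apply: measurableT_comp => //; exact/measurable_EFinP.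
  - by apply: filterS fae => w /= /andP[f0 fl] _; rewrite lee_fin ger0_norm.
have sf : Rintegrable f.
  apply/integrableP; split; first exact/measurable_EFinP.
  by apply: le_lt_trans fa' _; exact: ltry.
split=> //; rewrite -lee_fin -meanE//; apply: le_trans fa'.
by apply: le_trans (lee_abs _) _; apply: le_abse_integral => //; exact/measurable_EFinP.
Qed.

End Mean.

(** * Products of functions measurable for independent systems of sets *)

Section IndependentProducts.
Context {d : measure_display} {T : measurableType d} {R : realType}.
Variable P : probability T R.
Implicit Types (f g : T -> R) (F G : set (set T)).

Definition independent_systems F G : Prop :=
  forall A B, F A -> G B -> P (A `&` B) = (P A * P B)%E.

Definition measurable_wrt F f : Prop :=
  forall U : set R, measurable U -> F (f @^-1` U).

(** On rectangles the law of [(f, g)] agrees with the product of the two laws, so they are equal by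
    uniqueness of product measures. Tonelli, applied to [|f g|], then gives integrability, and
    Fubini the value of the mean. *)
Lemma independent_product F G f g :
  F `<=` measurable -> G `<=` measurable -> independent_systems F G ->
  measurable_wrt F f -> measurable_wrt G g -> Rintegrable P f -> Rintegrable P g ->
  Rintegrable P (fun w => f w * g w) /\
  mean P (fun w => f w * g w) = mean P f * mean P g.
Proof.
move=> Fm Gm FG Ff Gg sf sg.
have mf := Rintegrable_measurable sf; have mg := Rintegrable_measurable sg.
have mh : measurable_fun setT (fun w => (f w, g w)) by exact: measurable_fun_pair.
pose X : {RV P >-> R} := mfun_Sub (mem_set mf).
pose Y : {RV P >-> R} := mfun_Sub (mem_set mg).
pose Z : {RV P >-> (R * R)%type} := mfun_Sub (mem_set mh).
have XE : X = f :> (T -> R) by [].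
have YE : Y = g :> (T -> R) by [].
have ZE : Z = (fun w => (f w, g w)) :> (T -> (R * R)%type) by [].
have lawE (A : set (R * R)) : measurable A ->
    (distribution P X \x distribution P Y)%E A = distribution P Z A.
  apply: (@product_measure_unique _ _ _ _ _ _ _ (distribution P Z)) => U V mU mV.
  by rewrite /distribution /pushforward -FG//; [exact: Ff|exact: Gg].
have mmul : measurable_fun [set: R * R] (fun p : R * R => (p.1 * p.2)%:E).
  by apply/measurable_EFinP; exact: measurable_funM.
have ge0E (h : R * R -> \bar R) : measurable_fun setT h -> (forall p, 0 <= h p)%E ->
    (\int[P]_w h (f w, g w) = \int[P]_w \int[P]_v h (f w, g v))%E.
  move=> mh' h0.
  rewrite -(@ge0_integral_distribution _ _ _ _ _ P Z h)//.
  rewrite -(eq_measure_integral _ (fun A mA _ => lawE A mA)).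
  rewrite fubini_tonelli1// -[RHS](@ge0_integral_distribution _ _ _ _ _ P X (fun x => \int[P]_v h (x, g v))%E).
  - by apply: eq_integral => x _; rewrite /fubini_F (@ge0_integral_distribution _ _ _ _ _ P Y)//; exact: measurableT_comp.
  - have := measurable_fun_fubini_tonelli_F (m2 := distribution P Y) h mh' h0.
    congr measurable_fun; apply/funext => x; rewrite /fubini_F.
    by rewrite (@ge0_integral_distribution _ _ _ _ _ P Y)//; exact: measurableT_comp.
  - by move=> y; exact: integral_ge0.
have sfg : Rintegrable P (fun w => f w * g w).
  apply/integrableP; split; first by apply/measurable_EFinP; exact: measurable_funM.
  rewrite /= (ge0E (fun p => `|(p.1 * p.2)%:E|%E))//; last exact: measurableT_comp.
  have mnf : measurable_fun [set: T] (fun w => `|f w|%:E).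
    by apply/measurable_EFinP; exact: measurableT_comp.
  have mng : measurable_fun [set: T] (fun w => `|g w|%:E).
    by apply/measurable_EFinP; exact: measurableT_comp.
  have inner w : (\int[P]_v `|(f w * g v)%:E| = `|f w|%:E * \int[P]_v `|g v|%:E)%E.
    rewrite -ge0_integralZl//.
    by apply: eq_integral => v _; rewrite /= normrM EFinM.
  rewrite /= (eq_integral (fun w => `|f w|%:E * \int[P]_v `|g v|%:E)%E); last first.
    by move=> w _; exact: inner.
  rewrite ge0_integralZr//; last exact: integral_ge0.
  case/integrableP: sf => _ /= sf; case/integrableP: sg => _ /= sg.
  by rewrite lte_mul_pinfty ?integral_ge0// ge0_fin_numE ?integral_ge0.
split => //; apply: EFin_inj; rewrite -meanE//.
have lawi : (distribution P X \x distribution P Y)%E.-integrable setT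
    (fun p : R * R => (p.1 * p.2)%:E).
  apply/integrableP; split => //.
  rewrite (eq_measure_integral _ (fun A mA _ => lawE A mA)).
  rewrite (@ge0_integral_distribution _ _ _ _ _ P Z)//; last exact: measurableT_comp.
  by case/integrableP: sfg.
rewrite -(@integral_distribution _ _ _ _ _ P Z (fun p => (p.1 * p.2)%:E))//.
rewrite -(eq_measure_integral _ (fun A mA _ => lawE A mA)).
rewrite -integral12_prod_meas1// /fubini_F/=.
under eq_integral => x _.
  under eq_integral => y _ do rewrite EFinM.
  rewrite (@integral_distribution _ _ _ _ _ P Y (fun y => x%:E * y%:E)%E)/=; last 2 first.
  - exact: measurable_funeM.
  - exact: integrableZl.
  rewrite integralZl// meanE// muleC.
  over.
rewrite /= integralZl//; last first.
  exact: integrable_pushforward.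
rewrite (@integral_distribution _ _ _ _ _ P X EFin)//= meanE//.
by rewrite muleC.
Qed.

End IndependentProducts.

(** * Independent orthonormal ensembles, and independence of one of them from all others *)

Section IndependentEnsembles.
Context {d : measure_display} {T : measurableType d} {R : realType}.
Variable P : probability T R.
Context {n : nat} {m : 'I_n -> nat}.

(** Plain functions instead of bundled random variables: hybrids on a product space can then be
    written down directly, measurability being a field of [independent_ensembles]. *)
Definition families := forall i : 'I_n, 'I_(m i).+1 -> T -> R.
Implicit Types (Z : families) (f g : T -> R).

Definition sigma_family (I : Type) (F : I -> T -> R) : set (set T) :=
  <<s \bigcup_i preimage_set_system setT (F i) measurable >>.

Definition at_point Z (w : T) : values R m := fun i j => Z i j w.

Record independent_ensembles Z : Prop := IndependentEnsembles {
  ie_measurable : forall i j, measurable_fun setT (Z i j);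
  ie_one : forall i w, Z i ord0 w = 1;
  ie_Rintegrable : forall i j l, Rintegrable P (fun w => Z i j w * Z i l w);
  ie_orthonormal : forall i j l, mean P (fun w => Z i j w * Z i l w) = (j == l)%:R;
  ie_independent : mutually_independent P (fun i => sigma_family (Z i)) }.

Arguments ie_measurable {Z} _ i j.
Arguments ie_one {Z} _ i w.
Arguments ie_Rintegrable {Z} _ i j l.
Arguments ie_orthonormal {Z} _ i j l.

Lemma sigma_family_sub (I : Type) (F : I -> T -> R) :
  (forall i, measurable_fun setT (F i)) -> sigma_family F `<=` measurable.
Proof.
move=> mF; apply: smallest_sub; first exact: sigma_algebra_measurable.
by move=> A [i _ [B mB <-]]; apply: mF.
Qed.

Lemma sigma_family_base (I : Type) (F : I -> T -> R) i U :
  measurable U -> sigma_family F (F i @^-1` U).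
Proof.
move=> mU; apply: sub_sigma_algebra; exists i => //.
by exists U => //; rewrite setTI.
Qed.

Lemma sigma_family_sigma_algebra (I : Type) (F : I -> T -> R) :
  sigma_algebra setT (sigma_family F).
Proof. exact: smallest_sigma_algebra. Qed.

Lemma sigma_familyT (I : Type) (F : I -> T -> R) : sigma_family F setT.
Proof.
have [h0 hC _] := sigma_family_sigma_algebra F.
by have := hC _ h0; rewrite setD0.
Qed.

(* A pi-system, hence the choice of intersections over all families. *)
Definition events_off Z (k : 'I_n) : set (set T) :=
  [set A | exists A_ : 'I_n -> set T,
     [/\ forall i, sigma_family (Z i) (A_ i), A_ k = setT & A = \bigcap_i A_ i]].

Definition space_off Z k := g_sigma_algebraType (events_off Z k).

Definition measurable_off Z k f : Prop :=
  measurable_fun [set: space_off Z k] (f : space_off Z k -> R).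

Lemma bigcap_setT_set (I : finType) (A : I -> set T) :
  \bigcap_(i in [set i | i \in [set: I]%SET]) A i = \bigcap_i A i.
Proof. by congr bigcap; apply/seteqP; split=> // i _ /=; rewrite inE. Qed.

Lemma independent_all Z (A : 'I_n -> set T) : independent_ensembles Z ->
  (forall i, sigma_family (Z i) (A i)) -> P (\bigcap_i A i) = (\prod_i P (A i))%E.
Proof.
move=> [_ _ _ _ /(_ [set: 'I_n]%SET A)]; rewrite bigcap_setT_set => h sA.
by rewrite h//; apply: eq_bigl => i; rewrite inE.
Qed.

Lemma bigcap_ord_measurable (A : 'I_n -> set T) :
  (forall i, measurable (A i)) -> measurable (\bigcap_i A i).
Proof.
move=> mA; rewrite -bigcap_setT_set bigcap_set_type.
by apply: fin_bigcap_measurable => //; exact: finite_finset.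
Qed.

(** Dynkin's pi-lambda argument: for a fixed event [B] of the [k]-th ensemble, the events
    independent of [B] are closed under complements and disjoint countable unions, and they contain
    the pi-system [events_off Z k]. *)
Lemma independent_off Z k : independent_ensembles Z ->
  independent_systems P <<s events_off Z k>> (sigma_family (Z k)).
Proof.
move=> iZ S B hS hB.
have mB : measurable B := sigma_family_sub (ie_measurable iZ k) hB.
have mE : events_off Z k `<=` measurable.
  move=> _ [A_ [sA _ ->]]; apply: bigcap_ord_measurable => i.
  exact: (sigma_family_sub (ie_measurable iZ i) (sA i)).
have mS A : <<s events_off Z k>> A -> measurable A.
  by move: A; apply: smallest_sub => //; exact: sigma_algebra_measurable.
have fP C : d.-measurable C -> P C \is a fin_num by exact: fin_num_measure.
pose Pr (A : set T) := P (A `&` B) = (P A * P B)%E.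
apply: (@dynkin_induction _ (space_off Z k) (events_off Z k) Pr) hS => //.
- move=> _ _ [A [sA Ak ->]] [A' [sA' Ak' ->]]; exists (fun i => A i `&` A' i).
  split; [|by rewrite Ak Ak' setTI|by rewrite bigcapI].
  by move=> i; apply: (@measurableI _ (g_sigma_algebraType _)); [exact: sA|exact: sA'].
- by rewrite /Pr setTI [P setT]probability_setT mul1e.
- move=> _ [A [sA Ak ->]]; rewrite /Pr.
  (* The [k]-th slot of the intersection is [setT], so [B] can be stored there and independence of
     the whole family applies. *)
  have -> : \bigcap_i A i `&` B = \bigcap_i (if i == k then B else A i).
    apply/seteqP; split=> w.
      by move=> [Aw Bw] i _; case: ifP => // _; exact: Aw.
    move=> h; split; last by have := h k I; rewrite eqxx.
    by move=> i _; have := h i I; case: eqP => // ->; rewrite Ak.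
  rewrite !(independent_all iZ)//; last first.
    by move=> i; case: eqP => // ->.
  rewrite (bigD1 k)//= eqxx [in RHS](bigD1 k)//= Ak [P setT]probability_setT mul1e muleC.
  by congr (_ * _)%E; apply: eq_bigr => i /negPf ->.
- move=> A /mS mA; rewrite /Pr => h.
  have -> : ~` A `&` B = B `\` (A `&` B).
    apply/seteqP; split=> w /= [nA Bw]; split=> //; first by case.
    by move=> Aw; apply: Bw.
  have mAB : d.-measurable ((A : set T) `&` B) by exact: measurableI.
  have -> : P (B `\` ((A : set T) `&` B)) = (P B - P ((A : set T) `&` B))%E.
    rewrite measureD; [|exact: mB|exact: mAB|by rewrite -ge0_fin_numE ?fP].
    by rewrite setICA setIid.
  have -> : P (~` (A : set T)) = (1 - P A)%E by exact: probability_setC.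
  by rewrite h muleBl ?fP// ?mul1e//; exact: fin_num_adde_defr.
- move=> F mF tF hF; rewrite /Pr setI_bigcupl.
  have mF' i : d.-measurable (F i : set T) by apply: mS; exact: mF.
  rewrite measure_bigcup//; last 2 first.
    by move=> i _; exact: measurableI.
    exact: trivIset_setIr.
  rewrite measure_bigcup// muleC -(fineK (fP B mB)) -nneseriesZl//.
  by apply: eq_eseriesr => i _; rewrite fineK ?fP// muleC; exact: hF.
Qed.

Lemma measurable_off_var Z k i j : i != k -> measurable_off Z k (Z i j).
Proof.
move=> ik _ U mU; rewrite setTI; apply: sub_sigma_algebra.
exists (fun l => if l == i then Z i j @^-1` U else setT); split.
- move=> l; case: eqP => [->|_]; first exact: sigma_family_base.
  exact: sigma_familyT.
- by rewrite eq_sym (negPf ik).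
- apply/seteqP; split=> [w Uw l _|w /(_ i I)]; last by rewrite eqxx.
  by case: ifP.
Qed.

Lemma independent_product_off Z k f g : independent_ensembles Z ->
  measurable_off Z k f -> measurable_wrt (sigma_family (Z k)) g ->
  Rintegrable P f -> Rintegrable P g ->
  Rintegrable P (fun w => f w * g w) /\
  mean P (fun w => f w * g w) = mean P f * mean P g.
Proof.
move=> iZ mf mg sf sg.
apply: (independent_product _ _ (@independent_off Z k iZ)) => //.
- apply: smallest_sub; first exact: sigma_algebra_measurable.
  move=> _ [A_ [sA _ ->]]; apply: bigcap_ord_measurable => i.
  exact: (sigma_family_sub (ie_measurable iZ i) (sA i)).
- exact: (sigma_family_sub (ie_measurable iZ k)).
- by move=> U mU; have := mf measurableT _ mU; rewrite setTI.
Qed.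

Lemma measurable_off_monomial Z k s : (forall i w, Z i ord0 w = 1) ->
  supported_on (predC (pred1 k)) s ->
  measurable_off Z k (fun w => monomial (at_point Z w) s).
Proof.
move=> Z1 /supported_onP hs; apply: measurable_prod => i _.
have [->|ik] := eqVneq i k; last exact: measurable_off_var.
rewrite hs /= ?negbK//; rewrite (_ : (fun _ => _) = cst 1); first exact: measurable_cst.
by apply/funext => w; exact: Z1.
Qed.

Lemma measurable_off_eval_coef Z k t (Q : mlpoly R m) : (forall i w, Z i ord0 w = 1) ->
  measurable_off Z k (fun w => eval (coef (pred1 k) t Q) (at_point Z w)).
Proof.
move=> Z1; apply: measurable_sum => s; rewrite /coef.
case: ifPn => hs; first by apply: measurable_funM => //; exact: measurable_off_monomial.
rewrite (_ : (fun _ => _) = cst 0); first exact: measurable_cst.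
by apply/funext => w; rewrite mul0r.
Qed.

Lemma measurable_wrt_monomial Z k t : (forall i w, Z i ord0 w = 1) ->
  supported_on (pred1 k) t ->
  @measurable_fun _ _ (g_sigma_algebraType
     (\bigcup_j preimage_set_system setT (Z k j) measurable)) R setT
     (fun w => monomial (at_point Z w) t).
Proof.
move=> Z1 /supported_onP ht; apply: measurable_prod => i _.
have [->|ik] := eqVneq i k.
  by move=> _ U mU; rewrite setTI; exact: (@sigma_family_base _ (Z k)).
rewrite ht//= (_ : (fun _ => _) = cst 1); first exact: measurable_cst.
by apply/funext => w; exact: Z1.
Qed.

End IndependentEnsembles.
Arguments ie_measurable {d T R P n m Z} _ i j.
Arguments ie_one {d T R P n m Z} _ i w.
Arguments ie_Rintegrable {d T R P n m Z} _ i j l.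
Arguments ie_orthonormal {d T R P n m Z} _ i j l.

(** * Orthonormality of monomials and hypercontractivity in [L^3] *)

Section SquareIntegrable.
Context {d : measure_display} {T : measurableType d} {R : realType}.
Variable P : probability T R.
Context {n : nat} {m : 'I_n -> nat}.
Implicit Types (Z : @families d T R n m) (Q : mlpoly R m) (s t : multi_index m).

Lemma measurable_monomial Z s : (forall i j, measurable_fun setT (Z i j)) ->
  measurable_fun setT (fun w => monomial (at_point Z w) s).
Proof. by move=> mZ; apply: measurable_prod => i _; exact: mZ. Qed.

Lemma measurable_eval Z Q : (forall i j, measurable_fun setT (Z i j)) ->
  measurable_fun setT (fun w => eval Q (at_point Z w)).
Proof.
move=> mZ; apply: measurable_sum => s.
by apply: measurable_funM => //; exact: measurable_monomial.
Qed.

Lemma measurable_wrt_mulr (I : Type) (F : I -> T -> R) i j :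
  measurable_wrt (sigma_family F) (fun w => F i w * F j w).
Proof.
pose T' := g_sigma_algebraType (\bigcup_k preimage_set_system setT (F k) measurable).
have mF k : measurable_fun [set: T'] (F k : T' -> R).
  by move=> _ U mU; rewrite setTI; exact: (@sigma_family_base _ _ _ _ F).
move=> U mU; have := @measurable_funM _ T' R setT _ _ (mF i) (mF j) measurableT U mU.
by rewrite setTI.
Qed.

(** The product is built one coordinate at a time, pairing [Z i (s i)] with [Z i (t i)]: these pairs
    are integrable with known mean, and the part already built only involves ensembles other than
    the one being added. *)
Lemma monomialsM Z s t : independent_ensembles P Z ->
  Rintegrable P (fun w => monomial (at_point Z w) s * monomial (at_point Z w) t) /\
  mean P (fun w => monomial (at_point Z w) s * monomial (at_point Z w) t)
    = (s == t)%:R.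
Proof.
move=> iZ.
pose W k w := \prod_(i < n | (i < k)%N) (Z i (s i) w * Z i (t i) w).
have HW k : (k <= n)%N -> Rintegrable P (W k) /\
    mean P (W k) = \prod_(i < n | (i < k)%N) (s i == t i)%:R.
  elim: k => [_|k IH kn].
    have W1 : (fun=> 1) =1 W 0%N by move=> w; rewrite /W big_pred0.
    split; first exact: Rintegrable_ext W1 (Rintegrable_cst P 1).
    by rewrite -(mean_ext P W1) mean_cst big_pred0.
  have [sW mW] := IH (ltnW kn); pose kk := Ordinal kn.
  have mWk : measurable_off Z kk (W k).
    have -> : W k = (fun w => \prod_(i < n)
        (if (i < k)%N then Z i (s i) w * Z i (t i) w else 1)).
      by apply/funext => w; rewrite /W big_mkcond.
    apply: measurable_prod => i _; case: (boolP (i < k)%N) => ik.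
      have ikk : i != kk by apply: contraTneq ik => ->; rewrite ltnn.
      by apply: measurable_funM; exact: measurable_off_var.
    exact: measurable_cst.
  have [sM mM] := independent_product_off iZ mWk
    (measurable_wrt_mulr (s kk) (t kk)) sW (ie_Rintegrable iZ kk (s kk) (t kk)).
  have WE w : W k w * (Z kk (s kk) w * Z kk (t kk) w) = W k.+1 w.
    rewrite mulrC /W [RHS](bigD1 kk)//=; congr (_ * _); apply: eq_bigl => i.
    by rewrite -val_eqE /= ltnS [in RHS]leq_eqVlt; case: ltngtP.
  split; first exact: Rintegrable_ext WE sM.
  rewrite -(mean_ext P WE) mM mW ie_orthonormal// mulrC [RHS](bigD1 kk)//=.
  congr (_ * _); apply: eq_bigl => i.
  by rewrite -val_eqE /= ltnS [in RHS]leq_eqVlt; case: ltngtP.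
have [sW mW] := HW n (leqnn n).
have WE w : W n w = monomial (at_point Z w) s * monomial (at_point Z w) t.
  by rewrite /W -big_split; apply: eq_bigl => i; rewrite ltn_ord.
split; first exact: Rintegrable_ext WE sW.
rewrite -(mean_ext P WE) mW.
have [->|st] := eqVneq s t; first by rewrite big1// => i _; rewrite eqxx.
have [i sti] : exists i, s i != t i.
  apply/existsP; apply: contraNT st; rewrite negb_exists => /forallP h.
  by apply/eqP/ffunP => i; apply/eqP; rewrite -[_ == _]negbK h.
by rewrite (bigD1 i)//= (negPf sti) mul0r.
Qed.

Lemma eval_mul Z Q Q' : independent_ensembles P Z ->
  Rintegrable P (fun w => eval Q (at_point Z w) * eval Q' (at_point Z w)) /\
  mean P (fun w => eval Q (at_point Z w) * eval Q' (at_point Z w))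
    = \sum_s Q s * Q' s.
Proof.
move=> iZ.
pose F s w := \sum_t (Q s * Q' t) *
   (monomial (at_point Z w) s * monomial (at_point Z w) t).
have sm s t := (monomialsM s t iZ).1; have mm s t := (monomialsM s t iZ).2.
have sF s : Rintegrable P (F s).
  by apply: Rintegrable_sum => t _; apply: RintegrableZ; exact: sm.
have FE w : \sum_s F s w = eval Q (at_point Z w) * eval Q' (at_point Z w).
  rewrite /eval big_distrl; apply: eq_bigr => s _; rewrite big_distrr.
  by apply: eq_bigr => t _ /=; rewrite mulrACA.
split; first by apply: Rintegrable_ext FE _; exact: Rintegrable_sum.
rewrite -(mean_ext P FE) mean_sum//; apply: eq_bigr => s _.
rewrite mean_sum; last by move=> t _; apply: RintegrableZ; exact: sm.
rewrite (bigD1 s)//= big1 ?addr0.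
  by rewrite meanZ ?mm ?eqxx ?mulr1//; exact: sm.
move=> t ts; rewrite meanZ; last exact: sm.
by rewrite mm eq_sym (negPf ts) mulr0.
Qed.

Lemma Rintegrable_eval_sqr Z Q : independent_ensembles P Z ->
  Rintegrable P (fun w => eval Q (at_point Z w) ^+ 2).
Proof. by move=> iZ; have := (eval_mul Q Q iZ).1. Qed.

Lemma mean_eval_sqr Z Q : independent_ensembles P Z ->
  mean P (fun w => eval Q (at_point Z w) ^+ 2) = sqnorm Q.
Proof. by move=> iZ; have := (eval_mul Q Q iZ).2. Qed.

Lemma Rintegrable_of_sqr (f : T -> R) : measurable_fun setT f -> Rintegrable P (fun w => f w ^+ 2) ->
  Rintegrable P f.
Proof.
move=> mf sf; apply: (Rintegrable_dominated mf (RintegrableD (Rintegrable_cst P 1) sf)) => w.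
have := sqr_ge0 (`|f w| - 1); rewrite -(real_normK (num_real (f w))).
have := sqr_ge0 (`|f w|); lra.
Qed.

Lemma Rintegrable_eval Z Q : independent_ensembles P Z ->
  Rintegrable P (fun w => eval Q (at_point Z w)).
Proof.
move=> iZ; apply: Rintegrable_of_sqr; last exact: Rintegrable_eval_sqr.
exact: measurable_eval (ie_measurable iZ).
Qed.

Lemma mean_eval Z Q : independent_ensembles P Z ->
  mean P (fun w => eval Q (at_point Z w)) = Q (multi_index0 : multi_index m).
Proof.
move=> iZ.
pose e s : R := (s == multi_index0 :> multi_index m)%:R.
have eE w : eval e (at_point Z w) = 1.
  rewrite /eval (bigD1 multi_index0)//= big1 ?addr0.
    by rewrite /e eqxx mul1r monomial0// => i; exact: ie_one iZ i w.
  by move=> s /negPf; rewrite /e => ->; rewrite mul0r.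
rewrite (mean_ext P (g := fun w => eval Q (at_point Z w) * eval e (at_point Z w))).
  rewrite (eval_mul Q e iZ).2 (bigD1 multi_index0)//= big1 ?addr0 /e ?eqxx ?mulr1//.
  by move=> s /negPf ->; rewrite mulr0.
by move=> w; rewrite eE mulr1.
Qed.

(* For [P]-orthonormal independent ensembles, [Num.sqrt (sqnorm Q)] is the L^2
   norm of [Q(Z)], so this is (2, 3, eta)-hypercontractivity. *)
Definition cube_hypercontractive (eta : R) Z : Prop := forall Q,
  Rintegrable P (fun w => `|eval (noise_op eta Q) (at_point Z w)| ^+ 3) /\
  mean P (fun w => `|eval (noise_op eta Q) (at_point Z w)| ^+ 3)
    <= Num.sqrt (sqnorm Q) ^+ 3.

(** Weighted arithmetic-geometric mean inequality for [x^(k+3)] and 1. Applied to a normalized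
    variable, it bounds the third moment by a higher one. *)
Lemma cube_le_power (x : R) k : 0 <= x ->
  (k + 3)%:R * x ^+ 3 <= 3 * x ^+ (k + 3) + k%:R.
Proof.
move=> x0; elim: k => [|k IH]; first by rewrite !add0n addr0.
(* The right side minus the left side grows by [3 (x - 1) x^(k+3) - (x^3 - 1)] from [k] to [k + 1];
   this is its factored form. *)
have key : 0 <= (x - 1) * (3 * x ^+ (k + 3) - x ^+ 2 - x - 1).
  have [x1|x1] := leP 1 x.
    apply: mulr_ge0; first lra.
    have h j : 1 <= x ^+ j by exact: exprn_ege1.
    have : x ^+ 2 <= x ^+ (k + 3) by apply: ler_weXn2l; rewrite ?addn3.
    have : x ^+ 1 <= x ^+ (k + 3) by apply: ler_weXn2l; rewrite ?addn3.
    have := h (k + 3)%N; rewrite expr1; lra.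
  apply: mulr_le0; first lra.
  have : x ^+ (k + 3) <= x ^+ 2 by apply: ler_wiXn2l; rewrite ?addn3// ltW.
  have : x ^+ (k + 3) <= x ^+ 1 by apply: ler_wiXn2l; rewrite ?addn3// ltW.
  have : x ^+ (k + 3) <= 1 by apply: exprn_ile1 => //; rewrite ltW.
  rewrite expr1; lra.
have -> : x ^+ (k.+1 + 3) = x * x ^+ (k + 3) by rewrite addSn exprS.
have -> : (k.+1 + 3)%:R = k%:R + 4 :> R by rewrite natrD -natr1; ring.
have -> : k.+1%:R = k%:R + 1 :> R by rewrite natr1.
by move: IH key; rewrite natrD; move: (x ^+ (k + 3)) k%:R => y K; lra.
Qed.

(** By orthonormality the [L^2] norm of [Q(X)] is [a]. The passage from the exponent [r] to 3
    integrates [cube_le_power] at [|f| / a]; the case [a = 0] is separate because of this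
    division. *)
Lemma hypercontractive_cube (r : nat) eta (X : rv_families P m) :
  (3 <= r)%N -> independent_ensembles P (fun i j => X i j : T -> R) ->
  hypercontractive 2 r%:R eta X ->
  cube_hypercontractive eta (fun i j => X i j : T -> R).
Proof.
move=> r3 iX [_ _ _ hX] Q; set Z := (fun i j => X i j : T -> R) in iX *.
set a := Num.sqrt (sqnorm Q).
have a0 : 0 <= a by exact: sqrtr_ge0.
set f := fun w => eval (noise_op eta Q) (at_point Z w).
have mf : measurable_fun setT f by exact: measurable_eval (ie_measurable iX).
have N2 : 'N[P]_(2%:E)[EFin \o mlpoly_eval Q X]%E = a%:E.
  rewrite unlock /Lnorm.
  have -> : (\int[P]_x `|(EFin \o mlpoly_eval Q X) x| `^ 2 = (sqnorm Q)%:E)%E.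
    rewrite -(mean_eval_sqr Q iX) -(meanE (Rintegrable_eval_sqr Q iX)).
    apply: eq_integral => w _; rewrite /= ?poweR_EFin powR_mulrn//.
    by rewrite real_normK ?num_real.
  by rewrite poweR_EFin powR12_sqrt// sqnorm_ge0.
have r0 : r%:R != 0 :> R by rewrite pnatr_eq0; case: r r3 {hX}.
have Nr : (\int[P]_w (`|f w| ^+ r)%:E <= (a ^+ r)%:E)%E.
  have -> : (\int[P]_w (`|f w| ^+ r)%:E =
     'N[P]_(r%:R%:E)[EFin \o mlpoly_eval (noise_op eta Q) X] `^ r%:R)%E.
    rewrite poweR_Lnorm//; apply: eq_integral => w _.
    by rewrite /= ?poweR_EFin powR_mulrn.
  rewrite -(powR_mulrn r a0) -poweR_EFin -N2.
  by apply: gt0_ler_poweR; rewrite ?in_itv/= ?leey ?Lnorm_ge0//; exact: hX.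
have mfr k : measurable_fun setT (fun w => `|f w| ^+ k).
  by apply: measurable_funX; exact: measurableT_comp.
have [sr mr] := Rintegrable_ge0_le (mfr r) (fun w => exprn_ge0 r (normr_ge0 (f w))) Nr.
have [aeq0|an0] := eqVneq a 0.
  have Q0 : sqnorm Q = 0.
    by apply/le_anti; rewrite sqnorm_ge0 andbT -sqrtr_eq0 -/a aeq0.
  have f0 w : f w = 0.
    rewrite /f /eval big1// => s _; rewrite /noise_op.
    by rewrite (sqnorm_eq0 _ Q0) mulr0 mul0r.
  rewrite aeq0 expr0n/= (_ : (fun _ => _) = (fun=> 0)); last first.
    by apply/funext => w; rewrite -/(f w) f0 normr0 expr0n.
  by split; [exact: Rintegrable_cst|rewrite mean_cst].
have agt : 0 < a by rewrite lt_neqAle eq_sym an0.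
pose k := (r - 3)%N; have rk : r = (k + 3)%N by rewrite subnK.
(* This is [a^3 (3 (|f| / a)^r + k) / r], whose mean is at most [a^3 (3 + k) / r = a^3]. *)
pose g w := a ^+ 3 * (3 / r%:R) / a ^+ r * `|f w| ^+ r + a ^+ 3 * (k%:R / r%:R).
have rgt : 0 < r%:R :> R by rewrite lt_neqAle eq_sym r0/= ler0n.
have fg w : `|f w| ^+ 3 <= g w.
  have := cube_le_power k (divr_ge0 (normr_ge0 (f w)) a0).
  rewrite -rk !expr_div_n -(ler_pM2r (_ : 0 < a ^+ 3 / r%:R)); last first.
    by rewrite divr_gt0// exprn_gt0.
  have -> : r%:R * (`|f w| ^+ 3 / a ^+ 3) * (a ^+ 3 / r%:R) = `|f w| ^+ 3.
    by field; rewrite r0.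
  move/le_trans; apply; rewrite le_eqVlt; apply/orP; left; apply/eqP.
  rewrite /g; move: (a ^+ r) (expf_neq0 r an0) => A A0.
  by field; rewrite r0 A0.
have sg : Rintegrable P g.
  by apply: RintegrableD; [exact: RintegrableZ|exact: Rintegrable_cst].
have s3 : Rintegrable P (fun w => `|f w| ^+ 3).
  by apply: (Rintegrable_dominated (mfr 3) sg) => w; rewrite ger0_norm// exprn_ge0.
split=> //; apply: le_trans (le_mean s3 sg fg) _.
rewrite /g (meanD (RintegrableZ _ sr) (Rintegrable_cst P _)) (meanZ _ sr) mean_cst.
have : a ^+ 3 * (3 / r%:R) / a ^+ r * mean P (fun w => `|f w| ^+ r)
  <= a ^+ 3 * (3 / r%:R) / a ^+ r * a ^+ r.
  apply: ler_wpM2l mr.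
  by rewrite !(mulr_ge0, invr_ge0, exprn_ge0)// ler0n.
rewrite divfK ?expf_neq0// => h.
have : a ^+ 3 * (3 / r%:R) + a ^+ 3 * (k%:R / r%:R) = a ^+ 3.
  have -> : r%:R = k%:R + 3 :> R by rewrite rk natrD.
  by field; rewrite -[X in _ + X]/(3%:R) -natrD -rk.
lra.
Qed.

End SquareIntegrable.

(** * The replacement argument *)

Section ReplacingOneEnsemble.
Context {d : measure_display} {T : measurableType d} {R : realType}.
Variable P : probability T R.
Context {n : nat} {m : 'I_n -> nat}.
Implicit Types (Z : @families d T R n m) (Q : mlpoly R m) (s t : multi_index m).

Definition cube_integrable Z : Prop := forall Q,
  Rintegrable P (fun w => `|eval Q (at_point Z w)| ^+ 3).

Lemma cube_hypercontractive_Rintegrable eta Z : eta != 0 ->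
  cube_hypercontractive P eta Z -> cube_integrable Z.
Proof.
move=> eta0 hZ Q; have [+ _] := hZ (noise_op eta^-1 Q).
by apply: Rintegrable_ext => w; rewrite (eval_ext _ (noise_opK Q eta0)).
Qed.

(** What is left of [Q] after averaging over the [k]-th ensemble; its [sqnorm] is the influence of
    that ensemble. *)
Definition dependent_part (k : 'I_n) Q : mlpoly R m :=
  fun s => if s k != ord0 then Q s else 0.

Lemma coef_dependent_part k Q t : supported_on (pred1 k) t ->
  coef (pred1 k) t (dependent_part k Q) =1
  (if t != multi_index0 then coef (pred1 k) t Q else fun=> 0).
Proof.
move=> ht s; rewrite /coef /dependent_part ffunE /= eqxx.
rewrite (pred1_supported_neq0 ht); case: (t != _) => //=.
by case: (supported_on _ s).
Qed.

Lemma eval_dependent_part k Q x : (forall i, x i ord0 = 1) ->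
  eval (dependent_part k Q) x =
  \sum_(t | supported_on (pred1 k) t && (t != multi_index0))
     eval (coef (pred1 k) t Q) x * monomial x t.
Proof.
move=> x1; rewrite (eval_coef (pred1 k))// [RHS]big_mkcondr/=.
apply: eq_bigr => t ht; rewrite (eval_ext _ (coef_dependent_part Q ht)).
by case: ifP => // _; rewrite /eval big1 ?mul0r// => s _; rewrite mul0r.
Qed.

Lemma eval_split k Q x : (forall i, x i ord0 = 1) ->
  eval Q x = eval (coef (pred1 k) multi_index0 Q) x + eval (dependent_part k Q) x.
Proof.
move=> x1; rewrite eval_dependent_part// (eval_coef (pred1 k))//.
by rewrite (bigD1 multi_index0)/= ?supported_on0// monomial0// mulr1.
Qed.

Lemma measurable_pospart : measurable_fun setT (@pospart R).
Proof.
exact: (@measurable_maxr _ _ R setT id (cst 0) (@measurable_id _ _ _) (@measurable_cst _ _ _ _ _ _)).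
Qed.

Lemma measurable_wrt_monomialM Z k t t' : independent_ensembles P Z ->
  supported_on (pred1 k) t -> supported_on (pred1 k) t' ->
  measurable_wrt (sigma_family (Z k))
    (fun w => monomial (at_point Z w) t * monomial (at_point Z w) t').
Proof.
move=> iZ ht ht' U mU.
have mt u (hu : supported_on (pred1 k) u) := measurable_wrt_monomial (ie_one iZ) hu.
by have := measurable_funM (mt _ ht) (mt _ ht') measurableT mU; rewrite setTI.
Qed.

Lemma independent_off_monomial Z k f t : independent_ensembles P Z ->
  measurable_off Z k f -> Rintegrable P f ->
  supported_on (pred1 k) t -> t != multi_index0 ->
  Rintegrable P (fun w => f w * monomial (at_point Z w) t) /\
  mean P (fun w => f w * monomial (at_point Z w) t) = 0.
Proof.
move=> iZ mf sf ht t0.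
have [sm mm] := monomialsM t multi_index0 iZ.
have mon0 w : monomial (at_point Z w) multi_index0 = 1.
  by rewrite monomial0// => i; exact: ie_one iZ i w.
have gE w : monomial (at_point Z w) t * monomial (at_point Z w) multi_index0
  = monomial (at_point Z w) t by rewrite mon0 mulr1.
have [s1 m1] := independent_product_off iZ mf
   (measurable_wrt_monomialM iZ ht (supported_on0 _)) sf sm.
have fE w : f w * (monomial (at_point Z w) t * monomial (at_point Z w) multi_index0)
  = f w * monomial (at_point Z w) t by rewrite gE.
split; first exact: Rintegrable_ext fE s1.
by rewrite -(mean_ext P fE) m1 mm (negPf t0) mulr0.
Qed.

Lemma independent_off_monomialM Z k f t t' : independent_ensembles P Z ->
  measurable_off Z k f -> Rintegrable P f ->
  supported_on (pred1 k) t -> supported_on (pred1 k) t' ->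
  Rintegrable P (fun w => f w * (monomial (at_point Z w) t * monomial (at_point Z w) t')) /\
  mean P (fun w => f w * (monomial (at_point Z w) t * monomial (at_point Z w) t'))
    = mean P f * (t == t')%:R.
Proof.
move=> iZ mf sf ht ht'.
have [sm mm] := monomialsM t t' iZ.
have := independent_product_off iZ mf (measurable_wrt_monomialM iZ ht ht') sf sm.
by rewrite mm.
Qed.

(* Orthonormality and independence kill the terms that are linear in the k-th
   ensemble and diagonalize the quadratic ones. *)
Lemma mean_linear_off Z k g Q : independent_ensembles P Z ->
  measurable_off Z k g ->
  (forall t, supported_on (pred1 k) t ->
     Rintegrable P (fun w => g w * eval (coef (pred1 k) t Q) (at_point Z w))) ->
  Rintegrable P (fun w => g w * eval (dependent_part k Q) (at_point Z w)) /\
  mean P (fun w => g w * eval (dependent_part k Q) (at_point Z w)) = 0.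
Proof.
move=> iZ mg sg.
pose F t w := g w * eval (coef (pred1 k) t Q) (at_point Z w) * monomial (at_point Z w) t.
have FE w : \sum_(t | supported_on (pred1 k) t && (t != multi_index0)) F t w
    = g w * eval (dependent_part k Q) (at_point Z w).
  rewrite eval_dependent_part; last by move=> i; exact: ie_one iZ i w.
  by rewrite mulr_sumr; apply: eq_bigr => t _; rewrite /F mulrA.
have HF t : supported_on (pred1 k) t && (t != multi_index0) ->
    Rintegrable P (F t) /\ mean P (F t) = 0.
  move=> /andP[ht t0]; apply: (independent_off_monomial iZ _ (sg t ht) ht t0).
  by apply: (measurable_funM mg); apply: measurable_off_eval_coef; exact: (ie_one iZ).
split; first by apply: Rintegrable_ext FE _; apply: Rintegrable_sum => t /HF [].
rewrite -(mean_ext P FE) mean_sum; last by move=> t /HF [].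
by apply: big1 => t /HF [].
Qed.

Lemma mean_quadratic_off Z k g Q : independent_ensembles P Z ->
  measurable_off Z k g ->
  (forall t t', supported_on (pred1 k) t -> supported_on (pred1 k) t' ->
     Rintegrable P (fun w => g w * (eval (coef (pred1 k) t Q) (at_point Z w)
                   * eval (coef (pred1 k) t' Q) (at_point Z w)))) ->
  Rintegrable P (fun w => g w * eval (dependent_part k Q) (at_point Z w) ^+ 2) /\
  mean P (fun w => g w * eval (dependent_part k Q) (at_point Z w) ^+ 2) =
  \sum_(t | supported_on (pred1 k) t && (t != multi_index0))
    mean P (fun w => g w * (eval (coef (pred1 k) t Q) (at_point Z w)
                   * eval (coef (pred1 k) t Q) (at_point Z w))).
Proof.
move=> iZ mg sg.
pose D t := supported_on (pred1 k) t && (t != multi_index0).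
pose G t t' w := g w * (eval (coef (pred1 k) t Q) (at_point Z w)
                   * eval (coef (pred1 k) t' Q) (at_point Z w)).
pose F t t' w := G t t' w * (monomial (at_point Z w) t * monomial (at_point Z w) t').
have HF t t' : D t -> D t' ->
    Rintegrable P (F t t') /\ mean P (F t t') = mean P (G t t') * (t == t')%:R.
  move=> /andP[ht _] /andP[ht' _].
  apply: (independent_off_monomialM iZ _ (sg t t' ht ht') ht ht').
  apply: (measurable_funM mg); apply: measurable_funM;
    apply: measurable_off_eval_coef; exact: (ie_one iZ).
have FE w : \sum_(t | D t) \sum_(t' | D t') F t t' w
    = g w * eval (dependent_part k Q) (at_point Z w) ^+ 2.
  rewrite eval_dependent_part; last by move=> i; exact: ie_one iZ i w.
  rewrite expr2 big_distrl mulr_sumr; apply: eq_bigr => t _.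
  rewrite big_distrr mulr_sumr; apply: eq_bigr => t' _ /=.
  by rewrite /F /G -!mulrA; congr (_ * (_ * _)); rewrite mulrCA.
have sF t : D t -> Rintegrable P (fun w => \sum_(t' | D t') F t t' w).
  by move=> Dt; apply: Rintegrable_sum => t' Dt'; have [] := HF _ _ Dt Dt'.
split; first by apply: Rintegrable_ext FE _; apply: Rintegrable_sum.
rewrite -(mean_ext P FE) mean_sum//; apply: eq_bigr => t Dt.
rewrite mean_sum; last by move=> t' Dt'; have [] := HF _ _ Dt Dt'.
rewrite (bigD1 t)//= big1 ?addr0.
  by rewrite (HF _ _ Dt Dt).2 eqxx mulr1.
by move=> t' /andP[Dt' tt']; rewrite (HF _ _ Dt Dt').2 eq_sym (negPf tt') mulr0.
Qed.

(** The value subtracted on the left depends only on the ensembles other than the [k]-th. Two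
    hybrids that differ at [k] alone therefore share it, and only the Taylor remainders are left to
    estimate. *)
Lemma lindeberg_step Z k Q : independent_ensembles P Z -> cube_integrable Z ->
  `| mean P (fun w => pospart (eval Q (at_point Z w)) ^+ 3)
     - (mean P (fun w => pospart (eval (coef (pred1 k) multi_index0 Q) (at_point Z w)) ^+ 3)
        + 3 * \sum_(t | supported_on (pred1 k) t && (t != multi_index0))
            mean P (fun w => pospart (eval (coef (pred1 k) multi_index0 Q) (at_point Z w))
               * (eval (coef (pred1 k) t Q) (at_point Z w)
                  * eval (coef (pred1 k) t Q) (at_point Z w)))) |
  <= mean P (fun w => `|eval (dependent_part k Q) (at_point Z w)| ^+ 3).
Proof.
move=> iZ cZ.
set A := fun w => eval (coef (pred1 k) multi_index0 Q) (at_point Z w).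
pose B t w := eval (coef (pred1 k) t Q) (at_point Z w).
set F := fun w => eval (dependent_part k Q) (at_point Z w).
have mev Q' : measurable_fun setT (fun w => eval Q' (at_point Z w)).
  exact: (measurable_eval _ (ie_measurable iZ)).
have mp (f : T -> R) : measurable_fun setT f -> measurable_fun setT (fun w => pospart (f w)).
  by move=> mf; exact: (measurableT_comp measurable_pospart mf).
have moA : measurable_off Z k (fun w => pospart (A w)).
  apply: (measurableT_comp measurable_pospart).
  by apply: measurable_off_eval_coef; exact: (ie_one iZ).
have pc (f : T -> R) w : `|pospart (f w) ^+ 3| <= `|f w| ^+ 3.
  by rewrite normrX ger0_norm ?pospart_ge0// lerXn2r ?nnegrE ?pospart_ge0 ?pospart_le_norm.
have spos Q' : Rintegrable P (fun w => pospart (eval Q' (at_point Z w)) ^+ 3).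
  apply: (Rintegrable_dominated _ (cZ Q') (pc (fun w => eval Q' (at_point Z w)))).
  by apply: measurable_funX; exact: (mp _ (mev _)).
have sl t : Rintegrable P (fun w => pospart (A w) ^+ 2 * B t w).
  apply: (Rintegrable_dominated _ (RintegrableD (cZ (coef (pred1 k) multi_index0 Q))
      (cZ (coef (pred1 k) t Q)))).
    by apply: measurable_funM; [apply: measurable_funX; exact: (mp _ (mev _))|exact: mev].
  move=> w; rewrite normrM normrX; apply: (le_trans (sqrM_le_cubes _ _)) => //.
  by rewrite lerD2r -normrX; exact: pc.
have sq t t' : Rintegrable P (fun w => pospart (A w) * (B t w * B t' w)).
  apply: (Rintegrable_dominated _ (RintegrableD (RintegrableD (cZ (coef (pred1 k) multi_index0 Q))
      (cZ (coef (pred1 k) t Q))) (cZ (coef (pred1 k) t' Q)))).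
    by apply: measurable_funM; [exact: (mp _ (mev _))|apply: measurable_funM; exact: mev].
  move=> w; rewrite mulrA !normrM; apply: (le_trans (mul3_le_cubes _ _ _)) => //.
  by rewrite !lerD2r -normrX; exact: pc.
have [sL mL] := mean_linear_off iZ (measurable_funX 2 moA) (fun t _ => sl t).
have [sQ mQ] := mean_quadratic_off iZ moA (fun t t' _ _ => sq t t').
rewrite -mQ -/F -/A.
have s1 := spos Q; have s2 := spos (coef (pred1 k) multi_index0 Q).
have s3 := RintegrableZ 3 sL; have s4 := RintegrableZ 3 sQ.
have s12 := RintegrableB s1 s2; have s123 := RintegrableB s12 s3.
have -> : mean P (fun w => pospart (eval Q (at_point Z w)) ^+ 3)
   - (mean P (fun w => pospart (A w) ^+ 3) + 3 * mean P (fun w => pospart (A w) * F w ^+ 2))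
  = mean P (fun w => pospart (eval Q (at_point Z w)) ^+ 3 - pospart (A w) ^+ 3
      - 3 * (pospart (A w) ^+ 2 * F w) - 3 * (pospart (A w) * F w ^+ 2)).
  by rewrite (meanB s123 s4) (meanB s12 s3) (meanB s1 s2) (meanZ _ sL) (meanZ _ sQ) mL; ring.
have sT := RintegrableB s123 s4.
apply: (le_trans (le_norm_mean sT)); apply: le_mean; [exact: Rintegrable_norm|exact: cZ|].
move=> w; rewrite (@eval_split k Q); last by move=> i; exact: ie_one iZ i w.
by have := pospart_cube_taylor (A w) (F w); rewrite -2!mulrA.
Qed.

End ReplacingOneEnsemble.

(** * Hybrids on the product space, and tensorization of hypercontractivity *)

Section HybridEnsembles.
Context {d d' : measure_display} {T : measurableType d} {T' : measurableType d'}.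
Context {R : realType} (P : probability T R) (P' : probability T' R).
Context {n : nat} {m : 'I_n -> nat}.
Implicit Types (B : pred 'I_n) (X : @families d T R n m) (Y : @families d' T' R n m).

Local Notation PP := (P \x P')%E.

Lemma Rintegrable_fst (f : T -> R) : Rintegrable P f ->
  Rintegrable PP (fun p => f p.1) /\ mean PP (fun p => f p.1) = mean P f.
Proof.
move=> sf; have mf := Rintegrable_measurable sf.
have mF : measurable_fun [set: T * T'] (fun p => (f p.1)%:E).
  by apply/measurable_EFinP; exact: measurableT_comp mf measurable_fst.
have sF : Rintegrable PP (fun p => f p.1).
  apply/(integrable12ltyP _ _ mF).
  under eq_integral do rewrite /= integral_cst_probability.
  by case/integrableP: sf.
split=> //; apply: EFin_inj; rewrite -!meanE//.
rewrite -(integral12_prod_meas1 sF) /fubini_F/=.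
by apply: eq_integral => x _; rewrite integral_cst_probability.
Qed.

Lemma Rintegrable_snd (f : T' -> R) : Rintegrable P' f ->
  Rintegrable PP (fun p => f p.2) /\ mean PP (fun p => f p.2) = mean P' f.
Proof.
move=> sf; have mf := Rintegrable_measurable sf.
have mF : measurable_fun [set: T * T'] (fun p => (f p.2)%:E).
  by apply/measurable_EFinP; exact: measurableT_comp mf measurable_snd.
have sF : Rintegrable PP (fun p => f p.2).
  apply/(integrable21ltyP _ _ mF).
  under eq_integral do rewrite /= integral_cst_probability.
  by case/integrableP: sf.
split=> //; apply: EFin_inj; rewrite -!meanE//.
rewrite -(integral21_prod_meas1 sF) /fubini_G/=.
by apply: eq_integral => x _; rewrite integral_cst_probability.
Qed.

Definition hybrid B X Y : @families _ (T * T')%type R n m :=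
  fun i j p => if B i then X i j p.1 else Y i j p.2.

Lemma sigma_family_comp {d1 d2} {T1 : measurableType d1} {T2 : measurableType d2}
    (I : Type) (F : I -> T2 -> R) (h : T1 -> T2) A :
  sigma_family (fun i w => F i (h w)) A ->
  exists2 A', sigma_family F A' & A = h @^-1` A'.
Proof.
move=> hA; have [A' sA' <-] : preimage_set_system setT h (sigma_family F) A.
  move: A hA; apply: smallest_sub.
    by apply: sigma_algebra_preimage; exact: sigma_family_sigma_algebra.
  move=> A [i _ [U mU <-]]; exists (F i @^-1` U); first exact: sigma_family_base.
  by [].
by exists A' => //; rewrite setTI.
Qed.

Lemma fin_bigcap_measurable_in {d1} {T1 : measurableType d1} (J : {set 'I_n})
  (A : 'I_n -> set T1) : (forall i, i \in J -> measurable (A i)) ->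
  measurable (\bigcap_(i in [set i | i \in J]) A i).
Proof. by move=> mA; apply: fin_bigcap_measurable => //; exact: finite_finset. Qed.

(** Each event is a preimage under one of the two projections, so an intersection of them is a
    rectangle. The product measure splits it, and independence of [X] and of [Y] splits each
    side. *)
Lemma hybrid_independent B X Y :
  independent_ensembles P X -> independent_ensembles P' Y ->
  independent_ensembles PP (hybrid B X Y).
Proof.
move=> iX iY; split.
- move=> i j; rewrite /hybrid; case: (B i).
    by apply: measurableT_comp measurable_fst; exact: ie_measurable iX i j.
  by apply: measurableT_comp measurable_snd; exact: ie_measurable iY i j.
- by move=> i w; rewrite /hybrid; case: (B i); [exact: ie_one iX i _|exact: ie_one iY i _].
- move=> i j l; rewrite /hybrid; case: (B i).
    by have [] := Rintegrable_fst (ie_Rintegrable iX i j l).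
  by have [] := Rintegrable_snd (ie_Rintegrable iY i j l).
- move=> i j l; rewrite /hybrid; case: (B i).
    by rewrite (Rintegrable_fst (ie_Rintegrable iX i j l)).2 ie_orthonormal.
  by rewrite (Rintegrable_snd (ie_Rintegrable iY i j l)).2 ie_orthonormal.
move=> J A hA.
have /choice[A1 hA1] : forall i, exists A', i \in J -> B i ->
    sigma_family (X i) A' /\ A i = fst @^-1` A'.
  move=> i; have [iJ|iJ] := boolP (i \in J); last by exists set0.
  have [Bi|Bi] := boolP (B i); last by exists set0.
  have := hA i iJ; rewrite /hybrid Bi => /sigma_family_comp[A' sA' AE].
  by exists A'.
have /choice[A2 hA2] : forall i, exists A', i \in J -> ~~ B i ->
    sigma_family (Y i) A' /\ A i = snd @^-1` A'.
  move=> i; have [iJ|iJ] := boolP (i \in J); last by exists set0.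
  have [Bi|Bi] := boolP (B i); first by exists set0.
  have := hA i iJ; rewrite /hybrid (negPf Bi) => /sigma_family_comp[A' sA' AE].
  by exists A'.
pose J1 := [set i in J | B i]%SET; pose J2 := [set i in J | ~~ B i]%SET.
have J1P i : i \in J1 -> sigma_family (X i) (A1 i) /\ A i = fst @^-1` A1 i.
  by rewrite inE => /andP[iJ Bi]; exact: hA1.
have J2P i : i \in J2 -> sigma_family (Y i) (A2 i) /\ A i = snd @^-1` A2 i.
  by rewrite inE => /andP[iJ Bi]; exact: hA2.
have m1 i : i \in J1 -> measurable (A1 i).
  by move=> /J1P[+ _]; exact: sigma_family_sub (ie_measurable iX i) _.
have m2 i : i \in J2 -> measurable (A2 i).
  by move=> /J2P[+ _]; exact: sigma_family_sub (ie_measurable iY i) _.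
have AE : \bigcap_(i in [set i | i \in J]) A i =
    (\bigcap_(i in [set i | i \in J1]) A1 i) `*` (\bigcap_(i in [set i | i \in J2]) A2 i).
  apply/seteqP; split=> [[x y] h|[x y] [/= h1 h2] i /= iJ].
    split=> i /= iJ; move: (iJ); rewrite inE => /andP[iJ' Bi]; have := h i iJ'.
      by rewrite (J1P _ iJ).2.
    by rewrite (J2P _ iJ).2.
  have [Bi|Bi] := boolP (B i).
    have iJ1 : i \in J1 by rewrite inE iJ.
    by rewrite (J1P _ iJ1).2; exact: h1.
  have iJ2 : i \in J2 by rewrite inE iJ.
  by rewrite (J2P _ iJ2).2; exact: h2.
have P1 i : i \in J1 -> PP (A i) = P (A1 i).
  move=> iJ; rewrite (J1P _ iJ).2 (_ : fst @^-1` _ = A1 i `*` setT).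
    rewrite product_measure1E//; last exact: m1.
    by rewrite -[RHS]mule1; congr (_ * _)%E; exact: probability_setT.
  by apply/seteqP; split=> [[x y]|[x y] []].
have P2 i : i \in J2 -> PP (A i) = P' (A2 i).
  move=> iJ; rewrite (J2P _ iJ).2 (_ : snd @^-1` _ = setT `*` A2 i).
    rewrite product_measure1E//; last exact: m2.
    by rewrite -[RHS]mul1e; congr (_ * _)%E; exact: probability_setT.
  by apply/seteqP; split=> [[x y]|[x y] []].
rewrite AE -[LHS]/(PP (_ `*` _)).
rewrite product_measure1E; [|exact: fin_bigcap_measurable_in..].
rewrite [RHS](bigID B)/=; congr (_ * _)%E.
  apply: (etrans (ie_independent iX (fun i iJ => (J1P i iJ).1))).
  rewrite [RHS](eq_bigl (fun i => i \in J1)); last by move=> i; rewrite inE.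
  by apply: eq_bigr => i /P1.
apply: (etrans (ie_independent iY (fun i iJ => (J2P i iJ).1))).
rewrite [RHS](eq_bigl (fun i => i \in J2)); last by move=> i; rewrite inE.
by apply: eq_bigr => i /P2.
Qed.

(** The shape needed for Fubini: once [p.2] is fixed, a hybrid value is a polynomial in [X] alone,
    to which the hypercontractivity of [X] applies. *)
Lemma eval_hybrid B X Y (Q : mlpoly R m) p :
  (forall i w, X i ord0 w = 1) -> (forall i w, Y i ord0 w = 1) ->
  eval Q (at_point (hybrid B X Y) p) =
  eval (fun t => if supported_on B t then eval (coef B t Q) (at_point Y p.2) else 0)
    (at_point X p.1).
Proof.
move=> X1 Y1.
have h1 (i : 'I_n) : (at_point (hybrid B X Y) p : values R m) i ord0 = 1.
  by rewrite /at_point /hybrid; case: (B i).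
rewrite (eval_coef B)// [RHS]/eval big_mkcond/=; apply: eq_bigr => t _.
case: ifPn => ht; last by rewrite mul0r.
congr (_ * _).
  apply: eval_coef_supported => //; first by move=> i; exact: Y1.
  by move=> i /negPf Bi; apply/funext => j; rewrite /at_point /hybrid Bi.
apply: (monomial_supported _ _ _ ht) => //; first by move=> i; exact: X1.
by move=> i Bi; apply/funext => j; rewrite /at_point /hybrid Bi.
Qed.

(** For fixed [w'], hypercontractivity of [X] bounds the inner integral by the cube of the [l^2]
    norm of the coefficients [g t w']. Minkowski's inequality in [L^(3/2)] moves the integral over
    [w'] inside the sum, where that of [Y] applies to each coefficient. *)
Lemma hybrid_cube_hypercontractive eta B X Y :
  independent_ensembles P X -> independent_ensembles P' Y ->
  cube_hypercontractive P eta X -> cube_hypercontractive P' eta Y ->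
  cube_hypercontractive PP eta (hybrid B X Y).
Proof.
move=> iX iY hX hY Q.
pose f p := `|eval (noise_op eta Q) (at_point (hybrid B X Y) p)| ^+ 3.
have mf : measurable_fun setT f.
  apply: measurable_funX; apply: measurableT_comp => //.
  exact: (measurable_eval _ (ie_measurable (hybrid_independent B iX iY))).
have f0 p : 0 <= f p by exact: exprn_ge0.
apply: Rintegrable_ge0_le => //.
have mfE : measurable_fun setT (fun p => (f p)%:E) by exact/measurable_EFinP.
pose g t w' := eval (noise_op eta (coef B t Q)) (at_point Y w').
pose a t := Num.sqrt (sqnorm (coef B t Q)).
pose W := sqnorm Q.
(* The bound given by [hoelder_three_halves] with the norms [a t] as weights. Each mean of
   [|g t w'|^3 / a t] is at most [a t ^ 2], and these add up to [W]. *)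
pose G w' := Num.sqrt W * \sum_(t | supported_on B t) (a t)^-1 * `|g t w'| ^+ 3.
have a2 t : a t ^+ 2 = sqnorm (coef B t Q) by rewrite sqr_sqrtr ?sqnorm_ge0.
have WE : \sum_(t | supported_on B t) a t ^+ 2 = W.
  by rewrite /W (sqnorm_coef B); apply: eq_bigr => t _.
have sg t : Rintegrable P' (fun w' => (a t)^-1 * `|g t w'| ^+ 3).
  by apply: RintegrableZ; have [] := hY (coef B t Q).
have sS : Rintegrable P' (fun w' => \sum_(t | supported_on B t) (a t)^-1 * `|g t w'| ^+ 3).
  by apply: Rintegrable_sum => t _; exact: sg.
have sG : Rintegrable P' G by exact: RintegrableZ.
have mG : mean P' G <= Num.sqrt W ^+ 3.
  rewrite /G (meanZ _ sS) mean_sum; last by move=> t _; exact: sg.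
  rewrite exprS; apply: ler_wpM2l; first exact: sqrtr_ge0.
  rewrite sqr_sqrtr ?sqnorm_ge0// -WE; apply: ler_sum => t _.
  have [sY mY] := hY (coef B t Q).
  rewrite (meanZ _ sY); apply: (@le_trans _ _ ((a t)^-1 * a t ^+ 3)).
    by apply: ler_wpM2l => //; rewrite invr_ge0 sqrtr_ge0.
  have [->|at0] := eqVneq (a t) 0; first by rewrite invr0 mul0r sqr_ge0.
  by rewrite exprS mulKf.
have inner w' : (\int[P]_w (f (w, w'))%:E <= (G w')%:E)%E.
  pose q t := if supported_on B t then g t w' else 0.
  have fE w : f (w, w') = `|eval (noise_op eta q) (at_point X w)| ^+ 3.
    rewrite /f eval_hybrid; [|exact: ie_one iX|exact: ie_one iY].
    congr (`|_| ^+ 3); apply: eval_ext => t; rewrite /noise_op /q.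
    by case: ifPn => ht; rewrite ?mulr0// eval_coef_noise_op.
  have [sq mq] := hX q.
  under eq_integral do rewrite fE.
  rewrite meanE// lee_fin; apply: (le_trans mq).
  have -> : sqnorm q = \sum_(t | supported_on B t) g t w' ^+ 2.
    rewrite /sqnorm [RHS]big_mkcond/=; apply: eq_bigr => t _.
    by rewrite /q; case: ifP => // _; rewrite expr0n.
  rewrite /G -WE; under [X in _ <= _ * X]eq_bigr do rewrite mulrC.
  apply: hoelder_three_halves => t; first exact: sqrtr_ge0.
  move=> at0; apply: eval_sqnorm0.
  have c0 : sqnorm (coef B t Q) = 0 by rewrite -a2 at0 expr0n.
  by apply: big1 => s _; rewrite /noise_op (sqnorm_eq0 _ c0) mulr0 expr0n.
rewrite (fubini_tonelli2 (fun p => (f p)%:E))//.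
apply: (@le_trans _ _ (\int[P']_w' (G w')%:E)%E); last by rewrite meanE// lee_fin.
have f0E p : (0 <= (f p)%:E)%E by rewrite lee_fin.
have mFG := measurable_fun_fubini_tonelli_G (m1 := P) _ mfE f0E.
have mGE : measurable_fun setT (fun w' => (G w')%:E).
  by apply/measurable_EFinP; exact: Rintegrable_measurable sG.
apply: ge0_le_integral => //.
- by move=> w' _; apply: integral_ge0.
- by move=> w' _; exact: inner.
Qed.

End HybridEnsembles.

(** * Replacing all ensembles in a polynomial of bounded degree *)

Section Invariance.
Context {d d' : measure_display} {T : measurableType d} {T' : measurableType d'}.
Context {R : realType} (P : probability T R) (P' : probability T' R).
Context {n : nat} {m : 'I_n -> nat}.
Variables (X : @families d T R n m) (Y : @families d' T' R n m).
Hypothesis iX : independent_ensembles P X.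
Hypothesis iY : independent_ensembles P' Y.
Implicit Types (Q : mlpoly R m).

Local Notation PP := (P \x P')%E.

Definition degree_le (D : nat) Q : Prop := forall s, (D < msupp_size s)%N -> Q s = 0.

Lemma sqnorm_noise_inv eta D Q : 0 < eta <= 1 -> degree_le D Q ->
  sqnorm (noise_op eta^-1 Q) <= eta^-1 ^+ (2 * D) * sqnorm Q.
Proof.
move=> /andP[eta0 eta1] dQ; rewrite /sqnorm mulr_sumr; apply: ler_sum => s _.
rewrite /noise_op exprMn -exprM mulnC.
have [sD|Ds] := leqP (msupp_size s) D; last by rewrite dQ// expr0n/= !mulr0.
apply: ler_wpM2r; first exact: sqr_ge0.
by apply: ler_weXn2l; rewrite ?leq_mul2l//; rewrite invf_ge1.
Qed.

(** Hypercontractivity is applied to [noise_op eta^-1 Q], whose norm exceeds that of [Q] by at most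
    a factor [eta^-D]. *)
Lemma mean_cube_degree {d1} {T1 : measurableType d1} (P1 : probability T1 R)
    (Z : @families d1 T1 R n m) eta D Q :
  0 < eta <= 1 -> cube_hypercontractive P1 eta Z -> degree_le D Q ->
  mean P1 (fun w => `|eval Q (at_point Z w)| ^+ 3)
    <= eta^-1 ^+ (3 * D) * Num.sqrt (sqnorm Q) ^+ 3.
Proof.
move=> /[dup] eta01 /andP[eta0 eta1] hZ dQ.
have [_] := hZ (noise_op eta^-1 Q).
have e0 : eta != 0 by rewrite gt_eqF.
rewrite (mean_ext P1 (g := fun w => `|eval Q (at_point Z w)| ^+ 3)); last first.
  by move=> w; rewrite (eval_ext _ (noise_opK Q e0)).
move/le_trans; apply.
have -> : eta^-1 ^+ (3 * D) = Num.sqrt (eta^-1 ^+ (2 * D)) ^+ 3.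
  rewrite [(2 * D)%N]mulnC [_ ^+ (D * 2)]exprM sqrtr_sqr ger0_norm ?exprn_ge0 ?invr_ge0 ?ltW//.
  by rewrite -exprM mulnC.
rewrite -exprMn; apply: lerXn2r; rewrite ?nnegrE ?mulr_ge0 ?sqrtr_ge0//.
rewrite -sqrtrM; last by rewrite exprn_ge0// invr_ge0 ltW.
by apply: ler_wsqrtr; exact: sqnorm_noise_inv.
Qed.

Lemma degree_dependent_part k D Q : degree_le D Q -> degree_le D (dependent_part k Q).
Proof. by move=> dQ s /dQ Qs; rewrite /dependent_part Qs if_same. Qed.

(** Exchanging sums, the square of each coefficient is counted once for every index in its support,
    hence at most [D] times. *)
Lemma sum_influences D Q : degree_le D Q ->
  \sum_k sqnorm (dependent_part k Q) <= D%:R * mlpoly_var Q.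
Proof.
move=> dQ; rewrite /sqnorm exchange_big/= /mlpoly_var [X in _ <= _ * X]big_mkcond mulr_sumr/=.
apply: ler_sum => s _.
have -> : \sum_(k < n) dependent_part k Q s ^+ 2 = (msupp_size s)%:R * Q s ^+ 2.
  rewrite /dependent_part (eq_bigr (fun k => if s k != ord0 then Q s ^+ 2 else 0)).
    by rewrite -big_mkcond sumr_const mulr_natl.
  by move=> k _; case: ifP => // _; rewrite expr0n.
have [sD|Ds] := leqP (msupp_size s) D; last by rewrite dQ// expr0n/= !mulr0 if_same mulr0.
case: posnP => [->|_]; first by rewrite mul0r mulr0.
by apply: ler_wpM2r; [exact: sqr_ge0|rewrite ler_nat].
Qed.

(** A replacement costs twice the third moment of [dependent_part], which is at most [eta^(-3D)
    I^(3/2) <= eta^(-3D) sqrt(tau) I] for an influence [I <= tau]; the remaining factors [I] sum to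
    at most [D] times the variance. *)
Lemma invariance_cube eta D tau Q : 0 < eta <= 1 ->
  cube_hypercontractive P eta X -> cube_hypercontractive P' eta Y ->
  degree_le D Q -> (forall k, sqnorm (dependent_part k Q) <= tau) ->
  `| mean P (fun w => pospart (eval Q (at_point X w)) ^+ 3)
     - mean P' (fun w => pospart (eval Q (at_point Y w)) ^+ 3) |
  <= 2 * eta^-1 ^+ (3 * D) * Num.sqrt tau * (D%:R * mlpoly_var Q).
Proof.
move=> /[dup] eta01 /andP[eta0 eta1] hX hY dQ infQ.
(* The first [j] ensembles come from [Y], the others from [X]; [H 0] is [X] and [H n] is [Y]. *)
pose H (j : nat) := hybrid (fun i : 'I_n => (j <= i)%N) X Y.
have iH j : independent_ensembles PP (H j) by exact: hybrid_independent.
have hH j : cube_hypercontractive PP eta (H j) by exact: hybrid_cube_hypercontractive.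
have cH j : cube_integrable PP (H j).
  by apply: cube_hypercontractive_Rintegrable (hH j); rewrite gt_eqF.
pose E j := mean PP (fun p => pospart (eval Q (at_point (H j) p)) ^+ 3).
have cX : cube_integrable P X.
  by apply: cube_hypercontractive_Rintegrable hX; rewrite gt_eqF.
have cY : cube_integrable P' Y.
  by apply: cube_hypercontractive_Rintegrable hY; rewrite gt_eqF.
have spos d1 (T1 : measurableType d1) (P1 : probability T1 R)
    (Z : @families d1 T1 R n m) : independent_ensembles P1 Z -> cube_integrable P1 Z ->
    Rintegrable P1 (fun w => pospart (eval Q (at_point Z w)) ^+ 3).
  move=> iZ cZ; apply: (Rintegrable_dominated _ (cZ Q)) => [|w].
    apply: measurable_funX; apply: (measurableT_comp measurable_pospart).
    exact: (measurable_eval _ (ie_measurable iZ)).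
  by rewrite normrX ger0_norm ?pospart_ge0// lerXn2r ?nnegrE ?pospart_ge0 ?pospart_le_norm.
have E0 : mean P (fun w => pospart (eval Q (at_point X w)) ^+ 3) = E 0%N.
  by rewrite -(Rintegrable_fst P' (spos _ _ _ _ iX cX)).2.
have En : mean P' (fun w => pospart (eval Q (at_point Y w)) ^+ 3) = E n.
  rewrite -(Rintegrable_snd P (spos _ _ _ _ iY cY)).2; apply: mean_ext => p /=.
  congr (pospart (eval Q _) ^+ 3); rewrite /at_point.
  apply/functional_extensionality_dep => i; apply/funext => j.
  by rewrite /H /hybrid leqNgt ltn_ord.
have step (k : 'I_n) : `|E k - E k.+1| <=
    2 * eta^-1 ^+ (3 * D) * Num.sqrt tau * sqnorm (dependent_part k Q).
  have bnd j : mean PP (fun p => `|eval (dependent_part k Q) (at_point (H j) p)| ^+ 3)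
      <= eta^-1 ^+ (3 * D) * Num.sqrt tau * sqnorm (dependent_part k Q).
    apply: (le_trans (mean_cube_degree eta01 (hH j) (degree_dependent_part k dQ))).
    rewrite -mulrA; apply: ler_wpM2l; first by rewrite exprn_ge0// invr_ge0 ltW.
    rewrite exprS sqr_sqrtr ?sqnorm_ge0//; apply: ler_wpM2r; first exact: sqnorm_ge0.
    exact: ler_wsqrtr.
  (* Coefficients off [k] take the same values on [H k] and [H k.+1], so both applications of
     [lindeberg_step] compare with the same number, [C] below. *)
  have agree t p : eval (coef (pred1 k) t Q) (at_point (H k) p) =
                   eval (coef (pred1 k) t Q) (at_point (H k.+1) p).
    apply: eval_coef_supported => [i|i|i ik].
    - exact: ie_one (iH k) i p.
    - exact: ie_one (iH k.+1) i p.
    apply/funext => j; rewrite /at_point /H /hybrid.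
    by rewrite [in LHS]leq_eqVlt eq_sym (negPf (ik : i != k :> nat)).
  have := lindeberg_step k Q (iH k) (cH k).
  have := lindeberg_step k Q (iH k.+1) (cH k.+1).
  rewrite -!/(E _).
  under [X in _ + 3 * X]eq_bigr do under mean_ext do rewrite -!agree.
  under mean_ext do rewrite -agree.
  set C := (X in `|_ - X| <= _ -> `|_ - X| <= _ -> _).
  move=> h1 h2; have := le_trans h1 (bnd _); have := le_trans h2 (bnd _).
  rewrite !ler_norml => /andP[? ?] /andP[? ?]; apply/andP; split; lra.
rewrite E0 En.
have -> : E 0%N - E n = \sum_(k < n) (E k - E k.+1).
  elim: (n) => [|l IH]; first by rewrite big_ord0 subrr.
  by rewrite big_ord_recr/= -IH; ring.
apply: (le_trans (ler_norm_sum _ _ _)).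
apply: (le_trans (ler_sum _ (fun k _ => step k))).
rewrite -mulr_sumr; apply: ler_wpM2l (sum_influences dQ).
by rewrite !mulr_ge0// ?sqrtr_ge0// exprn_ge0// invr_ge0 ltW.
Qed.

End Invariance.

(** * Hypercontractivity from fourth moments *)

Lemma measurable_sum_cond {d : measure_display} {T : measurableType d} {R : realType}
    (I : finType) (A : pred I) (F : I -> T -> R) :
  (forall i, A i -> measurable_fun setT (F i)) ->
  measurable_fun setT (fun w => \sum_(i | A i) F i w).
Proof.
move=> mF; rewrite (_ : (fun _ => _) = (fun w => \sum_i (if A i then F i w else 0))).
  apply: measurable_sum => i; case: (boolP (A i)) => [/mF //|_].
  exact: measurable_cst.
by apply/funext => w; rewrite big_mkcond.
Qed.

Section FourthMoments.
Context {d : measure_display} {T : measurableType d} {R : realType}.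
Variable P : probability T R.
Context {n : nat} {m : 'I_n -> nat}.
Implicit Types (Q : mlpoly R m) (s t : multi_index m).

Definition nonconstant_at (k : 'I_n) t : bool :=
  supported_on (pred1 k) t && (t != multi_index0).

Variable Z : @families d T R n m.
Arguments Z : clear implicits.
Hypothesis iZ : independent_ensembles P Z.

(** The multi-indices [t] have their only nonzero entry at [k], so this is the sum of the squares of
    the nonconstant variables of the [k]-th ensemble. *)
Definition ensemble_sqnorm (k : 'I_n) (w : T) : R :=
  \sum_(t | nonconstant_at k t) monomial (at_point Z w) t ^+ 2.

Let mev Q : measurable_fun setT (fun w => eval Q (at_point Z w)).
Proof. exact: (measurable_eval _ (ie_measurable iZ)). Qed.

Let Z1 w i : (at_point Z w : values R m) i ord0 = 1.
Proof. exact: ie_one iZ i w. Qed.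

Lemma measurable_wrt_ensemble_sqnorm k :
  measurable_wrt (sigma_family (Z k)) (fun w => ensemble_sqnorm k w ^+ 2).
Proof.
pose T' := g_sigma_algebraType (\bigcup_j preimage_set_system setT (Z k j) measurable).
have mt t (ht : supported_on (pred1 k) t) := measurable_wrt_monomial (ie_one iZ) ht.
have mG : measurable_fun [set: T'] (fun w : T' => ensemble_sqnorm k w ^+ 2).
  apply: measurable_funX; apply: measurable_sum_cond => t /andP[ht _].
  by apply: measurable_funX; exact: mt.
by move=> U mU; have := mG measurableT U mU; rewrite setTI.
Qed.

(** Cauchy-Schwarz separates the coefficients, which live off [k], from the variables at [k]; after
    squaring, independence factorizes the mean. *)
Lemma sqr_dependent_part_le k Q w :
  eval (dependent_part k Q) (at_point Z w) ^+ 2 <=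
  (\sum_(t | nonconstant_at k t) eval (coef (pred1 k) t Q) (at_point Z w) ^+ 2)
    * ensemble_sqnorm k w.
Proof.
rewrite eval_dependent_part//.
pose b t := eval (coef (pred1 k) t Q) (at_point Z w) * monomial (at_point Z w) t.
pose c t := eval (coef (pred1 k) t Q) (at_point Z w) ^+ 2.
have c0 t : 0 <= c t by exact: sqr_ge0.
have cb t : c t = 0 -> b t = 0.
  by move/eqP; rewrite sqrf_eq0 => /eqP c00; rewrite /b c00 mul0r.
apply: (le_trans (cauchy_schwarz_weighted (nonconstant_at k) c0 cb)).
apply: ler_wpM2l; first exact: sumr_ge0.
apply: ler_sum => t _; rewrite /b /c exprMn.
have [->|h] := eqVneq (eval (coef (pred1 k) t Q) (at_point Z w)) 0.
  by rewrite expr0n/= !mul0r sqr_ge0.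
by rewrite mulrAC divff ?mul1r// expf_neq0.
Qed.

Lemma cube_mul_le_fourth (a b : R) : `|a ^+ 3 * b| <= a ^+ 4 + b ^+ 4.
Proof.
have h (x y : R) : 0 <= x -> 0 <= y -> x ^+ 3 * y <= x ^+ 4 + y ^+ 4.
  move=> x0 y0; have := ler_wpM2l x0 (sqrM_le_cubes x0 y0).
  have := ler_wpM2l x0 (cube_tangent y0 x0).
  have := ler_wpM2l y0 (cube_tangent x0 y0).
  have := exprn_ge0 4 x0; have := exprn_ge0 4 y0.
  have := sqr_ge0 (x ^+ 2 - y ^+ 2); have := sqr_ge0 (x ^+ 2 - x * y).
  have := sqr_ge0 (y ^+ 2 - x * y); lra.
rewrite normrM normrX; apply: le_trans (h _ _ (normr_ge0 a) (normr_ge0 b)) _.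
by rewrite -!normrX !ger0_norm ?exprn_even_ge0.
Qed.

Lemma sqr_mul2_le_fourth (a b c : R) : `|a ^+ 2 * (b * c)| <= a ^+ 4 + b ^+ 4 + c ^+ 4.
Proof.
rewrite normrM (normrM b) ger0_norm ?sqr_ge0//.
have h : 2 * (`|b| * `|c|) <= b ^+ 2 + c ^+ 2.
  rewrite -(real_normK (num_real b)) -(real_normK (num_real c)).
  by have := sqr_ge0 (`|b| - `|c|); lra.
have := ler_wpM2l (sqr_ge0 a) h.
have := sqr_ge0 (a ^+ 2 - b ^+ 2); have := sqr_ge0 (a ^+ 2 - c ^+ 2).
have p4 (x : R) : 0 <= x ^+ 4 by exact: exprn_even_ge0.
have := p4 a; have := p4 b; have := p4 c; lra.
Qed.

Variables (M eta : R).
Hypothesis sM : forall k, Rintegrable P (fun w => ensemble_sqnorm k w ^+ 2).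
Hypothesis leM : forall k, mean P (fun w => ensemble_sqnorm k w ^+ 2) <= M.
Hypothesis eta_ge0 : 0 <= eta.
Hypothesis eta_le : 8 * eta ^+ 2 <= 2.
Hypothesis eta_M : 3 * M * eta ^+ 4 <= 1.

Let bounded_fourth Q :=
  Rintegrable P (fun w => eval (noise_op eta Q) (at_point Z w) ^+ 4) /\
  mean P (fun w => eval (noise_op eta Q) (at_point Z w) ^+ 4) <= sqnorm Q ^+ 2.

(** With [A] the part free of the [k]-th ensemble and [F] the rest, [fourth_power_expansion] is
    integrated: the term in [A^3 F] vanishes, [F^2] becomes [S = eta^2 V], and [F^4] costs at most
    [M] times [S^2]. The two conditions on [eta] say precisely that the result is at most the mean
    of [A^4 + 2 A^2 V + V^2 = (A^2 + V)^2]. *)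
Let fourth_step k Q : (forall t, bounded_fourth (coef (pred1 k) t Q)) -> bounded_fourth Q.
Proof.
move=> IH; rewrite /bounded_fourth; set QE := noise_op eta Q.
pose B t w := eval (noise_op eta (coef (pred1 k) t Q)) (at_point Z w).
pose C t w := eval (coef (pred1 k) t QE) (at_point Z w).
pose A := C multi_index0.
pose F w := eval (dependent_part k QE) (at_point Z w).
have CE t w : supported_on (pred1 k) t -> C t w = eta ^+ (t != multi_index0) * B t w.
  by move=> ht; rewrite /C eval_coef_noise_op// (msupp_size_pred1 ht).
have AE w : A w = B multi_index0 w.
  by rewrite /A CE ?supported_on0// eqxx mul1r.
pose V w := \sum_(t | nonconstant_at k t) B t w ^+ 2.
pose S w := \sum_(t | nonconstant_at k t) C t w ^+ 2.
have SE w : S w = eta ^+ 2 * V w.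
  rewrite /S /V mulr_sumr; apply: eq_bigr => t /andP[ht t0].
  by rewrite CE// t0 exprMn expr1.
have mB t : measurable_fun setT (B t) by exact: mev.
have mC t : measurable_fun setT (C t) by exact: mev.
have moC t : measurable_off Z k (C t).
  by apply: measurable_off_eval_coef; exact: (ie_one iZ).
have sB4 t : Rintegrable P (fun w => B t w ^+ 4) by have [] := IH t.
have sA4 : Rintegrable P (fun w => A w ^+ 4).
  by apply: Rintegrable_ext (sB4 multi_index0) => w; rewrite AE.
pose wt t := sqnorm (coef (pred1 k) t Q).
pose W := sqnorm Q.
have WE : W = \sum_(t | supported_on (pred1 k) t) wt t by exact: sqnorm_coef.
(* A pointwise majorant of [(A^2 + V)^2], by Cauchy-Schwarz weighted with the squared norms [wt t].
   The induction hypothesis bounds its mean by [W^2]. *)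
pose N w := W * \sum_(t | supported_on (pred1 k) t) (wt t)^-1 * B t w ^+ 4.
have sN0 : Rintegrable P (fun w =>
    \sum_(t | supported_on (pred1 k) t) (wt t)^-1 * B t w ^+ 4).
  by apply: Rintegrable_sum => t _; exact: RintegrableZ.
have sN : Rintegrable P N by exact: RintegrableZ.
have W0 : 0 <= W by exact: sqnorm_ge0.
have mN : mean P N <= W ^+ 2.
  rewrite /N (meanZ _ sN0) expr2; apply: ler_wpM2l => //.
  rewrite mean_sum; last by move=> t _; exact: RintegrableZ.
  rewrite WE; apply: ler_sum => t _; rewrite (meanZ _ (sB4 t)).
  have wt0 : 0 <= wt t by exact: sqnorm_ge0.
  have [wt00|wtn0] := eqVneq (wt t) 0; first by rewrite wt00 invr0 mul0r.
  apply: (@le_trans _ _ ((wt t)^-1 * wt t ^+ 2)).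
    by apply: ler_wpM2l; [rewrite invr_ge0|have [] := IH t].
  by rewrite expr2 mulKf.
have UN w : (A w ^+ 2 + V w) ^+ 2 <= N w.
  have -> : A w ^+ 2 + V w = \sum_(t | supported_on (pred1 k) t) B t w ^+ 2.
    by rewrite AE /V [RHS](bigD1 multi_index0) ?supported_on0.
  rewrite /N WE.
  have wt0 t : 0 <= wt t by exact: sqnorm_ge0.
  have wtB t : wt t = 0 -> B t w ^+ 2 = 0.
    move=> h; rewrite /B /eval big1 ?expr0n// => s _.
    by rewrite /noise_op (sqnorm_eq0 _ h) mulr0 mul0r.
  apply: (le_trans (cauchy_schwarz_weighted _ wt0 wtB)).
  apply: ler_wpM2l; first exact: sumr_ge0.
  by apply: ler_sum => t _; rewrite mulrC -exprM.
have V0 w : 0 <= V w by apply: sumr_ge0 => t _; exact: sqr_ge0.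
have mV : measurable_fun setT V.
  by apply: measurable_sum_cond => t _; exact: measurable_funX.
have mA : measurable_fun setT A by exact: mC.
have sV2 : Rintegrable P (fun w => V w ^+ 2).
  apply: (Rintegrable_dominated _ sN) => [|w]; first exact: measurable_funX.
  rewrite ger0_norm ?sqr_ge0//; apply: le_trans (UN w).
  rewrite lerXn2r ?nnegrE ?addr_ge0 ?sqr_ge0//.
  by rewrite lerDr sqr_ge0.
have sA2V : Rintegrable P (fun w => A w ^+ 2 * V w).
  apply: (Rintegrable_dominated _ sN) => [|w].
    by apply: measurable_funM => //; exact: measurable_funX.
  rewrite ger0_norm; last by apply: mulr_ge0 => //; exact: sqr_ge0.
  apply: le_trans (UN w).
  have := mulr_ge0 (sqr_ge0 (A w)) (V0 w).
  by have := sqr_ge0 (A w ^+ 2); have := sqr_ge0 (V w); lra.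
have sC4 t : supported_on (pred1 k) t -> Rintegrable P (fun w => C t w ^+ 4).
  move=> ht; apply: Rintegrable_ext (RintegrableZ ((eta ^+ (t != multi_index0)) ^+ 4) (sB4 t)).
  by move=> w; rewrite CE// exprMn.
have [sL mL] : Rintegrable P (fun w => A w ^+ 3 * F w) /\ mean P (fun w => A w ^+ 3 * F w) = 0.
  apply: (@mean_linear_off _ _ _ P _ _ Z k _ QE iZ) => [|t ht].
    exact: (measurable_funX 3 (moC multi_index0)).
  apply: (Rintegrable_dominated _ (RintegrableD sA4 (sC4 t ht))) => [|w].
    by apply: measurable_funM; [exact: measurable_funX|exact: mC].
  exact: cube_mul_le_fourth.
have [sQ mQ] : Rintegrable P (fun w => A w ^+ 2 * F w ^+ 2) /\
    mean P (fun w => A w ^+ 2 * F w ^+ 2) = mean P (fun w => A w ^+ 2 * S w).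
  have sAC t t' : supported_on (pred1 k) t -> supported_on (pred1 k) t' ->
      Rintegrable P (fun w => A w ^+ 2 * (C t w * C t' w)).
    move=> ht ht'.
    apply: (Rintegrable_dominated _ (RintegrableD (RintegrableD sA4 (sC4 t ht)) (sC4 t' ht'))) => [|w].
      by apply: measurable_funM; [exact: measurable_funX|apply: measurable_funM; exact: mC].
    exact: sqr_mul2_le_fourth.
  have [h1 h2] := @mean_quadratic_off _ _ _ P _ _ Z k _ QE iZ
    (measurable_funX 2 (moC multi_index0)) sAC.
  split=> //; rewrite h2 -mean_sum; last by move=> t /andP[ht _]; exact: sAC.
  by apply: mean_ext => w; rewrite /S mulr_sumr; apply: eq_bigr.
have moS : measurable_off Z k (fun w => S w ^+ 2).
  apply: measurable_funX; apply: measurable_sum_cond => t _.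
  by apply: measurable_funX; exact: moC.
have sS2 : Rintegrable P (fun w => S w ^+ 2).
  by apply: Rintegrable_ext (RintegrableZ ((eta ^+ 2) ^+ 2) sV2) => w; rewrite SE [RHS]exprMn.
have [sSG mSG] := independent_product_off iZ moS (@measurable_wrt_ensemble_sqnorm k) sS2 (sM k).
pose H w := A w ^+ 4 + 4 * (A w ^+ 3 * F w) + 8 * (A w ^+ 2 * F w ^+ 2)
            + 3 * (S w ^+ 2 * ensemble_sqnorm k w ^+ 2).
have s1 := RintegrableZ 4 sL; have s2 := RintegrableZ 8 sQ; have s3 := RintegrableZ 3 sSG.
have s01 := RintegrableD sA4 s1; have s012 := RintegrableD s01 s2.
have sH : Rintegrable P H by exact: RintegrableD.
have fH w : eval QE (at_point Z w) ^+ 4 <= H w.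
  rewrite (eval_split k)//.
  have := fourth_power_expansion (A w) 1 (F w); rewrite mul1r !expr1n !mulr1.
  move/le_trans; apply; rewrite /H lerD2l; apply: ler_wpM2l => //.
  have h := sqr_dependent_part_le k QE w; rewrite -exprMn (exprM _ 2 2).
  rewrite lerXn2r// ?nnegrE ?sqr_ge0// mulr_ge0//; last first.
    by apply: sumr_ge0 => t _; exact: sqr_ge0.
  by apply: sumr_ge0 => t _; exact: sqr_ge0.
have f0 w : 0 <= eval QE (at_point Z w) ^+ 4 by exact: exprn_even_ge0.
have sf : Rintegrable P (fun w => eval QE (at_point Z w) ^+ 4).
  apply: (Rintegrable_dominated _ sH) => [|w]; first by apply: measurable_funX; exact: mev.
  by rewrite ger0_norm.
split=> //; apply: (le_trans (le_mean sf sH fH)).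
rewrite (meanD s012 s3) (meanD s01 s2) (meanD sA4 s1) (meanZ _ sL) (meanZ _ sQ) (meanZ _ sSG).
rewrite mL mQ mSG mulr0 addr0.
apply: le_trans mN.
have sAS : Rintegrable P (fun w => A w ^+ 2 * S w).
  by apply: Rintegrable_ext (RintegrableZ (eta ^+ 2) sA2V) => w; rewrite SE; ring.
have s1' := RintegrableZ 8 sAS; have s2' := RintegrableZ (3 * M) sS2.
have s01' := RintegrableD sA4 s1'; have s012' := RintegrableD s01' s2'.
apply: (@le_trans _ _ (mean P (fun w => A w ^+ 4 + 8 * (A w ^+ 2 * S w) + 3 * M * S w ^+ 2))).
  rewrite (meanD s01' s2') (meanD sA4 s1') (meanZ _ sAS) (meanZ _ sS2) lerD2l.
  rewrite -mulrA; apply: ler_wpM2l => //; rewrite mulrC.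
  apply: ler_wpM2r; last exact: leM.
  by apply: mean_ge0 => w; exact: sqr_ge0.
apply: le_mean => // w; apply: le_trans (UN w).
rewrite SE.
have h1 : 8 * eta ^+ 2 * (A w ^+ 2 * V w) <= 2 * (A w ^+ 2 * V w).
  by apply: ler_wpM2r => //; rewrite mulr_ge0// sqr_ge0.
have h2 : 3 * M * eta ^+ 4 * V w ^+ 2 <= 1 * V w ^+ 2.
  by apply: ler_wpM2r => //; rewrite sqr_ge0.
lra.
Qed.

(** The induction is on [k], for polynomials in the first [k] ensembles; taking coefficients
    relative to the last of them leaves polynomials in one ensemble less. *)
Lemma bonami_fourth Q :
  Rintegrable P (fun w => eval (noise_op eta Q) (at_point Z w) ^+ 4) /\
  mean P (fun w => eval (noise_op eta Q) (at_point Z w) ^+ 4) <= sqnorm Q ^+ 2.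
Proof.
suff H : forall k, (k <= n)%N -> forall Q,
    (forall s, ~~ supported_on (fun i : 'I_n => (i < k)%N) s -> Q s = 0) ->
    bounded_fourth Q.
  apply: (H n (leqnn n)) => s /negP[]; apply/supported_onP => i.
  by rewrite ltn_ord.
elim=> [_ {}Q hQ|k IH kn {}Q hQ].
  have Q0 s : s != multi_index0 -> Q s = 0.
    move=> s0; apply: hQ; apply: contra s0 => /supported_onP h.
    by apply/eqP/ffunP => i; rewrite ffunE h.
  have fE w : eval (noise_op eta Q) (at_point Z w) = Q multi_index0.
    rewrite /eval (bigD1 multi_index0)//= big1 ?addr0.
      by rewrite /noise_op msupp_size0 mul1r monomial0// mulr1.
    by move=> s s0; rewrite /noise_op Q0// mulr0 mul0r.
  have eqc : (fun=> Q multi_index0 ^+ 4) =1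
      (fun w => eval (noise_op eta Q) (at_point Z w) ^+ 4) by move=> w; rewrite fE.
  split; first exact: (Rintegrable_ext eqc (Rintegrable_cst P _)).
  rewrite -(mean_ext P eqc) mean_cst /sqnorm (bigD1 multi_index0)//= big1 ?addr0.
    by rewrite -exprM.
  by move=> s s0; rewrite Q0// expr0n.
apply: (fourth_step (k := Ordinal kn)) => t; apply: IH (ltnW kn) _ _ => s hs.
rewrite /coef; case: ifPn => // /supported_onP hsk; apply: hQ.
apply: contra hs => /supported_onP h; apply/supported_onP => i ik.
have [->|iNk] := eqVneq i (Ordinal kn); first by rewrite hsk//= negbK.
have := h i; rewrite ffunE /= (negPf iNk); apply.
by rewrite ltnS leq_eqVlt negb_or ik andbT.
Qed.

(** [L^3] is interpolated between [L^2] and [L^4] through [cube_norm_le_sqr_fourth], with [s] the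
    norm of [Q]: each of the two terms then has mean at most [s^3]. *)
Lemma bonami_cube : cube_hypercontractive P eta Z.
Proof.
move=> Q; have [s4 m4] := bonami_fourth Q.
set f := fun w => eval (noise_op eta Q) (at_point Z w).
have sf2 : Rintegrable P (fun w => f w ^+ 2) by exact: (Rintegrable_eval_sqr _ iZ).
have mf3 : measurable_fun setT (fun w => `|f w| ^+ 3).
  by apply: measurable_funX; apply: measurableT_comp => //; exact: mev.
have eta1 : eta <= 1.
  have e2 : eta ^+ 2 <= 1 by move: eta_le; lra.
  by rewrite -(ler_pXn2r (n := 2)) ?nnegrE// expr1n.
have m2 : mean P (fun w => f w ^+ 2) <= sqnorm Q.
  rewrite (mean_eval_sqr _ iZ); apply: ler_sum => s _; rewrite /noise_op exprMn.
  by rewrite ler_piMl ?sqr_ge0// exprn_ile1// ?exprn_ge0// exprn_ile1.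
set s := Num.sqrt (sqnorm Q); have s0 : 0 <= s by exact: sqrtr_ge0.
have sE : sqnorm Q = s ^+ 2 by rewrite sqr_sqrtr ?sqnorm_ge0.
have [seq0|sn0] := eqVneq s 0.
  have Q0 : sqnorm Q = 0 by rewrite sE seq0 expr0n.
  have f0 : (fun=> 0) =1 (fun w => `|f w| ^+ 3).
    move=> w; rewrite /f /eval big1 ?normr0 ?expr0n// => t _.
    by rewrite /noise_op (sqnorm_eq0 _ Q0) mulr0 mul0r.
  split; first exact: (Rintegrable_ext f0 (Rintegrable_cst P 0)).
  by rewrite -(mean_ext P f0) mean_cst exprn_ge0.
have sgt : 0 < s by rewrite lt_neqAle eq_sym sn0.
have sg2 := RintegrableZ s sf2; have sg4 := RintegrableZ s^-1 s4.
have sg := RintegrableZ 2^-1 (RintegrableD sg2 sg4).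
have le3 w : `|f w| ^+ 3 <= 2^-1 * (s * f w ^+ 2 + s^-1 * f w ^+ 4).
  by rewrite [s^-1 * _]mulrC; exact: cube_norm_le_sqr_fourth.
have s3 : Rintegrable P (fun w => `|f w| ^+ 3).
  by apply: (Rintegrable_dominated mf3 sg) => w; rewrite ger0_norm ?exprn_ge0.
split=> //; apply: (le_trans (le_mean s3 sg le3)).
rewrite (meanZ _ (RintegrableD sg2 sg4)) (meanD sg2 sg4) (meanZ _ sf2) (meanZ _ s4).
have h2 : s * mean P (fun w => f w ^+ 2) <= s ^+ 3.
  by rewrite [leRHS]exprS; apply: ler_wpM2l => //; rewrite -sE.
have h4 : s^-1 * mean P (fun w => f w ^+ 4) <= s ^+ 3.
  rewrite mulrC ler_pdivrMr// -exprSr (le_trans m4)// sE -exprM.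
  by [].
lra.
Qed.

End FourthMoments.

(** * Fourth moments of bits, Gaussians and uniform variables *)

Section FourthMomentOfVariables.
Import HBNNSimple.
Context {R : realType}.

(* Compares an integral to a mass without a change of density: it suffices to
   bound the measure of the sets on which [f] is at least a constant. *)
Lemma ge0_integral_le_of_levels {d} {T : measurableType d}
    (nu nu' : {measure set T -> \bar R}) (f : T -> R) (C : R) :
  (forall x, 0 <= f x) -> 0 <= C ->
  (forall (r : R) A, 0 <= r -> measurable A -> (forall x, A x -> r <= f x) ->
     (r%:E * nu A <= C%:E * nu' A)%E) ->
  (\int[nu]_x (f x)%:E <= C%:E * nu' setT)%E.
Proof.
move=> f0 C0 levels.
rewrite ge0_integralTE; last by move=> x; rewrite lee_fin.
apply: ge_ereal_sup => _ /= [h hf <-].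
rewrite sintegralE.
have mh r : measurable (h @^-1` [set r]).
  by rewrite -[X in measurable X]setTI; exact: measurable_funP.
apply: (@le_trans _ _ (\sum_(r \in range h) C%:E * nu' (h @^-1` [set r]))%E).
  apply: lee_fsum => // r [x _ <-].
  apply: levels => // y /= hy.
  by rewrite -hy -lee_fin; exact: hf.
rewrite -ge0_mule_fsumr; last by move=> r; exact: measure_ge0.
rewrite -measure_fin_bigcup//; last exact: trivIset_preimage1.
apply: lee_wpmul2l; first by rewrite lee_fin.
by apply: le_measure; rewrite ?inE//; apply: fin_bigcup_measurable => // r _.
Qed.

Lemma expR_half_le2 : expR 2^-1 <= 2 :> R.
Proof.
have := expR_ge1Dx (- 2^-1 : R); rewrite expRN => h.
have e0 := expR_gt0 (2^-1 : R).
rewrite -(ler_pM2r (_ : 0 < (expR 2^-1)^-1)) ?invr_gt0// mulfV ?gt_eqF//.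
lra.
Qed.

(** Completing the square, [expR (s x)] times the centered density is [expR (1/2) <= 2] times the
    density centered at [s]. *)
Lemma gaussian_exponential_moment (s : R) : s ^+ 2 = 1 ->
  (\int[normal_prob 0 1]_x (expR (s * x))%:E <= 2%:E)%E.
Proof.
move=> s1.
apply: (@le_trans _ _ (2%:E * normal_prob s 1 setT)%E); last first.
  rewrite -[leRHS]mule1; apply: lee_wpmul2l; first by rewrite lee_fin.
  exact: probability_le1.
apply: (@ge0_integral_le_of_levels _ _ (normal_prob 0 1) (normal_prob s 1)
  (fun x => expR (s * x)) 2) => // r A r0 mA rA.
rewrite /= /normal_prob.
have mp (c : R) : measurable_fun A (fun x => (normal_pdf c 1 x)%:E).
  by apply/measurable_EFinP/measurable_funTS; exact: measurable_normal_pdf.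
have p0 (c x : R) : (0 <= (normal_pdf c 1 x)%:E)%E.
  by rewrite lee_fin normal_pdf_ge0.
rewrite -!ge0_integralZl//.
apply: ge0_le_integral => //.
- by move=> x _; rewrite -EFinM lee_fin mulr_ge0// normal_pdf_ge0.
- exact: measurable_funeM.
- exact: measurable_funeM.
move=> x Ax; rewrite -!EFinM lee_fin !normal_pdfE ?oner_eq0//.
have pk : 0 <= normal_peak (1 : R) by exact: normal_peak_ge0.
apply: (@le_trans _ _ (expR (s * x) * (normal_peak 1 * normal_fun 0 1 x))).
  by apply: ler_wpM2r; [rewrite mulr_ge0// normal_fun_ge0|exact: rA].
rewrite mulrCA [leRHS]mulrCA; apply: ler_wpM2l => //.
have -> : expR (s * x) * normal_fun 0 1 x = expR 2^-1 * normal_fun s 1 x.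
  rewrite /normal_fun -!expRD; congr expR.
  have -> : s * x = s * x * s ^+ 2 by rewrite s1 mulr1.
  rewrite expr1n subr0.
  have -> : - (x - s) ^+ 2 / (1 *+ 2) = - (x ^+ 2 / 2) + s * x - s ^+ 2 / 2 :> R.
    by field.
  have -> : - x ^+ 2 / (1 *+ 2) = - (x ^+ 2 / 2) :> R by field.
  by rewrite s1; field.
by apply: ler_wpM2r; [exact: normal_fun_ge0|exact: expR_half_le2].
Qed.

Lemma fourth_power_le_expR (x : R) : x ^+ 4 <= 24 * (expR (1 * x) + expR (-1 * x)).
Proof.
have h (y : R) : 0 <= y -> y ^+ 4 <= 24 * expR y.
  move=> y0; have := expR_ge1Dxn 3 y0.
  have -> : 4`!%:R = 24 :> R by [].
  lra.
rewrite mul1r mulN1r mulrDr; have [x0|x0] := leP 0 x.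
  by rewrite (le_trans (h _ x0))// lerDl mulr_ge0// expR_ge0.
have -> : x ^+ 4 = (- x) ^+ 4 by rewrite exprNn -signr_odd mul1r.
apply: (le_trans (h (- x) _)); first by rewrite oppr_ge0 ltW.
by rewrite lerDr mulr_ge0// expR_ge0.
Qed.

(** The constant is that of the Gaussian: [x^4 <= 4! (e^x + e^-x)], and both exponential moments are
    at most 2, which gives [24 * (2 + 2)]. The other variables are almost surely at most [sqrt 3] in
    absolute value, so 9 suffices. *)
Lemma H4_variable_fourth {d} {T : measurableType d} (P : probability T R)
    (V : {RV P >-> R}) : H4_variable V ->
  Rintegrable P (fun w => V w ^+ 4) /\ mean P (fun w => V w ^+ 4) <= 96.
Proof.
have mV : measurable_fun setT V by exact: measurable_funPT.
have mV4 : measurable_fun setT (fun w => V w ^+ 4) by exact: measurable_funX.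
have V40 w : 0 <= V w ^+ 4 by exact: exprn_even_ge0.
have bounded (N : set T) : measurable N -> P N = 0%E ->
    (forall w, ~ N w -> V w ^+ 4 <= 9) ->
    Rintegrable P (fun w => V w ^+ 4) /\ mean P (fun w => V w ^+ 4) <= 96.
  move=> mN PN hN.
  have [|s4 m4] := @Rintegrable_ae_bounded _ _ _ P (fun w => V w ^+ 4) 9 N mV4 mN PN.
    by move=> w /hN h; rewrite V40.
  by split=> //; apply: le_trans m4 _; rewrite ler_nat.
have mpre (U : set R) : measurable U -> measurable (V @^-1` U).
  by move=> mU; rewrite -[X in measurable X]setTI; exact: mV.
case=> [[p1 pN1]|gauss|unif].
- have m1 := mpre _ (measurable_set1 (1 : R)).
  have mN1 := mpre _ (measurable_set1 (-1 : R)).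
  apply: (bounded (~` (V @^-1` [set 1] `|` V @^-1` [set -1]))).
  + by apply: measurableC; exact: measurableU.
  + rewrite [LHS]probability_setC; last exact: measurableU.
    have -> : P (V @^-1` [set 1] `|` V @^-1` [set -1]) = 1%E.
      transitivity (P (V @^-1` [set 1%R]) + P (V @^-1` [set (-1)%R]))%E.
        apply: measureU => //; apply/seteqP; split=> // w [/= -> h].
        by have := ltrN10 R; rewrite -h ltr10.
      rewrite [P (V @^-1` [set 1])]p1 [P _]pN1 -EFinD.
      by congr EFin; field.
    by rewrite subee.
  move=> w /contrapT[] /= ->; rewrite ?expr1n ?ler1n//.
  by rewrite -signr_odd expr0 ler1n.
- have le2 (s : R) := @gaussian_exponential_moment s.
  apply: Rintegrable_ge0_le => //.
  have m4 : measurable_fun [set: R] (fun x => (x ^+ 4)%:E).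
    by apply/measurable_EFinP.
  have mV' : @measurable_fun _ _ T (measurableTypeR R) setT V by exact: mV.
  have -> : (\int[P]_w (V w ^+ 4)%:E = \int[normal_prob 0 1]_x (x ^+ 4)%:E)%E.
    have h40 : {in [set: R], forall x, 0 <= (x ^+ 4)%:E}%E.
      by move=> x _; rewrite lee_fin exprn_even_ge0.
    rewrite -[LHS](ge0_integral_pushforward mV' P measurableT m4 h40).
    by apply: eq_measure_integral => A mA _; exact: gauss.
  have me (s : R) : measurable_fun [set: measurableTypeR R] (fun x => (expR (s * x))%:E).
    by apply/measurable_EFinP; apply: measurableT_comp => //; exact: mulrl_measurable.
  apply: (@le_trans _ _ (\int[normal_prob 0 1]_x
      (24%:E * ((expR (1 * x))%:E + (expR (-1 * x))%:E)))%E).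
    apply: ge0_le_integral => //.
    + by move=> x _; rewrite lee_fin exprn_even_ge0.
    + exact: (measurable_funeM _ (emeasurable_funD (me 1) (me (-1)))).
    + by move=> x _; rewrite -EFinD -EFinM lee_fin; exact: fourth_power_le_expR.
  have e0 (s x : R) : (0 <= (expR (s * x))%:E)%E by rewrite lee_fin expR_ge0.
  rewrite ge0_integralZl//; last 2 first.
  + exact: emeasurable_funD.
  + by move=> x _; rewrite adde_ge0.
  rewrite ge0_integralD//.
  apply: (@le_trans _ _ (24%:E * (2%:E + 2%:E))%E).
    apply: lee_wpmul2l; first by rewrite lee_fin.
    by apply: leeD; apply: le2; rewrite ?sqrrN expr1n.
  by rewrite -EFinD -EFinM lee_fin; lra.
- pose I : set R := [set` `[- Num.sqrt 3, Num.sqrt 3]].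
  have mI : measurable I by exact: measurable_itv.
  apply: (bounded (~` (V @^-1` I))).
  + by apply: measurableC; exact: mpre.
  + rewrite [LHS]probability_setC; last exact: mpre.
    have -> : P (V @^-1` I) = 1%E.
      rewrite -[LHS]/(distribution P V I) unif// /uniform_prob.
      by rewrite integral_uniform_pdf1//; exact: oppsqrt3_lt.
    by rewrite subee.
  move=> w /contrapT; rewrite /I /= in_itv/= -ler_norml => h.
  have -> : V w ^+ 4 = (`|V w| ^+ 2) ^+ 2.
    by rewrite real_normK ?num_real// -exprM.
  have -> : 9 = (Num.sqrt 3 ^+ 2) ^+ 2 :> R by rewrite sqr_sqrtr//; ring.
  by rewrite !lerXn2r// ?nnegrE ?exprn_ge0 ?sqrtr_ge0.
Qed.

End FourthMomentOfVariables.

(** * Hypercontractivity with controlled constants under each hypothesis *)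

Section Hypotheses.
Context {d : measure_display} {T : measurableType d} {R : realType}.
Variable P : probability T R.
Context {n : nat} {m : 'I_n -> nat}.
Implicit Types (X Y : rv_families P m) (s t : multi_index m).

Definition plain X : @families d T R n m := fun i j => X i j : T -> R.
Arguments plain : clear implicits.

Lemma ensemble_seq_independent X : ensemble_seq X ->
  independent_ensembles P (plain X).
Proof.
move=> [onX indX]; have sX i j l : Rintegrable P (fun w => plain X i j w * plain X i l w).
  have [_ X2 _] := onX i.
  by have := Lfun2_mul_Lfun1 (X2 j) (X2 l) => /Lfun1_integrable.
split.
- by move=> i j; exact: (@measurable_funPT _ _ _ _ (X i j)).
- by move=> i w; have [X1 _ _] := onX i; exact: X1.
- exact: sX.
- move=> i j l; have [_ _ h] := onX i; apply: EFin_inj.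
  by rewrite -(expectation_mean (sX i j l)); exact: h.
- exact: indX.
Qed.

(** Noise operators compose, and the one of parameter [rho = eta' / eta <= 1] does not increase the
    norm. *)
Lemma cube_hypercontractive_le eta eta' (Z : @families d T R n m) :
  0 <= eta' <= eta -> 0 < eta ->
  cube_hypercontractive P eta Z -> cube_hypercontractive P eta' Z.
Proof.
move=> /andP[eta'0 ee'] eta0 hZ Q.
pose rho := eta' / eta.
have rho0 : 0 <= rho by rewrite divr_ge0// ltW.
have rho1 : rho <= 1 by rewrite ler_pdivrMr// mul1r.
have E w : eval (noise_op eta (noise_op rho Q)) (at_point Z w)
         = eval (noise_op eta' Q) (at_point Z w).
  apply: eval_ext => s; rewrite /noise_op mulrA -exprMn /rho mulrCA divff ?mulr1//.
  by rewrite gt_eqF.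
have E3 w : `|eval (noise_op eta (noise_op rho Q)) (at_point Z w)| ^+ 3
         = `|eval (noise_op eta' Q) (at_point Z w)| ^+ 3 by rewrite E.
have [s3 m3] := hZ (noise_op rho Q).
split; first exact: (Rintegrable_ext E3 s3).
rewrite -(mean_ext P E3); apply: (le_trans m3).
rewrite lerXn2r ?nnegrE ?sqrtr_ge0//; apply: ler_wsqrtr.
apply: ler_sum => s _; rewrite /noise_op exprMn.
by rewrite ler_piMl ?sqr_ge0// exprn_ile1 ?exprn_ge0// exprn_ile1.
Qed.

(** Hypercontractivity is tested on [1 + x_t / 2]. The left side is at least
    [1 + (3/4) eta^2 - 1/8], where [1/8] comes from the test on [x_t] alone, and the right side is
    [(5/4)^(3/2) <= 45/32]; so [eta] stays away from 1. *)
Lemma cube_hypercontractive_bound eta (Z : @families d T R n m) t :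
  independent_ensembles P Z -> msupp_size t = 1%N -> 0 <= eta ->
  cube_hypercontractive P eta Z -> eta <= 9 / 10.
Proof.
move=> iZ t1 eta0 hZ.
have Z1 w i : (at_point Z w : values R m) i ord0 = 1 by exact: ie_one iZ i w.
have t0 : t != multi_index0 by rewrite -msupp_size_gt0 t1.
pose e s : mlpoly R m := fun s' => (s' == s)%:R.
have noiseE rho s w : eval (noise_op rho (e s)) (at_point Z w)
    = rho ^+ msupp_size s * monomial (at_point Z w) s.
  rewrite /eval (bigD1 s)//= big1 ?addr0; first by rewrite /noise_op /e eqxx mulr1.
  by move=> s' /negPf s's; rewrite /noise_op /e s's mulr0 mul0r.
pose u w := eta * monomial (at_point Z w) t.
pose Q : mlpoly R m := fun s => e multi_index0 s + 2^-1 * e t s.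
have QE w : eval (noise_op eta Q) (at_point Z w) = 1 + 2^-1 * u w.
  rewrite (eval_ext (Q' := fun s => noise_op eta (e multi_index0) s
      + 2^-1 * noise_op eta (e t) s)).
    rewrite eval_add (eval_scale _ (noise_op eta (e t))) !noiseE msupp_size0 t1.
    by rewrite expr0 expr1 mul1r monomial0.
  by move=> s; rewrite /noise_op /Q mulrDr mulrCA.
have Qn : sqnorm Q = 1 + 4^-1.
  rewrite /sqnorm (bigD1 multi_index0)//= (bigD1 t)//= big1 ?addr0; last first.
    by move=> s /andP[/negPf s0 /negPf st]; rewrite /Q /e s0 st mulr0 addr0 expr0n.
  rewrite /Q /e !eqxx eq_sym (negPf t0) mulr0 addr0 add0r expr1n mulr1.
  by field.
have etn : sqnorm (e t) = 1.
  rewrite /sqnorm (bigD1 t)//= big1 ?addr0 /e ?eqxx ?expr1n// => s /negPf ->.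
  by rewrite expr0n.
have [su3 mu3] := hZ (e t); rewrite etn sqrtr1 expr1n in mu3.
have uE w : `|eval (noise_op eta (e t)) (at_point Z w)| ^+ 3 = `|u w| ^+ 3.
  by rewrite noiseE t1 expr1.
have {}su3 : Rintegrable P (fun w => `|u w| ^+ 3) by exact: (Rintegrable_ext uE su3).
rewrite (mean_ext P uE) in mu3.
have [sm2 mm2] := monomialsM t t iZ; have [sm1 mm1] := monomialsM t multi_index0 iZ.
rewrite (negPf t0) eqxx in mm1 mm2.
have m1E w : eta * (monomial (at_point Z w) t * monomial (at_point Z w) multi_index0) = u w.
  by rewrite (monomial0 (Z1 w)) mulr1.
have su : Rintegrable P u by exact: (Rintegrable_ext m1E (RintegrableZ eta sm1)).
have mu0 : mean P u = 0 by rewrite -(mean_ext P m1E) (meanZ _ sm1) mm1 mulr0.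
have m2E w : eta ^+ 2 * (monomial (at_point Z w) t * monomial (at_point Z w) t) = u w ^+ 2.
  by rewrite /u exprMn expr2.
have su2 : Rintegrable P (fun w => u w ^+ 2) by exact: (Rintegrable_ext m2E (RintegrableZ _ sm2)).
have mu2 : mean P (fun w => u w ^+ 2) = eta ^+ 2.
  by rewrite -(mean_ext P m2E) (meanZ _ sm2) mm2 mulr1.
have [sQ mQ] := hZ Q.
pose low w := 1 + 3 / 2 * u w + 3 / 4 * u w ^+ 2 - 8^-1 * `|u w| ^+ 3.
have s1 := RintegrableZ (3 / 2) su; have s2 := RintegrableZ (3 / 4) su2.
have s3 := RintegrableZ 8^-1 su3; have s01 := RintegrableD (Rintegrable_cst P 1) s1.
have s012 := RintegrableD s01 s2; have slow : Rintegrable P low by exact: RintegrableB.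
have := le_mean slow sQ; rewrite /low.
have h w : low w <= `|eval (noise_op eta Q) (at_point Z w)| ^+ 3.
  rewrite QE; apply: le_trans (cube_norm_add1 _).
  rewrite normrM exprMn ger0_norm// /low.
  rewrite le_eqVlt; apply/orP; left; apply/eqP; by field.
move=> /(_ h)/le_trans/(_ mQ).
rewrite (meanB s012 s3) (meanD s01 s2) (meanD (Rintegrable_cst P 1) s1) mean_cst.
rewrite (meanZ _ su) (meanZ _ su2) (meanZ _ su3) mu0 mu2 Qn.
set S := Num.sqrt _.
have S2 : S ^+ 2 = 5 / 4 by rewrite sqr_sqrtr; [field|rewrite addr_ge0// invr_ge0].
have S0 : 0 <= S by exact: sqrtr_ge0.
have S112 : S <= 9 / 8.
  by rewrite -(ler_pXn2r (n := 2)) ?nnegrE ?S2//; lra.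
have S3 : S ^+ 3 <= 5 / 4 * (9 / 8) by rewrite exprSr S2; apply: ler_wpM2l => //; lra.
move=> hh; have e2 : eta ^+ 2 <= (9 / 10) ^+ 2 by lra.
by rewrite -(ler_pXn2r (n := 2)) ?nnegrE//; lra.
Qed.

Lemma expR_ln_inv (a : R) : 0 < a -> expR (ln a^-1) = a^-1.
Proof. by move=> a0; rewrite lnK// posrE invr_gt0. Qed.

Lemma ln_inv_ge (a : R) : 0 < a -> 1 - a <= ln a^-1.
Proof.
move=> a0; rewrite lnV ?posrE// lerNr opprB.
have -> : a = 1 + (a - 1) by ring.
by rewrite [leRHS]addrC addKr; apply: le_ln1Dx; lra.
Qed.

Lemma monomial_nonconstant_at X k t w : ensemble_seq X -> nonconstant_at k t ->
  monomial (at_point (plain X) w) t = X k (t k) w.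
Proof.
move=> [onX _] /andP[/supported_onP ht _].
rewrite /monomial (bigD1 k)//= big1 ?mulr1// => i ik.
by rewrite (ht i)//=; have [X1 _ _] := onX i; exact: X1.
Qed.

(** There is a single nonconstant variable per ensemble, so the squared [ensemble_sqnorm] is its
    fourth power and [M = 96] works. The value [1/8] satisfies the conditions of the fourth moment
    induction: [8 / 64 <= 2] and [3 * 96 / 8^4 <= 1]. *)
Lemma H4_cube_hypercontractive X : ensemble_seq X ->
  (forall i, m i = 1%N) ->
  (forall i (j : 'I_(m i).+1), j != ord0 -> H4_variable (X i j)) ->
  cube_hypercontractive P (8^-1) (plain X).
Proof.
move=> eX m1 hX; have iX := ensemble_seq_independent eX.
have H k : Rintegrable P (fun w => ensemble_sqnorm (plain X) k w ^+ 2) /\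
           mean P (fun w => ensemble_sqnorm (plain X) k w ^+ 2) <= 96.
  have [t /= ht|none] := pickP (@nonconstant_at n m k); last first.
    have E : (fun=> 0) =1 (fun w => ensemble_sqnorm (plain X) k w ^+ 2).
      by move=> w; rewrite /ensemble_sqnorm big_pred0 ?expr0n.
    split; first exact: (Rintegrable_ext E (Rintegrable_cst P 0)).
    by rewrite -(mean_ext P E) mean_cst.
  have uniq t' : nonconstant_at k t' = (t' == t).
    apply/idP/eqP => [ht'|->//]; apply/ffunP => i.
    move: (ht) (ht') => /andP[st t0] /andP[st' t'0].
    have [->|ik] := eqVneq i k; last first.
      by move/supported_onP: st => ->//; move/supported_onP: st' => ->.
    rewrite -(pred1_supported_neq0 st) in t0; rewrite -(pred1_supported_neq0 st') in t'0.
    have one (j : 'I_(m k).+1) : j != ord0 -> val j = 1%N.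
      by rewrite -val_eqE /=; have := ltn_ord j; rewrite {2}m1; case: (val j) => [|[]].
    by apply: val_inj; rewrite /= (one _ t0) (one _ t'0).
  have tk : t k != ord0 by case/andP: (ht) => st; rewrite -(pred1_supported_neq0 st).
  have E w : X k (t k) w ^+ 4 = ensemble_sqnorm (plain X) k w ^+ 2.
    rewrite /ensemble_sqnorm (eq_bigl _ _ uniq) big_pred1_eq.
    by rewrite (monomial_nonconstant_at _ eX ht) -exprM.
  have [s4 m4] := H4_variable_fourth (hX k (t k) tk).
  by split; [exact: (Rintegrable_ext E s4)|rewrite -(mean_ext P E)].
apply: (@bonami_cube _ _ _ _ _ _ _ iX 96) => [k|k|||].
- by have [] := H k.
- by have [] := H k.
- by rewrite invr_ge0.
- by rewrite expr2; lra.
- by rewrite !exprS expr0; lra.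
Qed.

Lemma finite_null_set (Om : fin_prob_space R) (W : T -> Om) :
  (forall a : Om, measurable (W @^-1` [set a]) /\ P (W @^-1` [set a]) = (mass a)%:E) ->
  measurable [set w | mass (W w) = 0] /\ P [set w | mass (W w) = 0] = 0%E.
Proof.
move=> hW.
have -> : [set w | mass (W w) = 0] = \big[setU/set0]_(a | mass a == 0) (W @^-1` [set a]).
  apply/seteqP; split=> [w /= /eqP w0|w].
    by rewrite (bigD1 (W w))//=; left.
  elim/big_ind: _ => //= [A B hA hB [/hA//|/hB//]|a /eqP a0 ->//].
elim/big_ind: _ => [|A B [mA A0] [mB B0]|a /eqP a0].
- by split; [exact: measurable0|exact: measure0].
- split; first exact: measurableU.
  by rewrite [LHS]measureU0// A0.
- by have [mWa ->] := hW a; rewrite a0.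
Qed.

(** Off a null set, the sum of the squares of the basis functions at an atom is at most [1 / alpha],
    by the reproducing kernel of their span. Thus [M = alpha^-2], and [alpha / 2] makes [3 M eta^4]
    equal to [(3/16) alpha^2]. *)
Lemma H3_cube_hypercontractive X (Om : 'I_n -> fin_prob_space R) alpha :
  ensemble_seq X -> (forall i, basis_of_functions (Om i) (X i)) ->
  (forall i (a : Om i), mass a != 0 -> alpha <= mass a) ->
  0 < alpha <= 1 -> cube_hypercontractive P (alpha / 2) (plain X).
Proof.
move=> eX bX hal /andP[al0 al1]; have iX := ensemble_seq_independent eX.
have mX := ie_measurable iX.
have H k : Rintegrable P (fun w => ensemble_sqnorm (plain X) k w ^+ 2) /\
           mean P (fun w => ensemble_sqnorm (plain X) k w ^+ 2) <= alpha^-1 ^+ 2.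
  have [W [f [hW hf _]]] := bX k.
  have [mN PN] := finite_null_set hW.
  apply: Rintegrable_ae_bounded mN PN _.
    apply: measurable_funX; apply: measurable_sum_cond => t _.
    by apply: measurable_funX; exact: measurable_monomial.
  move=> w0 /= /eqP w00; rewrite sqr_ge0/=.
  set C := ensemble_sqnorm (plain X) k w0.
  have C0 : 0 <= C by apply: sumr_ge0 => t _; exact: sqr_ge0.
  have monE t w : nonconstant_at k t ->
      monomial (at_point (plain X) w) t = f (t k) (W w).
    by move=> ht; rewrite (monomial_nonconstant_at _ eX ht) hf.
  (* The reproducing kernel at the atom of [w0]: its squared norm and its value on that atom are
     both [C], so [C^2] times the mass of the atom is at most [C]. *)
  pose Q : mlpoly R m := fun t =>
    if nonconstant_at k t then monomial (at_point (plain X) w0) t else 0.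
  have Qn : sqnorm Q = C.
    rewrite /C /ensemble_sqnorm /sqnorm [RHS]big_mkcond/=; apply: eq_bigr => t _.
    by rewrite /Q; case: ifP => // _; rewrite expr0n.
  have QE w : W w = W w0 -> eval Q (at_point (plain X) w) = C.
    move=> ww; rewrite /C /ensemble_sqnorm /eval [RHS]big_mkcond/=.
    apply: eq_bigr => t _; rewrite /Q; case: ifPn => ht; last by rewrite mul0r.
    by rewrite (monE _ w) // ww -(monE _ w0)// expr2.
  have [mA PA] := hW (W w0); set A := W @^-1` [set W w0] in mA PA.
  have key : C ^+ 2 * mass (W w0) <= C.
    rewrite -{2}Qn -(mean_eval_sqr Q iX) -lee_fin -(meanE (Rintegrable_eval_sqr Q iX)).
    rewrite EFinM -PA -integral_cst//.
    apply: (@le_trans _ _ (\int[P]_(w in A) (eval Q (at_point (plain X) w) ^+ 2)%:E)%E).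
      rewrite le_eqVlt; apply/orP; left; apply/eqP; apply: eq_integral => w.
      by rewrite inE => /= ww; rewrite QE.
    apply: ge0_subset_integral => //.
      apply/measurable_EFinP; apply: measurable_funX.
      exact: (measurable_eval _ (ie_measurable iX)).
    by move=> w _; rewrite lee_fin sqr_ge0.
  have Cal : C * alpha <= 1.
    have [->|Cn0] := eqVneq C 0; first by rewrite mul0r ler01.
    have Cgt : 0 < C by rewrite lt_neqAle eq_sym Cn0.
    rewrite -(ler_pM2l Cgt) mulr1 mulrA -expr2; apply: le_trans key.
    by apply: ler_wpM2l; [exact: sqr_ge0|exact: hal].
  apply: lerXn2r; rewrite ?nnegrE ?invr_ge0 ?(ltW al0)//.
  by rewrite -[alpha^-1]mul1r ler_pdivlMr.
have a2 : alpha ^+ 2 <= 1 by rewrite exprn_ile1 // ltW.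
apply: (@bonami_cube _ _ _ _ _ _ _ iX (alpha^-1 ^+ 2)) => [k|k|||].
- by have [] := H k.
- by have [] := H k.
- by rewrite divr_ge0// ltW.
- by rewrite exprMn; lra.
- have -> : 3 * alpha^-1 ^+ 2 * (alpha / 2) ^+ 4 = 3 / 16 * alpha ^+ 2.
    by field; rewrite gt_eqF.
  lra.
Qed.

End Hypotheses.
Arguments plain {d T R P n m} X i j w.

Section HypothesesH134.
Context {d : measure_display} {T : measurableType d} {R : realType}.
Variable P : probability T R.
Context {n : nat} {m : 'I_n -> nat}.
Implicit Types X Y : rv_families P m.

Lemma exists_msupp_size1 (i : 'I_n) : m i != 0%N ->
  exists t : multi_index m, msupp_size t = 1%N.
Proof.
move=> mi; pose t : multi_index m := [ffun l => if l == i then ord_max else ord0].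
have st : supported_on (pred1 i) t.
  by apply/supported_onP => l /= /negPf li; rewrite ffunE li.
exists t; rewrite (msupp_size_pred1 st) -(pred1_supported_neq0 st) ffunE eqxx.
by rewrite -val_eqE /= mi.
Qed.

(** The only way in which the three hypotheses enter the sequel. The factor 7 is set by H4, where
    [8 <= 1 + 7 <= expR 7]; H1 has [eta^-1 = expR K], and H3 has
    [2 / alpha <= alpha^-2 = expR (2 K)]. The first alternative is split off because then, under H1,
    nothing bounds [K] from below. *)
Lemma hypothesis_H134_cube (r : nat) X Y (K : R) :
  ensemble_seq X -> ensemble_seq Y -> hypothesis_H134 r X Y K ->
  (forall i, m i = 0%N) \/
  exists eta, [/\ 0 < eta <= 1, eta^-1 <= expR (7 * K), 10^-1 <= K,
    cube_hypercontractive P eta (plain X) & cube_hypercontractive P eta (plain Y)].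
Proof.
move=> eX eY [eta]; have iX := ensemble_seq_independent eX.
have iY := ensemble_seq_independent eY.
case=> [[[r3 _ hX hY _] ->]|[alpha [[_ [Om [bX [i [a [a0 aal]]] hal]] al2 etaE hY] ->]]|
        [[_ _ m1 hXY] ->]].
- have [/forallP m0|] := boolP [forall i, m i == 0%N].
    by left=> i; apply/eqP; exact: m0.
  rewrite negb_forall => /existsP[i mi]; right; exists eta.
  have [t t1] := exists_msupp_size1 mi.
  have cX := hypercontractive_cube r3 iX hX; have cY := hypercontractive_cube r3 iY hY.
  have [_ _ /andP[eta0 eta1] _] := hX.
  have eta9 := cube_hypercontractive_bound iX t1 (ltW eta0) cX.
  have K0 := ln_inv_ge eta0.
  split=> //; [by rewrite eta0 ltW| |lra].
  by rewrite -[leLHS](expR_ln_inv eta0) ler_expR; lra.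
- right; exists (alpha / 2).
  have al0 : 0 < alpha.
    by rewrite lt_neqAle -aal mass_ge0 eq_sym a0.
  have al1 : alpha <= 1 by lra.
  have K0 := ln_inv_ge al0.
  split.
  + by rewrite divr_gt0//=; lra.
  + have inv2 : 2 <= alpha^-1 by rewrite -[alpha^-1]mul1r ler_pdivlMr//; lra.
    apply: (@le_trans _ _ (expR (2 * ln alpha^-1))); last by rewrite ler_expR; lra.
    rewrite [in leRHS]mulrC expRM_natr expR_ln_inv// invfM invrK mulrC expr2.
    by apply: ler_wpM2r => //; rewrite invr_ge0 ltW.
  + lra.
  + by apply: H3_cube_hypercontractive hal _ => //; rewrite al0.
  (* [Y] is hypercontractive with the larger constant [alpha^(1/6) / 2], hence also with
     [alpha / 2], the one available for [X]. *)
  + have al6 : alpha <= alpha `^ 6^-1.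
      by apply: ger1_powR; [rewrite al0|rewrite invf_le1// ler1n].
    have eta0 : 0 < eta by rewrite etaE mulr_gt0 ?invr_gt0// powR_gt0.
    apply: (@cube_hypercontractive_le _ _ _ _ _ _ eta) => //.
      rewrite divr_ge0 ?(ltW al0)//= etaE [leLHS]mulrC.
      by apply: ler_wpM2l => //; rewrite invr_ge0.
    exact: (@hypercontractive_cube _ _ _ _ _ _ 3 _ _ _ iY).
- right; exists 8^-1; split.
  + by rewrite invr_gt0 ltr0n /= invf_le1 ?ler1n// ltr0n.
  + rewrite invrK mulr1.
    by apply: le_trans (expR_ge1Dx _); lra.
  + by rewrite invf_le1 ?ler1n// ltr0n.
  + by apply: H4_cube_hypercontractive eX m1 _ => i j /hXY [].
  + by apply: H4_cube_hypercontractive eY m1 _ => i j /hXY [].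
Qed.

End HypothesesH134.

(** * Levy distance and zeta *)

Section LevyDistance.
Context {d : measure_display} {T : measurableType d} {R : realType}.
Variable P : probability T R.
Implicit Types (U V f g : T -> R) (A : set T).

Lemma probability_fineK A : measurable A -> P A = (fine (P A))%:E.
Proof. by move=> mA; rewrite fineK// fin_num_measure. Qed.

Lemma mean_indic A : measurable A ->
  Rintegrable P (\1_A : T -> R) /\ mean P (\1_A : T -> R) = fine (P A).
Proof.
move=> mA; split.
  apply/integrableP; split; first by apply/measurable_EFinP; exact: measurable_indic.
  under eq_integral do rewrite /= ger0_norm//.
  rewrite integral_indic// setIT.
  exact: (le_lt_trans (probability_le1 P mA) (ltry 1)).
by rewrite /mean /Rintegral integral_indic// setIT.
Qed.

Lemma probability_le_mean A f : measurable A -> Rintegrable P f ->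
  (forall w, 0 <= f w) -> (forall w, A w -> 1 <= f w) -> fine (P A) <= mean P f.
Proof.
move=> mA sf f0 f1; have [sA <-] := mean_indic mA.
apply: le_mean => // w; rewrite indicE.
by case: (boolP (w \in A)) => [/set_mem/f1|].
Qed.

Lemma mean_le_probability A f : measurable A -> Rintegrable P f ->
  (forall w, f w <= 1) -> (forall w, ~ A w -> f w <= 0) -> mean P f <= fine (P A).
Proof.
move=> mA sf f1 f0; have [sA <-] := mean_indic mA.
apply: le_mean => // w; rewrite indicE.
by case: (boolP (w \in A)) => [_|/negP h]; [exact: f1|apply: f0 => /mem_set].
Qed.

Lemma measurable_le_set f (t : R) : measurable_fun setT f ->
  measurable [set w | f w <= t].
Proof.
move=> mf; have := mf measurableT _ (@measurable_itv R `]-oo, t]).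
by rewrite setTI; congr measurable; apply/seteqP; split=> w /=; rewrite in_itv.
Qed.

(** The upper inequality at [t] is the lower one with [U] and [V] exchanged, taken at [t + l]; the
    bounds below therefore need to treat only one side. *)
Lemma levy_dist_le U V (l : R) : measurable_fun setT U -> measurable_fun setT V ->
  0 < l ->
  (forall t, fine (P [set w | V w <= t - l]) - l <= fine (P [set w | U w <= t])) ->
  (forall t, fine (P [set w | U w <= t - l]) - l <= fine (P [set w | V w <= t])) ->
  levy_dist P U V <= l.
Proof.
move=> mU mV l0 hV hU; apply: ge_inf; first by exists 0 => x [/ltW].
split=> // t; split.
  rewrite (probability_fineK (measurable_le_set _ mV)).
  by rewrite (probability_fineK (measurable_le_set _ mU)) -EFinB lee_fin; exact: hV.
rewrite (probability_fineK (measurable_le_set _ mV)).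
rewrite (probability_fineK (measurable_le_set _ mU)) -EFinD lee_fin.
by have := hU (t + l); rewrite addrK lerBlDr.
Qed.

(* Cantelli's inequality at 9/20: there, [1 <= (f + 2)^2 / 6], and the mean of
   the right-hand side is at most 5/6. *)
Lemma one_sided_chebyshev A f : measurable A -> measurable_fun setT f ->
  Rintegrable P (fun w => f w ^+ 2) -> mean P f = 0 -> mean P (fun w => f w ^+ 2) <= 1 ->
  (forall w, A w -> 9 / 20 <= f w) -> fine (P A) <= 9 / 10.
Proof.
move=> mA mf sf2 f0 f2 hA; have sf := Rintegrable_of_sqr mf sf2.
have s4 := RintegrableZ (4 / 6) sf; have s2 := RintegrableZ 6^-1 sf2.
have s24 := RintegrableD s2 s4; have sc := Rintegrable_cst P (4 / 6 : R).
have E w : 6^-1 * f w ^+ 2 + 4 / 6 * f w + 4 / 6 = (f w + 2) ^+ 2 / 6 by field.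
apply: le_trans (probability_le_mean mA (RintegrableD s24 sc) _ _) _ => [w|w /hA h|].
- by rewrite E divr_ge0// sqr_ge0.
- rewrite E ler_pdivlMr// mul1r.
  by have := sqr_ge0 (f w - 9 / 20); lra.
rewrite (meanD s24 sc) (meanD s2 s4) (meanZ _ sf) (meanZ _ sf2) f0 mean_cst; lra.
Qed.

(** The interval from [t - 9/10] to [t] has length [2 * 9/20], so one of its ends is at distance at
    least [9/20] from [mu] on its own side. Accordingly [V <= t - 9/10] or [U > t] has probability
    at most [9/10]. *)
Lemma levy_dist_le_nine_tenths U V mu : measurable_fun setT U -> measurable_fun setT V ->
  Rintegrable P (fun w => (U w - mu) ^+ 2) -> Rintegrable P (fun w => (V w - mu) ^+ 2) ->
  mean P (fun w => U w - mu) = 0 -> mean P (fun w => V w - mu) = 0 ->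
  mean P (fun w => (U w - mu) ^+ 2) <= 1 -> mean P (fun w => (V w - mu) ^+ 2) <= 1 ->
  levy_dist P U V <= 9 / 10.
Proof.
move=> mU mV sU sV U0 V0 U2 V2.
have half (F G : T -> R) : measurable_fun setT F -> measurable_fun setT G ->
  Rintegrable P (fun w => (F w - mu) ^+ 2) -> Rintegrable P (fun w => (G w - mu) ^+ 2) ->
  mean P (fun w => F w - mu) = 0 -> mean P (fun w => G w - mu) = 0 ->
  mean P (fun w => (F w - mu) ^+ 2) <= 1 -> mean P (fun w => (G w - mu) ^+ 2) <= 1 ->
  forall t, fine (P [set w | G w <= t - 9 / 10]) - 9 / 10 <= fine (P [set w | F w <= t]).
  move=> mF mG sF sG F0 G0 F2 G2 t.
  have mGt := measurable_le_set (t - 9 / 10) mG; have mFt := measurable_le_set t mF.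
  have pF : 0 <= fine (P [set w | F w <= t]) by apply: fine_ge0.
  have [tm|tm] := leP (t - mu) (9 / 20).
    suff : fine (P [set w | G w <= t - 9 / 10]) <= 9 / 10 by lra.
    have mG' : measurable_fun setT (fun w => mu - G w).
      by apply: measurable_funB => //; exact: measurable_cst.
    have E2 w : (G w - mu) ^+ 2 = (mu - G w) ^+ 2 by ring.
    have E1 w : -1 * (G w - mu) = mu - G w by ring.
    have mG1 : measurable_fun setT (fun w => G w - mu).
      by apply: measurable_funB => //; exact: measurable_cst.
    have sG1 : Rintegrable P (fun w => G w - mu) by exact: Rintegrable_of_sqr.
    apply: (one_sided_chebyshev mGt mG').
    - exact: (Rintegrable_ext E2 sG).
    - by rewrite -(mean_ext P E1) (meanZ _ sG1) G0 mulr0.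
    - by rewrite -(mean_ext P E2).
    - by move=> w /= h; lra.
  suff h : fine (P (~` [set w | F w <= t])) <= 9 / 10.
    have : fine (P (~` [set w | F w <= t])) = 1 - fine (P [set w | F w <= t]).
      by rewrite probability_setC// [P [set w | _]]probability_fineK.
    have : fine (P [set w | G w <= t - 9 / 10]) <= 1.
      by rewrite -lee_fin -probability_fineK//; exact: probability_le1.
    lra.
  have mF1 : measurable_fun setT (fun w => F w - mu).
    by apply: measurable_funB => //; exact: measurable_cst.
  apply: (one_sided_chebyshev (measurableC mFt) mF1 sF F0 F2) => w /= /negP.
  by rewrite -ltNge => h; lra.
by apply: levy_dist_le => //; exact: half.
Qed.

Lemma pospart_scale (x w : R) : 0 < w -> pospart (x / w) = pospart x / w.
Proof.
move=> w0; have [x0|x0] := leP 0 x.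
  by rewrite !pospart_id// divr_ge0// ltW.
by rewrite !pospart_eq0 ?mul0r// ?ltW// pmulr_llt0// invr_gt0.
Qed.

Lemma smooth_step_scale (x t w : R) : 0 < w -> smooth_step ((x - t) / w) =
  (6 * w ^+ 3)^-1 * (pospart (x - t) ^+ 3 - 3 * pospart (x - (t + w)) ^+ 3
    + 3 * pospart (x - (t + 2 * w)) ^+ 3 - pospart (x - (t + 3 * w)) ^+ 3).
Proof.
move=> w0; have wn : w != 0 by rewrite gt_eqF.
have E c : (x - t) / w - c = (x - (t + c * w)) / w by field.
rewrite /smooth_step !E mul1r !pospart_scale// !expr_div_n.
by field.
Qed.

Definition cube_close (E : R) U V : Prop := forall k,
  [/\ Rintegrable P (fun w => pospart (U w - k) ^+ 3),
      Rintegrable P (fun w => pospart (V w - k) ^+ 3)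
    & `|mean P (fun w => pospart (U w - k) ^+ 3)
        - mean P (fun w => pospart (V w - k) ^+ 3)| <= E].

Lemma cube_close_sym E U V : cube_close E U V -> cube_close E V U.
Proof. by move=> h k; have [? ? ?] := h k; split=> //; rewrite distrC. Qed.

(** The step combines four cubes with coefficients 1, 3, 3, 1 up to sign, over [6 w^3]: the error is
    [8 E / (6 w^3)]. *)
Lemma cube_close_step E U V t w : cube_close E U V -> 0 < w ->
  [/\ Rintegrable P (fun x => smooth_step ((U x - t) / w)),
      Rintegrable P (fun x => smooth_step ((V x - t) / w))
    & mean P (fun x => smooth_step ((U x - t) / w))
        <= mean P (fun x => smooth_step ((V x - t) / w)) + 4 / 3 / w ^+ 3 * E].
Proof.
move=> hE w0; have wn : w != 0 by rewrite gt_eqF.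
have [U0 V0 E0] := hE t; have [U1 V1 E1] := hE (t + w).
have [U2 V2 E2] := hE (t + 2 * w); have [U3 V3 E3] := hE (t + 3 * w).
have comb (F : T -> R) : Rintegrable P (fun x => pospart (F x - t) ^+ 3) ->
   Rintegrable P (fun x => pospart (F x - (t + w)) ^+ 3) ->
   Rintegrable P (fun x => pospart (F x - (t + 2 * w)) ^+ 3) ->
   Rintegrable P (fun x => pospart (F x - (t + 3 * w)) ^+ 3) ->
   Rintegrable P (fun x => smooth_step ((F x - t) / w)) /\
   mean P (fun x => smooth_step ((F x - t) / w)) = (6 * w ^+ 3)^-1 *
    (mean P (fun x => pospart (F x - t) ^+ 3)
     - 3 * mean P (fun x => pospart (F x - (t + w)) ^+ 3)
     + 3 * mean P (fun x => pospart (F x - (t + 2 * w)) ^+ 3)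
     - mean P (fun x => pospart (F x - (t + 3 * w)) ^+ 3)).
  move=> F0 F1 F2 F3; have F1' := RintegrableZ 3 F1; have F2' := RintegrableZ 3 F2.
  have F01 := RintegrableB F0 F1'; have F012 := RintegrableD F01 F2'.
  have F0123 := RintegrableB F012 F3.
  have FE x := esym (smooth_step_scale (F x) t w0).
  split; first exact: (Rintegrable_ext FE (RintegrableZ _ F0123)).
  rewrite -(mean_ext P FE) (meanZ _ F0123) (meanB F012 F3) (meanD F01 F2').
  by rewrite (meanB F0 F1') (meanZ _ F1) (meanZ _ F2).
have [sU ->] := comb _ U0 U1 U2 U3; have [sV ->] := comb _ V0 V1 V2 V3.
split=> //.
have c0 : 0 < (6 * w ^+ 3)^-1 by rewrite invr_gt0 mulr_gt0// exprn_gt0.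
have -> : 4 / 3 / w ^+ 3 * E = (6 * w ^+ 3)^-1 * (8 * E) by field.
rewrite -mulrDr; apply: ler_wpM2l; first exact: ltW.
move: E0 E1 E2 E3; rewrite !ler_norml => /andP[? ?] /andP[? ?] /andP[? ?] /andP[? ?].
lra.
Qed.

(** Of the shift [5 w], the smooth step takes [3 w], rising between [t - 4 w] and [t - w], and each
    end keeps a margin [w] for the passage from [V] to [V'] or from [U] to [U']. By Chebyshev each
    margin costs [delta / w^2]. *)
Lemma levy_half E delta w U V U' V' : 0 < w -> cube_close E U' V' ->
  measurable_fun setT U -> measurable_fun setT V ->
  Rintegrable P (fun x => (U x - U' x) ^+ 2) -> Rintegrable P (fun x => (V x - V' x) ^+ 2) ->
  mean P (fun x => (U x - U' x) ^+ 2) <= delta ->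
  mean P (fun x => (V x - V' x) ^+ 2) <= delta ->
  2 * delta / w ^+ 2 + 4 / 3 / w ^+ 3 * E <= 5 * w ->
  forall t, fine (P [set x | V x <= t - 5 * w]) - 5 * w <= fine (P [set x | U x <= t]).
Proof.
move=> w0 hE mU mV sU sV dU dV hw t.
have [sSU sSV SUV] := cube_close_step (t - 4 * w) hE w0.
have w2 : 0 < w ^+ 2 by exact: exprn_gt0.
have s1 := Rintegrable_cst P (1 : R).
have sU2 := RintegrableZ (w ^+ 2)^-1 sU; have sV2 := RintegrableZ (w ^+ 2)^-1 sV.
have sV1 := RintegrableB s1 sSV; have sU1 := RintegrableB s1 sSU.
have hV : fine (P [set x | V x <= t - 5 * w]) <=
    1 - mean P (fun x => smooth_step ((V' x - (t - 4 * w)) / w))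
    + (w ^+ 2)^-1 * mean P (fun x => (V x - V' x) ^+ 2).
  have := meanD sV1 sV2; rewrite (meanB s1 sSV) (meanZ _ sV) mean_cst => <-.
  apply: probability_le_mean (measurable_le_set _ mV) (RintegrableD sV1 sV2) _ _ => x.
    have /andP[_ h1] := smooth_step_itv ((V' x - (t - 4 * w)) / w).
    by rewrite addr_ge0 ?subr_ge0// mulr_ge0 ?invr_ge0 ?sqr_ge0// ltW.
  move=> /= Vx; have [V'x|V'x] := leP (V' x) (t - 4 * w).
    have h0 : (V' x - (t - 4 * w)) / w <= 0 by rewrite ler_pdivrMr// mul0r subr_le0.
    by rewrite (smooth_step0 h0) subr0 lerDl mulr_ge0 ?invr_ge0 ?sqr_ge0// ltW.
  have /andP[_ h1] := smooth_step_itv ((V' x - (t - 4 * w)) / w).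
  have : 1 <= (w ^+ 2)^-1 * (V x - V' x) ^+ 2.
    rewrite mulrC ler_pdivlMr// mul1r.
    have -> : (V x - V' x) ^+ 2 = (V' x - V x) ^+ 2 by ring.
    by rewrite lerXn2r// ?nnegrE; lra.
  lra.
have hU : 1 - mean P (fun x => smooth_step ((U' x - (t - 4 * w)) / w))
    - (w ^+ 2)^-1 * mean P (fun x => (U x - U' x) ^+ 2) <= fine (P [set x | U x <= t]).
  have := meanB sU1 sU2; rewrite (meanB s1 sSU) (meanZ _ sU) mean_cst => <-.
  apply: mean_le_probability (measurable_le_set _ mU) (RintegrableB sU1 sU2) _ _ => x.
    have /andP[h0 _] := smooth_step_itv ((U' x - (t - 4 * w)) / w).
    have : 0 <= (w ^+ 2)^-1 * (U x - U' x) ^+ 2.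
      by rewrite mulr_ge0 ?invr_ge0 ?sqr_ge0// ltW.
    lra.
  move=> /= /negP; rewrite -ltNge => Ux.
  have [U'x|U'x] := leP (t - w) (U' x).
    have h3 : 3 <= (U' x - (t - 4 * w)) / w by rewrite ler_pdivlMr//; lra.
    by rewrite (smooth_step1 h3) subrr sub0r oppr_le0 mulr_ge0 ?invr_ge0 ?sqr_ge0// ltW.
  have /andP[h0 _] := smooth_step_itv ((U' x - (t - 4 * w)) / w).
  have : 1 <= (w ^+ 2)^-1 * (U x - U' x) ^+ 2.
    rewrite mulrC ler_pdivlMr// mul1r.
    by rewrite lerXn2r// ?nnegrE; lra.
  lra.
have dU' : (w ^+ 2)^-1 * mean P (fun x => (U x - U' x) ^+ 2) <= delta / w ^+ 2.
  by rewrite mulrC ler_pM2r ?invr_gt0.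
have dV' : (w ^+ 2)^-1 * mean P (fun x => (V x - V' x) ^+ 2) <= delta / w ^+ 2.
  by rewrite mulrC ler_pM2r ?invr_gt0.
move: hw; rewrite -mulrA; lra.
Qed.

End LevyDistance.

(** * Comparing the means of [zeta] through its Lipschitz part [huberp] *)

Section ZetaEstimates.
Context {d : measure_display} {T : measurableType d} {R : realType}.
Variable P : probability T R.
Implicit Types (U V f g : T -> R).

Lemma measurable_huberp : measurable_fun setT (@huberp R).
Proof.
apply: measurable_funB; apply: measurable_funX; first exact: measurable_pospart.
apply: (measurableT_comp measurable_pospart).
by apply: measurable_funB => //; exact: measurable_cst.
Qed.

Lemma Rintegrable_huberp U : Rintegrable P U -> Rintegrable P (fun w => huberp (U w)).
Proof.
move=> sU; apply: (Rintegrable_dominated _ (RintegrableZ 2 (Rintegrable_norm sU))) => [|w].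
  exact: measurableT_comp measurable_huberp (Rintegrable_measurable sU).
have := huberp_lip (U w) 0; rewrite subr0.
by have [[_ ->]|[[]]|[]] := huberp_cases (0 : R); rewrite ?subr0 ?lexx ?ler10// => _ ->;
  rewrite expr0n subr0.
Qed.

Lemma mean_zeta U : Rintegrable P U -> Rintegrable P (fun w => U w ^+ 2) ->
  Rintegrable P (fun w => zeta (U w)) /\
  mean P (fun w => zeta (U w)) =
    mean P (fun w => U w ^+ 2) - mean P (fun w => huberp (U w)).
Proof.
move=> sU sU2; have sh := Rintegrable_huberp sU.
have E w : U w ^+ 2 - huberp (U w) = zeta (U w) by rewrite zetaE.
split; first exact: (Rintegrable_ext E (RintegrableB sU2 sh)).
by rewrite -(mean_ext P E) (meanB sU2 sh).
Qed.

Lemma mean_norm_le f (delta : R) : 0 < delta -> measurable_fun setT f ->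
  Rintegrable P (fun w => f w ^+ 2) -> mean P (fun w => f w ^+ 2) <= delta ^+ 2 ->
  mean P (fun w => `|f w|) <= delta.
Proof.
move=> d0 mf sf2 f2; have sf := Rintegrable_norm (Rintegrable_of_sqr mf sf2).
have s1 := RintegrableZ (2 * delta)^-1 sf2; have s2 := Rintegrable_cst P (delta / 2).
apply: le_trans (le_mean sf (RintegrableD s1 s2) _) _ => [w|].
  have -> : (2 * delta)^-1 * f w ^+ 2 + delta / 2
     = (`|f w| ^+ 2 + delta ^+ 2) / (2 * delta).
    by rewrite real_normK ?num_real//; field; rewrite gt_eqF.
  rewrite ler_pdivlMr; last by rewrite mulr_gt0.
  by have := sqr_ge0 (`|f w| - delta); lra.
rewrite (meanD s1 s2) (meanZ _ sf2) mean_cst.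
have : (2 * delta)^-1 * mean P (fun w => f w ^+ 2) <= (2 * delta)^-1 * delta ^+ 2.
  by apply: ler_wpM2l => //; rewrite invr_ge0 mulr_ge0// ltW.
have -> : (2 * delta)^-1 * delta ^+ 2 = delta / 2 by field; rewrite gt_eqF.
lra.
Qed.

Lemma mean_huberp_le U V (delta : R) : 0 < delta -> Rintegrable P U -> Rintegrable P V ->
  Rintegrable P (fun w => (U w - V w) ^+ 2) ->
  mean P (fun w => (U w - V w) ^+ 2) <= delta ^+ 2 ->
  `|mean P (fun w => huberp (U w)) - mean P (fun w => huberp (V w))| <= 2 * delta.
Proof.
move=> d0 sU sV sD dD; have sUV := RintegrableB sU sV.
have sh := RintegrableB (Rintegrable_huberp sU) (Rintegrable_huberp sV).
rewrite -(meanB (Rintegrable_huberp sU) (Rintegrable_huberp sV)).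
apply: (le_trans (le_norm_mean sh)).
have sN := Rintegrable_norm sUV.
apply: (@le_trans _ _ (mean P (fun w => 2 * `|U w - V w|))).
  apply: le_mean (Rintegrable_norm sh) (RintegrableZ 2 sN) _ => w; exact: huberp_lip.
rewrite (meanZ _ sN) ler_pM2l//.
exact: mean_norm_le d0 (Rintegrable_measurable sUV) sD dD.
Qed.

(** [huberp] is a difference of two squares of positive parts, each smoothed with error [4/3 l^2],
    for [U] and for [V]: in all [16/3 l^2]. Four cubes over [6 l] account for the other term. *)
Lemma cube_close_huberp E l U V : 0 < l -> cube_close P E U V ->
  Rintegrable P U -> Rintegrable P V ->
  mean P (fun w => huberp (U w)) <=
  mean P (fun w => huberp (V w)) + (16 / 3 * l ^+ 2 + 2 / 3 / l * E).
Proof.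
move=> l0 hE sU sV; have ln0 : l != 0 by rewrite gt_eqF.
pose c : R := (6 * l)^-1.
have c0 : 0 < c by rewrite invr_gt0 mulr_gt0.
pose S (x : R) := c * (pospart (x - (- l)) ^+ 3 - pospart (x - l) ^+ 3
   - pospart (x - (1 - l)) ^+ 3 + pospart (x - (1 + l)) ^+ 3).
have SE x : `|huberp x - S x| <= 8 / 3 * l ^+ 2.
  have h1 := pospart_sqr_smoothing x l0; have h2 := pospart_sqr_smoothing (x - 1) l0.
  have -> : huberp x - S x =
     ((pospart (x - 1 + l) ^+ 3 - pospart (x - 1 - l) ^+ 3) / (6 * l) - pospart (x - 1) ^+ 2)
     - ((pospart (x + l) ^+ 3 - pospart (x - l) ^+ 3) / (6 * l) - pospart x ^+ 2).
    have e1 : x - (1 - l) = x - 1 + l by ring.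
    have e2 : x - (1 + l) = x - 1 - l by ring.
    by rewrite /S /huberp /c e1 e2 opprK; field.
  by move: h1 h2; rewrite !ler_norml => /andP[? ?] /andP[? ?]; apply/andP; split; lra.
have comb (F : T -> R) : Rintegrable P F ->
    Rintegrable P (fun x => pospart (F x - (- l)) ^+ 3) ->
    Rintegrable P (fun x => pospart (F x - l) ^+ 3) ->
    Rintegrable P (fun x => pospart (F x - (1 - l)) ^+ 3) ->
    Rintegrable P (fun x => pospart (F x - (1 + l)) ^+ 3) ->
    `|mean P (fun w => huberp (F w)) -
      c * (mean P (fun x => pospart (F x - (- l)) ^+ 3)
        - mean P (fun x => pospart (F x - l) ^+ 3)
        - mean P (fun x => pospart (F x - (1 - l)) ^+ 3)
        + mean P (fun x => pospart (F x - (1 + l)) ^+ 3))| <= 8 / 3 * l ^+ 2.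
  move=> sF F1 F2 F3 F4; have F12 := RintegrableB F1 F2; have F123 := RintegrableB F12 F3.
  have F1234 := RintegrableD F123 F4; have sS := RintegrableZ c F1234.
  have sh := Rintegrable_huberp sF; have shS := RintegrableB sh sS.
  rewrite -(meanB F1 F2) -(meanB F12 F3) -(meanD F123 F4) -(meanZ _ F1234) -(meanB sh sS).
  apply: (le_trans (le_norm_mean shS)).
  rewrite -[leRHS](mean_cst P); apply: le_mean (Rintegrable_norm shS) (Rintegrable_cst P _) _ => w.
  exact: SE.
have [U1 V1 E1] := hE (- l); have [U2 V2 E2] := hE l.
have [U3 V3 E3] := hE (1 - l); have [U4 V4 E4] := hE (1 + l).
have hU := comb _ sU U1 U2 U3 U4; have hV := comb _ sV V1 V2 V3 V4.
have -> : 2 / 3 / l * E = c * (4 * E) by rewrite /c; field.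
move: hU hV; rewrite !ler_norml => /andP[_ hU] /andP[hV _].
set a := (X in c * X) in hU; set b := (X in c * X) in hV.
have : c * a <= c * (b + 4 * E).
  apply: ler_wpM2l; first exact: ltW.
  move: E1 E2 E3 E4; rewrite !ler_norml /a /b => /andP[? ?] /andP[? ?] /andP[? ?] /andP[? ?].
  lra.
rewrite [c * (b + _)]mulrDr; move: (c * a) (c * b) (c * (4 * E)) hU hV => ? ? ?; lra.
Qed.

(** Equality of the second moments reduces [zeta] to [-huberp]. As [huberp] is 2-Lipschitz, each of
    the two truncations costs [2 * delta]. *)
Lemma zeta_close E delta l U V U' V' : 0 < l -> 0 < delta -> cube_close P E U' V' ->
  Rintegrable P U -> Rintegrable P V -> Rintegrable P U' -> Rintegrable P V' ->
  Rintegrable P (fun w => U w ^+ 2) -> Rintegrable P (fun w => V w ^+ 2) ->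
  mean P (fun w => U w ^+ 2) = mean P (fun w => V w ^+ 2) ->
  Rintegrable P (fun x => (U x - U' x) ^+ 2) -> Rintegrable P (fun x => (V x - V' x) ^+ 2) ->
  mean P (fun x => (U x - U' x) ^+ 2) <= delta ^+ 2 ->
  mean P (fun x => (V x - V' x) ^+ 2) <= delta ^+ 2 ->
  `|mean P (fun w => zeta (U w)) - mean P (fun w => zeta (V w))|
    <= 4 * delta + (16 / 3 * l ^+ 2 + 2 / 3 / l * E).
Proof.
move=> l0 d0 hE sU sV sU' sV' sU2 sV2 UV2 sdU sdV dU dV.
rewrite (mean_zeta sU sU2).2 (mean_zeta sV sV2).2 UV2.
have := mean_huberp_le d0 sU sU' sdU dU; have := mean_huberp_le d0 sV sV' sdV dV.
have := cube_close_huberp l0 hE sU' sV'.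
have := cube_close_huberp l0 (cube_close_sym hE) sV' sU'.
rewrite !ler_norml => ? ? /andP[? ?] /andP[? ?]; apply/andP; split; lra.
Qed.

Lemma mean_huberp_bounds U (mu : R) : Rintegrable P U ->
  Rintegrable P (fun w => (U w - mu) ^+ 2) -> mean P (fun w => U w - mu) = 0 ->
  mean P (fun w => (U w - mu) ^+ 2) <= 1 ->
  [/\ `|mu - 2^-1| <= mean P (fun w => huberp (U w)) - (mu - 2^-1),
      4^-1 <= mean P (fun w => huberp (U w)) - (mu - 2^-1)
    & forall s, 1 <= s -> mean P (fun w => huberp (U w)) - (mu - 2^-1)
        <= (1 + (mu - 2^-1) ^+ 2) / (2 * s) + s / 2].
Proof.
move=> sU sU2 U0 U2; have sh := Rintegrable_huberp sU.
have sc (a : R) := Rintegrable_cst P a.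
have sUh := RintegrableB sU (sc 2^-1).
have Umu : mean P U = mu.
  by have := meanB sU (sc mu); rewrite U0 mean_cst => /esym/eqP; rewrite subr_eq0 => /eqP.
have Uh : mean P (fun w => U w - 2^-1) = mu - 2^-1 by rewrite (meanB sU (sc _)) Umu mean_cst.
have shU := RintegrableB sh sUh.
have hh : mean P (fun w => huberp (U w) - (U w - 2^-1)) =
    mean P (fun w => huberp (U w)) - (mu - 2^-1) by rewrite (meanB sh sUh) Uh.
rewrite -hh; split.
- rewrite -Uh; apply: (le_trans (le_norm_mean sUh)).
  by apply: le_mean (Rintegrable_norm sUh) shU _ => w; have [] := huberp_ge (U w).
- rewrite -[leLHS](mean_cst P); apply: le_mean (sc _) shU _ => w.
  by have [] := huberp_ge (U w).
move=> s s1.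
have smu := RintegrableB sU (sc mu).
have sL := RintegrableZ (2 * (mu - 2^-1)) smu.
have sQ := RintegrableD sU2 sL; have sQ1 := RintegrableD sQ (sc ((mu - 2^-1) ^+ 2)).
have sQ2 := RintegrableZ (2 * s)^-1 sQ1; have sQ3 := RintegrableD sQ2 (sc (s / 2)).
apply: le_trans (le_mean shU sQ3 _) _ => [w|].
  apply: (le_trans (huberp_le (U w) s1)); rewrite lerD2r mulrC.
  rewrite le_eqVlt; apply/orP; left; apply/eqP; congr (_ * _); ring.
rewrite (meanD sQ2 (sc _)) (meanZ _ sQ1) (meanD sQ (sc _)) (meanD sU2 sL) (meanZ _ smu).
rewrite !mean_cst U0 mulr0 addr0 lerD2r mulrC.
apply: ler_wpM2r; first by rewrite invr_ge0; lra.
by rewrite lerD2r.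
Qed.

(** With [h = mu - 1/2], both [p - h] and [q - h] lie between [max(|h|, 1/4)] and the upper bound
    for a suitable [s]. For [|h| <= 1] the choice [s = 1] gives an interval of length at most
    [25/32]; for [|h| > 1] the choice [s = |h|] gives [1 / (2 |h|)]. *)
Lemma zeta_close_nine_tenths U V mu : Rintegrable P U -> Rintegrable P V ->
  Rintegrable P (fun w => U w ^+ 2) -> Rintegrable P (fun w => V w ^+ 2) ->
  mean P (fun w => U w ^+ 2) = mean P (fun w => V w ^+ 2) ->
  Rintegrable P (fun w => (U w - mu) ^+ 2) -> Rintegrable P (fun w => (V w - mu) ^+ 2) ->
  mean P (fun w => U w - mu) = 0 -> mean P (fun w => V w - mu) = 0 ->
  mean P (fun w => (U w - mu) ^+ 2) <= 1 -> mean P (fun w => (V w - mu) ^+ 2) <= 1 ->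
  `|mean P (fun w => zeta (U w)) - mean P (fun w => zeta (V w))| <= 9 / 10.
Proof.
move=> sU sV sU2 sV2 UV2 sUm sVm U0 V0 U1 V1.
rewrite (mean_zeta sU sU2).2 (mean_zeta sV sV2).2 UV2.
have [a1 a2 a3] := mean_huberp_bounds sU sUm U0 U1.
have [b1 b2 b3] := mean_huberp_bounds sV sVm V0 V1.
move: a1 a2 a3 b1 b2 b3; set p := mean P _; set q := mean P _.
set h := mu - 2^-1; move=> a1 a2 a3 b1 b2 b3.
have [h1|h1] := leP `|h| 1.
  have := a3 1 (lexx _); have := b3 1 (lexx _).
  have E : (1 + h ^+ 2) / (2 * 1) + 1 / 2 = 1 + `|h| ^+ 2 / 2 :> R.
    by rewrite real_normK ?num_real//; field.
  rewrite !E => b3' a3'.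
  have h0 : 0 <= `|h| by [].
  have [h4|h4] := leP `|h| 4^-1.
    have : `|h| ^+ 2 <= 4^-1 ^+ 2 by rewrite lerXn2r ?nnegrE.
    by move=> ?; rewrite ler_norml; apply/andP; split; lra.
  have : 0 <= (`|h| - 4^-1) * (1 - `|h|) by rewrite mulr_ge0; lra.
  by move=> ?; rewrite ler_norml; apply/andP; split; lra.
have := a3 _ (ltW h1); have := b3 _ (ltW h1).
have hn : `|h| != 0 by rewrite gt_eqF//; lra.
have E : (1 + h ^+ 2) / (2 * `|h|) + `|h| / 2 = `|h| + 2^-1 * `|h|^-1.
  by rewrite -(real_normK (num_real h)); field; rewrite normr_eq0 in hn *.
rewrite !E => b3' a3'.
have : `|h|^-1 <= 1 by rewrite invf_le1; lra.
by move=> ?; rewrite ler_norml; apply/andP; split; lra.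
Qed.

End ZetaEstimates.

(** * Choice of the parameters *)

(* The polynomial is truncated at degree about 2^-8 log(1/tau) / K. *)
Definition truncation_rate {R : realType} : R := 2^-1 ^+ 8.

Lemma truncation_rate_gt0 {R : realType} : 0 < truncation_rate :> R.
Proof. by rewrite exprn_gt0// invr_gt0. Qed.

(** Here [168 = 8 * 7 * 3]: [eta^-1 <= expR (7 K)] is raised to the power [3 D] and has to stay
    below [expR (L / 8)]. *)
Lemma truncation_rate_le {R : realType} : 168 * truncation_rate <= 1 :> R.
Proof. by rewrite /truncation_rate !exprS expr0; lra. Qed.

Section LinearBounds.
Context {R : realType}.
Implicit Types a b e : R.

Lemma linear_bound1 a b e : 0 < e -> 168 * e <= 1 -> a <= 10 * b -> 0 < b ->
  a * e <= 1 + b / 8.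
Proof.
move=> e0 e1 ab b0; have := ler_wpM2r (ltW e0) ab; have := ler_wpM2r (ltW b0) e1; lra.
Qed.

Lemma linear_bound2 a b e : 0 < e -> 168 * e <= 1 -> a <= 10 * b -> 0 < b ->
  b / 8 + (- (b / 2) + b / 8) <= - (a * e).
Proof.
move=> e0 e1 ab b0; have := ler_wpM2r (ltW e0) ab; have := ler_wpM2r (ltW b0) e1; lra.
Qed.

Lemma linear_bound3 a b e : 0 < e -> 168 * e <= 1 -> 0 < b -> a <= b * e ->
  7 * (3 * a) <= b / 8.
Proof.
by move=> e0 e1 b0 ab; have := ler_wpM2r (ltW b0) e1; lra.
Qed.

End LinearBounds.

Section ErrorTerms.
Context {R : realType}.
Variables (tau K eta gamma : R).
Hypothesis tau01 : 0 < tau < 1.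
Hypothesis K_ge : 10^-1 <= K.
Hypothesis eta01 : 0 < eta <= 1.
Hypothesis eta_K : eta^-1 <= expR (7 * K).
Hypothesis gamma01 : 0 < gamma < 1.

Let L := ln tau^-1.
Let q := gamma * L / K.
Let e : R := truncation_rate.
Let e0 : 0 < e := truncation_rate_gt0.
Let e1 : 168 * e <= 1 := truncation_rate_le.

Definition truncation_degree : nat := Num.truncn (L / K * e).
(** The fourth root of [expR (- (q * e))], which is the order of both the replacement and the
    truncation errors. Smoothing at this scale costs three of the four powers. *)
Definition rate : R := expR (- (q * (e / 4))).

Let K0 : 0 < K. Proof. by apply: lt_le_trans K_ge; rewrite invr_gt0. Qed.

Let L0 : 0 < L.
Proof. by case/andP: tau01 => t0 t1; rewrite ln_gt0// invf_gt1. Qed.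

Let tauE : tau = expR (- L).
Proof. by case/andP: tau01 => t0 t1; rewrite expRN expR_ln_inv// invrK. Qed.

Let invK : K^-1 <= 10.
Proof. by rewrite -[X in _ <= X]invrK lef_pV2// posrE ?invr_gt0. Qed.

Let LK0 : 0 <= L / K.
Proof. by rewrite divr_ge0// ltW. Qed.

Let D_le : truncation_degree%:R <= L / K * e.
Proof. by rewrite truncn_le// mulr_ge0// ltW. Qed.

Let D_gt : L / K * e < truncation_degree%:R + 1.
Proof. by rewrite natr1 truncnS_gt. Qed.

Lemma truncation_degree_le : truncation_degree%:R <= L / K.
Proof.
apply: le_trans D_le _; rewrite ler_piMr//; move: e1 (ltW e0).
by move: (e) => x; lra.
Qed.

Let LK_le : L / K <= 10 * L.
Proof. by rewrite mulrC ler_wpM2r// ltW. Qed.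

Let q0 : 0 < q.
Proof. by case/andP: gamma01 => g0 g1; rewrite divr_gt0// mulr_gt0. Qed.

Let q_le : q <= 10 * L.
Proof.
case/andP: gamma01 => g0 g1; apply: le_trans LK_le.
by rewrite /q -mulrA ler_piMl ?(ltW g1).
Qed.

Lemma rate_gt0 : 0 < rate. Proof. exact: expR_gt0. Qed.

Lemma rate_le1 : rate <= 1.
Proof.
have e4 : 0 < e / 4 by rewrite divr_gt0.
by rewrite -[leRHS]expR0 ler_expR oppr_le0 mulr_ge0 ?(ltW q0) ?(ltW e4).
Qed.

Let rate4 : rate ^+ 4 = expR (- (q * e)).
Proof. by rewrite -expRM_natr; congr expR; field. Qed.

(** The gain [sqrt(tau) = expR (- L / 2)] pays for two losses of at most [expR (L / 8)], one from
    [eta^(-3D)] and one from [D]. What remains, [expR (- L / 4)], is below [expR (- q e)] because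
    [q <= 10 L]. *)
Lemma invariance_error_le :
  2 * eta^-1 ^+ (3 * truncation_degree) * Num.sqrt tau * truncation_degree%:R
    <= 2 * rate ^+ 4.
Proof.
set D := truncation_degree.
case/andP: eta01 => eta0 eta1.
have h1 : eta^-1 ^+ (3 * D) <= expR (L / 8).
  apply: (@le_trans _ _ (expR (7 * K) ^+ (3 * D))).
    by rewrite lerXn2r ?nnegrE ?invr_ge0 ?expR_ge0// ltW.
  rewrite -expRM_natr ler_expR natrM.
  have hD : D%:R * K <= L * e.
    have := ler_wpM2r (ltW K0) D_le; rewrite -/D.
    by have -> : L / K * e * K = L * e by field; rewrite gt_eqF.
  have -> : 7 * K * (3%:R * D%:R) = 7 * (3 * (D%:R * K)) by ring.
  exact: linear_bound3 e0 e1 L0 hD.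
have h2 : Num.sqrt tau = expR (- (L / 2)).
  have -> : tau = expR (- (L / 2)) ^+ 2.
    by rewrite {1}tauE -expRM_natr; congr expR; field.
  by rewrite sqrtr_sqr ger0_norm// expR_ge0.
have h3 : D%:R <= expR (L / 8).
  apply: le_trans D_le _; apply: le_trans (expR_ge1Dx _).
  exact: linear_bound1 e0 e1 LK_le L0.
rewrite h2 -!mulrA ler_pM2l// rate4.
apply: (@le_trans _ _ (expR (L / 8) * (expR (- (L / 2)) * expR (L / 8)))).
  have E0 := expR_ge0 (- (L / 2)).
  apply: ler_pM; [|exact: mulr_ge0|exact: h1|exact: ler_wpM2l].
  by rewrite exprn_ge0// invr_ge0 ltW.
by rewrite -!expRD ler_expR; exact: linear_bound2 e0 e1 q_le L0.
Qed.

(** Rounding the degree down loses less than one unit, that is a factor of at most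
    [expR gamma <= expR 1 <= 4]. *)
Lemma truncation_error_le : (1 - gamma) ^+ truncation_degree <= 4 * rate ^+ 4.
Proof.
set D := truncation_degree; case/andP: gamma01 => g0 g1.
apply: (@le_trans _ _ (expR (- gamma) ^+ D)).
  apply: lerXn2r; rewrite ?nnegrE ?expR_ge0 ?subr_ge0 ?(ltW g1)//.
  exact: expR_ge1Dx.
rewrite -expRM_natr rate4.
apply: (@le_trans _ _ (expR (1 + - (q * e)))).
  rewrite ler_expR.
  have : gamma * (L / K * e) <= gamma * (D%:R + 1) by rewrite ler_pM2l// ltW.
  have -> : gamma * (L / K * e) = q * e by rewrite /q; ring.
  by move: (q * e) => y; lra.
rewrite expRD ler_pM2r ?expR_gt0//.
have -> : 1 = 2^-1 * 2%:R :> R by field.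
rewrite expRM_natr; apply: le_trans (_ : 2 ^+ 2 <= _); last by lra.
by rewrite lerXn2r ?nnegrE ?expR_ge0// expR_half_le2.
Qed.

Lemma powR_rate : (tau `^ (e / 4 / 16 / 8 * gamma / K)) ^+ 16 ^+ 8 = rate.
Proof.
case/andP: tau01 => t0 t1.
rewrite -exprM -powR_mulrn ?powR_ge0// -powRrM /powR gt_eqF// /rate; congr expR.
have -> : ln tau = - L by rewrite /L lnV ?opprK// posrE.
by rewrite natrM /q; field; rewrite gt_eqF.
Qed.

End ErrorTerms.

(* All error terms are at most 23 times the 128-th power of the target bound p;
   this absorbs the constant, unless p is close to 1, where cruder bounds apply. *)
Lemma power_bound {R : realType} (p : R) : 0 <= p -> p <= 9 / 10 ->
  23 * p ^+ 16 ^+ 8 <= p.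
Proof.
move=> p0 p9; have p1 : p <= 1 by lra.
have pw (x y : R) k : 0 <= x -> x <= y -> x ^+ k <= y ^+ k.
  by move=> x0 xy; rewrite lerXn2r ?nnegrE ?(le_trans x0).
have p4 : p ^+ 4 <= 2 / 3.
  by apply: le_trans (pw _ _ 4 p0 p9) _; rewrite !exprS expr0; lra.
have p16 : p ^+ 16 <= 4^-1.
  rewrite (exprM p 4 4); apply: le_trans (pw _ _ 4 (exprn_ge0 4 p0) p4) _.
  by rewrite !exprS expr0; lra.
have p16p : p ^+ 16 <= p by rewrite exprS ler_piMr// exprn_ile1.
have x0 : 0 <= p ^+ 16 by exact: exprn_ge0.
move: (p ^+ 16) x0 p16 p16p => x x0 x4 xp.
rewrite exprS mulrCA; apply: le_trans xp; rewrite ler_piMr//.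
have := pw _ _ 7 x0 x4; rewrite [X in _ <= X -> _](_ : _ = 4^-1 ^+ 7)// => h.
have : 4^-1 ^+ 7 <= 23^-1 :> R by rewrite !exprS expr0; lra.
lra.
Qed.

(** * Assembling the bounds for a polynomial with decaying tails *)

Section Conclusion.
Context {d : measure_display} {T : measurableType d} {R : realType}.
Variable P : probability T R.
Context {n : nat} {m : 'I_n -> nat}.
Implicit Types (X Y : rv_families P m) (Q : mlpoly R m).

Definition truncate (D : nat) Q : mlpoly R m :=
  fun s => if (msupp_size s <= D)%N then Q s else 0.

(** Serves both to center a polynomial and to obtain [(x - k)_+^3] from the single test function
    [x_+^3]; influences are unaffected. *)
Definition shift (a : R) Q : mlpoly R m :=
  fun s => Q s - (if s == multi_index0 then a else 0).

Lemma eval_shift a Q x : (forall i, x i ord0 = 1) -> eval (shift a Q) x = eval Q x - a.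
Proof.
move=> x1; rewrite /eval /shift.
under eq_bigr do rewrite mulrBl.
rewrite sumrB; congr (_ - _).
rewrite (bigD1 multi_index0)//= eqxx monomial0// mulr1 big1 ?addr0//.
by move=> s /negPf ->; rewrite mul0r.
Qed.

Lemma eval_truncate D Q x : eval Q x - eval (truncate D Q) x = eval (mlpoly_gt D Q) x.
Proof.
rewrite /eval -sumrB; apply: eq_bigr => s _; rewrite -mulrBl; congr (_ * _).
by rewrite /truncate /mlpoly_gt leqNgt; case: (D < _)%N; rewrite ?subr0 ?subrr.
Qed.

Lemma mlpoly_varE Q : Q multi_index0 = 0 -> mlpoly_var Q = sqnorm Q.
Proof.
move=> Q0; rewrite /mlpoly_var big_mkcond/=; apply: eq_bigr => s _.
rewrite msupp_size_gt0; case: eqP => // ->.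
by rewrite Q0 expr0n.
Qed.

Lemma mlpoly_var_shift a Q : mlpoly_var (shift a Q) = mlpoly_var Q.
Proof.
rewrite /mlpoly_var; apply: eq_bigr => s; rewrite msupp_size_gt0 /shift => /negPf ->.
by rewrite subr0.
Qed.

Lemma sqnorm_mlpoly_gt D Q : sqnorm (mlpoly_gt D Q) = mlpoly_var (mlpoly_gt D Q).
Proof. by rewrite mlpoly_varE// /mlpoly_gt msupp_size0. Qed.

Lemma degree_shift_truncate a D Q : degree_le D (shift a (truncate D Q)).
Proof.
move=> s Ds; rewrite /shift /truncate leqNgt Ds /=.
have : s != multi_index0 by rewrite -msupp_size_gt0 (leq_trans _ Ds).
by move=> /negPf ->; rewrite subr0.
Qed.

Lemma mlpoly_var_truncate D Q : mlpoly_var (truncate D Q) <= mlpoly_var Q.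
Proof.
apply: ler_sum => s _; rewrite /truncate; case: ifP => // _.
by rewrite expr0n sqr_ge0.
Qed.

Lemma influence_shift_truncate a (D : nat) (l : R) k Q : D%:R <= l ->
  sqnorm (dependent_part k (shift a (truncate D Q))) <= mlpoly_inf_le l k Q.
Proof.
move=> Dl; rewrite /sqnorm /mlpoly_inf_le [leRHS]big_mkcond/=.
apply: ler_sum => s _; rewrite /dependent_part /shift /truncate.
have [sk|sk] := boolP (s k != ord0); last by rewrite expr0n andbF.
have s0 : s != multi_index0 by apply: contraNneq sk => ->; rewrite ffunE.
rewrite (negPf s0) subr0 andbT; have [sD|_] := leqP (msupp_size s) D.
  by rewrite (le_trans _ Dl)// ler_nat.
by rewrite expr0n; case: ifP => // _; exact: sqr_ge0.
Qed.

Lemma measurable_mlpoly_eval Q X : ensemble_seq X ->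
  measurable_fun setT (mlpoly_eval Q X).
Proof.
move=> eX; have iX := ensemble_seq_independent eX.
exact: (measurable_eval Q (ie_measurable iX)).
Qed.

Lemma mlpoly_eval_moments Q X : ensemble_seq X ->
  let mu := Q multi_index0 in
  [/\ Rintegrable P (mlpoly_eval Q X), Rintegrable P (fun w => mlpoly_eval Q X w ^+ 2),
      mean P (fun w => mlpoly_eval Q X w ^+ 2) = sqnorm Q,
      mean P (fun w => mlpoly_eval Q X w - mu) = 0 &
      Rintegrable P (fun w => (mlpoly_eval Q X w - mu) ^+ 2) /\
      mean P (fun w => (mlpoly_eval Q X w - mu) ^+ 2) = mlpoly_var Q].
Proof.
move=> eX mu; have iX := ensemble_seq_independent eX.
have sQ := Rintegrable_eval Q iX.
have E w : eval (shift mu Q) (at_point (plain X) w) ^+ 2 = (mlpoly_eval Q X w - mu) ^+ 2.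
  by rewrite eval_shift// => i; exact: ie_one iX i w.
split; first exact: sQ.
- exact: (Rintegrable_eval_sqr Q iX).
- exact: (mean_eval_sqr Q iX).
- by rewrite (meanB sQ (Rintegrable_cst P mu)) mean_cst (mean_eval Q iX) subrr.
split; first exact: (Rintegrable_ext E (Rintegrable_eval_sqr _ iX)).
rewrite -(mean_ext P E) (mean_eval_sqr _ iX) -mlpoly_varE ?mlpoly_var_shift//.
by rewrite /shift eqxx subrr.
Qed.

Lemma levy_dist_self U (l : R) : measurable_fun setT U -> 0 < l -> levy_dist P U U <= l.
Proof.
move=> mU l0.
suff h t : fine (P [set w | U w <= t - l]) - l <= fine (P [set w | U w <= t]).
  by apply: levy_dist_le.
have : fine (P [set w | U w <= t - l]) <= fine (P [set w | U w <= t]).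
  rewrite -lee_fin -!probability_fineK; [|exact: measurable_le_set..].
  apply: le_measure; rewrite ?inE; [exact: measurable_le_set..|].
  by move=> w /= h; lra.
by lra.
Qed.

Lemma close_lawsP (eps : R) Q X Y : ensemble_seq X -> ensemble_seq Y ->
  levy_dist P (mlpoly_eval Q X) (mlpoly_eval Q Y) <= eps ->
  `|mean P (fun w => zeta (mlpoly_eval Q X w))
    - mean P (fun w => zeta (mlpoly_eval Q Y w))| <= eps ->
  close_laws P eps (mlpoly_eval Q X) (mlpoly_eval Q Y).
Proof.
move=> eX eY hl hz; split=> //.
have [sX sX2 _ _ _] := mlpoly_eval_moments Q eX.
have [sY sY2 _ _ _] := mlpoly_eval_moments Q eY.
rewrite (expectation_mean (mean_zeta sX sX2).1) (expectation_mean (mean_zeta sY sY2).1).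
by rewrite -EFinB abse_EFin lee_fin.
Qed.

Lemma close_laws_truncated (r : nat) X Y Q (K tau gamma : R) :
  ensemble_seq X -> ensemble_seq Y -> hypothesis_H134 r X Y K ->
  0 < tau < 1 -> mlpoly_var Q <= 1 ->
  (forall i, mlpoly_inf_le (ln tau^-1 / K) i Q <= tau) -> 0 < gamma < 1 ->
  (forall e : nat, mlpoly_var (mlpoly_gt e Q) <= (1 - gamma) ^+ (2 * e)) ->
  close_laws P (tau `^ (truncation_rate / 4 / 16 / 8 * gamma / K))
    (mlpoly_eval Q X) (mlpoly_eval Q Y).
Proof.
move=> eX eY hXY tau01 varQ infQ gamma01 tailQ.
have iX := ensemble_seq_independent eX; have iY := ensemble_seq_independent eY.
have [tau0 tau1] := andP tau01.
set p := tau `^ _; have p0 : 0 < p by exact: powR_gt0.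
have mU := measurable_mlpoly_eval Q eX; have mV := measurable_mlpoly_eval Q eY.
have [sX sX2 mX2 X0 [sXm mXm]] := mlpoly_eval_moments Q eX.
have [sY sY2 mY2 Y0 [sYm mYm]] := mlpoly_eval_moments Q eY.
(* When all variables are constant, both evaluations are the same function. *)
case: (hypothesis_H134_cube eX eY hXY) => [m0|[eta [eta01 etaK K_ge hcX hcY]]].
  have -> : mlpoly_eval Q X = mlpoly_eval Q Y.
    apply/funext => w; apply: eq_bigr => s _; congr (_ * _); apply: eq_bigr => i _.
    have -> : s i = ord0.
      by apply: val_inj => /=; have := ltn_ord (s i); rewrite {2}m0; case: (val _).
    by rewrite [LHS](ie_one iX i w) [RHS](ie_one iY i w).
  apply: close_lawsP => //; first exact: levy_dist_self.
  by rewrite subrr normr0 ltW.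
(* Above [9/10] the multiplicative constants cannot be absorbed, but there the bounds from the first
   two moments suffice. *)
have [p9|p9] := leP p (9 / 10); last first.
  have le9 : 9 / 10 <= p by exact: ltW.
  apply: close_lawsP => //; apply: le_trans le9.
    by apply: (@levy_dist_le_nine_tenths _ _ _ P _ _ (Q multi_index0));
      rewrite ?mXm ?mYm.
  by apply: (@zeta_close_nine_tenths _ _ _ P _ _ (Q multi_index0));
    rewrite ?mXm ?mYm ?mX2 ?mY2.
set z := rate tau K gamma.
have zp : 23 * z <= p.
  by rewrite /z -(powR_rate gamma tau01 K_ge); exact: power_bound (ltW p0) p9.
have z0 : 0 < z by exact: rate_gt0.
have z1 : z <= 1 by exact: rate_le1.
pose D := truncation_degree tau K.
pose Q' := truncate D Q.
have DL : D%:R <= ln tau^-1 / K by exact: truncation_degree_le.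
have cX : cube_hypercontractive P eta (plain X) by [].
have delta0 : 0 < 4 * z ^+ 4 by rewrite mulr_gt0// exprn_gt0.
have tail (Z : rv_families P m) (eZ : ensemble_seq Z) :
    Rintegrable P (fun w => (mlpoly_eval Q Z w - mlpoly_eval Q' Z w) ^+ 2) /\
    mean P (fun w => (mlpoly_eval Q Z w - mlpoly_eval Q' Z w) ^+ 2) <= (4 * z ^+ 4) ^+ 2.
  have iZ := ensemble_seq_independent eZ.
  have E w : eval (mlpoly_gt D Q) (at_point (plain Z) w) ^+ 2 =
      (mlpoly_eval Q Z w - mlpoly_eval Q' Z w) ^+ 2 by rewrite -eval_truncate.
  have sE := Rintegrable_eval_sqr (mlpoly_gt D Q) iZ.
  split; first exact: (Rintegrable_ext E sE).
  rewrite -(mean_ext P E) (mean_eval_sqr _ iZ) sqnorm_mlpoly_gt.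
  apply: (le_trans (tailQ D)); rewrite mulnC exprM.
  have [g0 g1] := andP gamma01.
  apply: lerXn2r; rewrite ?nnegrE ?(ltW delta0) ?exprn_ge0 ?subr_ge0 ?(ltW g1)//.
  exact: truncation_error_le.
have [sdX dX] := tail _ eX; have [sdY dY] := tail _ eY.
have eta_neq0 : eta != 0 by have /andP[h _] := eta01; rewrite gt_eqF.
have close : cube_close P (2 * z ^+ 4) (mlpoly_eval Q' X) (mlpoly_eval Q' Y).
  move=> k; have E (Z : rv_families P m) (eZ : ensemble_seq Z) w :
      pospart (eval (shift k Q') (at_point (plain Z) w)) ^+ 3
      = pospart (mlpoly_eval Q' Z w - k) ^+ 3.
    by rewrite eval_shift// => i; exact: ie_one (ensemble_seq_independent eZ) i w.
  have sk (Z : rv_families P m) (eZ : ensemble_seq Z) : cube_hypercontractive P eta (plain Z) ->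
      Rintegrable P (fun w => pospart (eval (shift k Q') (at_point (plain Z) w)) ^+ 3).
    move=> hZ; have iZ := ensemble_seq_independent eZ.
    apply: (Rintegrable_dominated _ (cube_hypercontractive_Rintegrable eta_neq0 hZ (shift k Q'))).
      apply: measurable_funX; apply: (measurableT_comp measurable_pospart).
      exact: (measurable_eval _ (ie_measurable iZ)).
    by move=> w; rewrite normrX ger0_norm ?pospart_ge0// lerXn2r ?nnegrE ?pospart_ge0
       ?pospart_le_norm.
  split; [exact: (Rintegrable_ext (E X eX) (sk X eX hcX))|
          exact: (Rintegrable_ext (E Y eY) (sk Y eY hcY))|].
  rewrite -(mean_ext P (E X eX)) -(mean_ext P (E Y eY)).
  have infl i : sqnorm (dependent_part i (shift k Q')) <= tau.
    exact: le_trans (influence_shift_truncate k i Q DL) (infQ i).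
  apply: (le_trans (invariance_cube iX iY eta01 hcX hcY
    (@degree_shift_truncate k D Q) infl)).
  apply: (@le_trans _ _ (2 * eta^-1 ^+ (3 * D) * Num.sqrt tau * D%:R)); last first.
    exact: invariance_error_le.
  have /andP[h _] := eta01.
  apply: ler_wpM2l.
    by rewrite !mulr_ge0 ?sqrtr_ge0// exprn_ge0// invr_ge0 ltW.
  rewrite mlpoly_var_shift ler_piMr//.
  exact: le_trans (mlpoly_var_truncate D Q) varQ.
have zpow k : z ^+ k.+1 <= z.
  by rewrite exprS ler_piMr ?(ltW z0)// exprn_ile1 ?(ltW z0).
have zn : z != 0 by rewrite gt_eqF.
have w0 : 0 < 2 * z by rewrite mulr_gt0.
(* [levy_half] is used at [w = 2 z] with [delta = (4 z^4)^2]: the left side is [8 z^6 + z / 3], well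
   below the shift [10 z]. *)
have hw : 2 * (4 * z ^+ 4) ^+ 2 / (2 * z) ^+ 2 + 4 / 3 / (2 * z) ^+ 3 * (2 * z ^+ 4)
    <= 5 * (2 * z).
  have -> : 2 * (4 * z ^+ 4) ^+ 2 / (2 * z) ^+ 2 + 4 / 3 / (2 * z) ^+ 3 * (2 * z ^+ 4)
    = 8 * z ^+ 6 + 3^-1 * z by field.
  by have := zpow 5%N; move: (z ^+ 6) z0 => y y0; lra.
apply: close_lawsP => //.
  apply: le_trans (_ : 5 * (2 * z) <= _); last by lra.
  apply: levy_dist_le => //; first by rewrite mulr_gt0.
    exact: (levy_half w0 close mU mV sdX sdY dX dY hw).
  exact: (levy_half w0 (cube_close_sym close) mV mU sdY sdX dY dX hw).
have [sX' _ _ _ _] := mlpoly_eval_moments Q' eX.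
have [sY' _ _ _ _] := mlpoly_eval_moments Q' eY.
have XY2 : mean P (fun w => mlpoly_eval Q X w ^+ 2) = mean P (fun w => mlpoly_eval Q Y w ^+ 2).
  by rewrite mX2 mY2.
(* With smoothing scale [l = z] the total is [16 z^4 + (16/3) z^2 + (4/3) z^3], hence at most
   [23 z]; this is the origin of the constant in [power_bound]. *)
apply: (le_trans (zeta_close z0 delta0 close sX sY sX' sY' sX2 sY2 XY2 sdX sdY dX dY)).
have -> : 2 / 3 / z * (2 * z ^+ 4) = 4 / 3 * z ^+ 3 by field.
have := zpow 1%N; have := zpow 2%N; have := zpow 3%N.
move: (z ^+ 4) (z ^+ 3) (z ^+ 2) zp z0 => a b c; lra.
Qed.

End Conclusion.

Theorem theorem3p20 (R : realType) (r : nat) :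
  exists2 c : R, 0 < c &
  forall (d : measure_display) (T : measurableType d) (P : probability T R)
    (n : nat) (m : 'I_n -> nat) (X Y : rv_families P m) (Q : mlpoly R m)
    (K tau gamma : R),
    ensemble_seq X -> ensemble_seq Y ->
    hypothesis_H134 r X Y K ->
    0 < tau < 1 ->
    mlpoly_var Q <= 1 ->
    (forall i : 'I_n, mlpoly_inf_le (ln tau^-1 / K) i Q <= tau) ->
    0 < gamma < 1 ->
    close_laws P (tau `^ (c * gamma / K))
      (mlpoly_eval (noise_op (1 - gamma) Q) X)
      (mlpoly_eval (noise_op (1 - gamma) Q) Y) /\
    ((forall e : nat,
        mlpoly_var (mlpoly_gt e Q) <= (1 - gamma) ^+ (2 * e)) ->
     close_laws P (tau `^ (c * gamma / K)) (mlpoly_eval Q X) (mlpoly_eval Q Y)).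
Proof.
(* The divisor 4 comes from the definition of [rate], and [16 * 8] is the power spent in
   [power_bound]. Since only third moments are used, the constant is the same for every [r]. *)
exists (truncation_rate / 4 / 16 / 8).
  by rewrite !divr_gt0// truncation_rate_gt0.
move=> d T P n m X Y Q K tau gamma eX eY hXY tau01 varQ infQ gamma01.
split; last exact: close_laws_truncated hXY tau01 varQ infQ gamma01.
have /andP[g0 g1] := gamma01.
set rho := 1 - gamma.
have rho0 : 0 <= rho by rewrite subr_ge0 ltW.
have rho1 : rho <= 1 by rewrite gerBl ltW.
have noise_le s : noise_op rho Q s ^+ 2 <= Q s ^+ 2.
  by rewrite /noise_op exprMn ler_piMl ?sqr_ge0// exprn_ile1 ?exprn_ge0// exprn_ile1.
apply: (close_laws_truncated eX eY hXY tau01 _ _ gamma01).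
- by apply: le_trans varQ; apply: ler_sum => s _.
- by move=> i; apply: le_trans (infQ i); apply: ler_sum => s _.
(* The noise operator itself produces the decay of tails: a term with [|s| > e] acquires the factor
   [rho^(2 |s|) <= rho^(2 e)]. *)
move=> e; rewrite -/rho; apply: (@le_trans _ _ (rho ^+ (2 * e) * mlpoly_var Q)).
  rewrite /mlpoly_var mulr_sumr; apply: ler_sum => s _; rewrite /mlpoly_gt.
  case: ifPn => es; last by rewrite expr0n/= mulr_ge0 ?sqr_ge0 ?exprn_ge0.
  rewrite /noise_op exprMn -exprM; apply: ler_wpM2r; first exact: sqr_ge0.
  by rewrite mulnC ler_wiXn2l// leq_mul2l ltnW.
by rewrite ler_piMr// exprn_ge0.
Qed.
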